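(* Let $\Omega\subset\mathbb{C}^n$ be a convexifiable strongly Goldilocks domain. Then there exists a constant $c>0$ such that for all $x,y\in\Omega$, $$k_\Omega(x,y)\ge\frac12\log\left(\frac{\delta_\Omega(y)}{\delta_\Omega(x)}\right)-c.$$
   Context: $\delta_\Omega(x)=\inf\{\|x-y\|:y\in\partial\Omega\}$; $\kappa_\Omega$ is the Kobayashi–Royden pseudometric and $k_\Omega$ the Kobayashi distance. $\Omega$ is convexifiable if for every $p\in\partial\Omega$ there is a neighbourhood $U_p$ and a biholomorphism $\Phi$ from $U_p$ onto an open set with $\Phi(\Omega\cap U_p)$ convex. $\Omega$ is strongly Goldilocks (SG) if it is bounded, its boundary is Dini-smooth (inner unit normal Dini-continuous near every boundary point), and there exist $c_0>0$ and $\omega_\Omega:(0,\infty)\to(0,\infty)$ with $\kappa_\Omega(x;v)\ge \frac{c_0\|v\|}{\omega_\Omega(\delta_\Omega(x))}$ for all $x\in\Omega,v\in\mathbb{C}^n$, where (a) $\omega_\Omega(x)/x$ is decreasing, (b) $\omega_\Omega(x)\log(\omega_\Omega(x)/x)$ is increasing, (c) $\int_0^\epsilon\frac{\omega_\Omega(x)}{x}\log\left(\frac{\omega_\Omega(x)}{x}\right)dx<\infty$ for every $\epsilon>0$. *)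

(* Defs.v *)
From HB Require Import structures.
From mathcomp Require Import all_boot all_order all_algebra.
From mathcomp Require Import all_classical all_reals all_analysis.
From mathcomp Require Import complex.
Import Order.TTheory GRing.Theory Num.Theory.
Import numFieldNormedType.Exports.

Set Implicit Arguments.
Unset Strict Implicit.
Unset Printing Implicit Defensive.

Local Open Scope ring_scope.
Local Open Scope classical_set_scope.

(* The complex numbers over a real field R, seen as a numClosedFieldType so   *)
(* that MathComp-Analysis equips C and C^n with their (complex) normed-module *)
(* structures: [differentiable] on these spaces is complex (Fréchet)          *)
(* differentiability, i.e. holomorphy.                                        *)
Definition CC (R : realType) : numClosedFieldType := R[i].

Notation Cn R n := 'rV[CC R]_n.

Section Defs.
Variables (R : realType) (n : nat).

Definition cabs (z : CC R) : R :=
  Num.sqrt (complex.Re z ^+ 2 + complex.Im z ^+ 2).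

Definition enorm (v : Cn R n) : R :=
  Num.sqrt (\sum_(i < n) (complex.Re (v 0 i) ^+ 2 + complex.Im (v 0 i) ^+ 2)).

Definition rinner (u v : Cn R n) : R :=
  \sum_(i < n) (complex.Re (u 0 i) * complex.Re (v 0 i)
                + complex.Im (u 0 i) * complex.Im (v 0 i)).

Definition rscale (t : R) (v : Cn R n) : Cn R n := (t%:C)%C *: v.

Definition boundary (Om : set (Cn R n)) : set (Cn R n) := closure Om `\` Om.

Definition bdist (Om : set (Cn R n)) (x : Cn R n) : R :=
  inf [set enorm (x - y) | y in boundary Om].

Definition bounded_set (Om : set (Cn R n)) : Prop :=
  exists M : R, forall x, Om x -> enorm x <= M.

Definition domain (Om : set (Cn R n)) : Prop :=
  open Om /\ connected Om /\ Om !=set0.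

Definition disc : set (CC R) := [set z | cabs z < 1].

Definition hol_disc (Om : set (Cn R n)) (phi : CC R -> Cn R n) : Prop :=
  forall z, disc z -> differentiable phi z /\ Om (phi z).

Definition kr (Om : set (Cn R n)) (x v : Cn R n) : R :=
  inf [set r : R | exists (a : CC R) (phi : CC R -> Cn R n),
         [/\ hol_disc Om phi, phi 0 = x, a *: 'D_1 phi 0 = v & r = cabs a]].

(* Poincaré distance on the disc from 0 to z (curvature -4 normalisation,
   compatible with kappa_D(0; v) = |v|) *)
Definition pdist0 (z : CC R) : R := 2^-1 * ln ((1 + cabs z) / (1 - cabs z)).

Definition kdist (Om : set (Cn R n)) (x y : Cn R n) : R :=
  inf [set s : R | exists (m : nat) (z : nat -> Cn R n) (zeta : nat -> CC R)
                          (phi : nat -> CC R -> Cn R n),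
         [/\ z 0%N = x, z m = y,
             (forall j, (j < m)%N ->
                [/\ hol_disc Om (phi j), disc (zeta j),
                    phi j 0 = z j & phi j (zeta j) = z j.+1])
           & s = \sum_(j < m) pdist0 (zeta j)]].

Definition holo_on (U : set (Cn R n)) (F : Cn R n -> Cn R n) : Prop :=
  forall z, U z -> differentiable F z.

Definition biholo (U V : set (Cn R n)) (F : Cn R n -> Cn R n) : Prop :=
  [/\ open U, open V, holo_on U F, F @` U = V &
      exists G : Cn R n -> Cn R n,
        [/\ holo_on V G, (forall z, U z -> G (F z) = z)
          & (forall w, V w -> F (G w) = w)]].

Definition cvx_set (S : set (Cn R n)) : Prop :=
  forall a b, S a -> S b -> forall t : R, 0 <= t <= 1 ->
    S (rscale t a + rscale (1 - t) b).

Definition convexifiable (Om : set (Cn R n)) : Prop :=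
  forall p, boundary Om p ->
    exists (U V : set (Cn R n)) (F : Cn R n -> Cn R n),
      [/\ U p, biholo U V F & cvx_set (F @` (Om `&` U))].

Definition has_rgrad (f : Cn R n -> R) (x g : Cn R n) : Prop :=
  forall e : R, 0 < e -> exists d : R, 0 < d /\
    forall h, enorm h < d -> `|f (x + h) - f x - rinner h g| <= e * enorm h.

Definition cont_on (U : set (Cn R n)) (G : Cn R n -> Cn R n) : Prop :=
  forall x, U x -> forall e : R, 0 < e -> exists d : R, 0 < d /\
    forall y, U y -> enorm (y - x) < d -> enorm (G y - G x) < e.

Definition Ioc0 (e : R) : set R := [set t : R | 0 < t <= e].

Definition dini_modulus (w : R -> R) : Prop :=
  [/\ (forall s t, 0 <= s -> s <= t -> w s <= w t),
      (forall t, 0 <= t -> 0 <= w t) &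
      (\int[@lebesgue_measure R]_(t in Ioc0 1)
          (w t / t)%R%:E < +oo)%E].

(* Dini-smooth boundary: near every boundary point the boundary is given by a
   C^1 defining function with nonvanishing gradient, and the inner unit normal
   -grad rho / |grad rho| is Dini-continuous on the boundary *)
Definition dini_smooth (Om : set (Cn R n)) : Prop :=
  forall p, boundary Om p ->
    exists (U : set (Cn R n)) (rho : Cn R n -> R) (G : Cn R n -> Cn R n)
           (w : R -> R),
      [/\ open U /\ U p,
          (forall x, U x -> has_rgrad rho x (G x) /\ G x != 0) /\ cont_on U G,
          (forall x, U x -> (Om x <-> rho x < 0)),
          dini_modulus w &
          (forall q q', U q -> U q' -> boundary Om q -> boundary Om q' ->
             enorm (rscale (- (enorm (G q))^-1) (G q)
                    - rscale (- (enorm (G q'))^-1) (G q'))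
               <= w (enorm (q - q')))].

Definition strongly_goldilocks (Om : set (Cn R n)) : Prop :=
  [/\ bounded_set Om, dini_smooth Om &
      exists (c0 : R) (w : R -> R),
        [/\ 0 < c0 /\ (forall t, 0 < t -> 0 < w t),
            (forall x v, Om x -> c0 * enorm v / w (bdist Om x) <= kr Om x v),
            (forall s t, 0 < s -> s <= t -> w t / t <= w s / s),
            (forall s t, 0 < s -> s <= t ->
               w s * ln (w s / s) <= w t * ln (w t / t)) &
            (forall eps : R, 0 < eps ->
               (\int[@lebesgue_measure R]_(x in Ioc0 eps)
                  ((w x / x) * ln (w x / x))%R%:E < +oo)%E)]].

End Defs.

(* Main.v *)
Require Import Defs.
From HB Require Import structures.
From mathcomp Require Import all_boot all_order all_algebra.
From mathcomp Require Import all_classical all_reals all_analysis.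
From mathcomp Require Import measurable_realfun complex ring lra.
Import Order.TTheory GRing.Theory Num.Theory.
Import numFieldNormedType.Exports.

(** Let p be a boundary point at which the domain is convexified by F. A point x
    of the domain near p lies within about delta(x) of a boundary point b, and a
    real hyperplane separating F(domain) from a point just beyond F(b) provides
    a holomorphic h near p, with values in the right half-plane, such that
    u = Re h satisfies u(x) <= C delta(x) and delta <= C u. By Schwarz-Pick,
    along a holomorphic disc log u grows at most at twice the Poincare speed,
    up to a factor 1/rho, where rho(z) is the radius below which discs centred
    at z cannot leave the chart (Royden localization).

    First rho >= alpha > 0, because kappa >= c0 |v| / omega(delta) and omega is
    bounded. So delta grows at most like exp(2 tau / alpha) in Poincare time
    tau, and since the integral of omega(s)/s converges at 0, a disc needs
    Poincare time (alpha/2) log(1/delta(z)) - O(1) to leave a fixed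
    neighbourhood; that is, 1 - rho(z) = O(u(z)^alpha). As the integral of
    s^(alpha-1) converges at 0, integrating du/dtau <= 2u(1 + C u^alpha) loses
    only a constant: delta(z) <= C delta(x) exp(2 tau) until the chain leaves
    the chart, and by the integrability of omega(s)/s again this cannot happen
    before C delta(x) exp(2 tau) is bounded below. Both alternatives give the
    estimate, and compactness of the closure makes the constant uniform. *)

Set Implicit Arguments.
Unset Strict Implicit.
Unset Printing Implicit Defensive.

Local Open Scope ring_scope.
Local Open Scope classical_set_scope.

Local Notation Re := complex.Re.
Local Notation Im := complex.Im.

(** * Modulus and Euclidean norm *)

(** The bounds are circular: growth of [u] is controlled only while the point stays in the chart,
    and the displacement that keeps it there is controlled only through the growth, since the speed
    bound omega(delta) depends on delta. Both are therefore carried together by a continuity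
    argument in the disc parameter. With delta <= A exp(K tau), the substitution s = A exp(K tau)
    turns the displacement, an integral of omega d tau, into 1/K times the integral of omega(s)/s.
    This converges by condition (c), because the logarithm there is bounded below near 0 unless
    omega(s) <= s throughout. A chain may have arbitrarily many discs, so nothing may be lost per
    disc. The inequalities carried along involve only the Poincare time elapsed so far; constants
    enter when delta is compared with [u] at a point, and do not accumulate. Nor is any differential
    inequality integrated: increments of the primitives [G] and [W] are compared with increments of
    Poincare time. *)

Section ComplexModulus.
Context {R : realType}.
Implicit Types z w : CC R.

Lemma cReD z w : Re (z + w) = Re z + Re w.
Proof. by move: z w => [a b] [c d]. Qed.

Lemma cImD z w : Im (z + w) = Im z + Im w.
Proof. by move: z w => [a b] [c d]. Qed.

Lemma cReN z : Re (- z) = - Re z.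
Proof. by case: z. Qed.

Lemma cImN z : Im (- z) = - Im z.
Proof. by case: z. Qed.

Lemma cReM z w : Re (z * w) = Re z * Re w - Im z * Im w.
Proof. by move: z w => [a b] [c d]. Qed.

Lemma cImM z w : Im (z * w) = Re z * Im w + Im z * Re w.
Proof. by move: z w => [a b] [c d]. Qed.

Lemma cRe_sum n (f : 'I_n -> CC R) : Re (\sum_i f i) = \sum_i Re (f i).
Proof.
by elim/big_ind2 : _ => // x1 x2 y1 y2 <- <-; rewrite cReD.
Qed.

Lemma cabsE z : cabs z = Normc.normc z.
Proof. by case: z. Qed.

Lemma norm_cabs z : `|z| = ((cabs z)%:C)%C.
Proof. exact: normc_def. Qed.

Lemma cabs_ge0 z : 0 <= cabs z.
Proof. exact: sqrtr_ge0. Qed.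

Lemma cabsM z w : cabs (z * w) = cabs z * cabs w.
Proof. by rewrite !cabsE Normc.normcM. Qed.

Lemma cabsV z : cabs z^-1 = (cabs z)^-1.
Proof. by rewrite !cabsE Normc.normcV. Qed.

Lemma ler_cabsD z w : cabs (z + w) <= cabs z + cabs w.
Proof. by rewrite !cabsE le_normcD. Qed.

Lemma cabsN z : cabs (- z) = cabs z.
Proof. by rewrite !cabsE normcN. Qed.

Lemma cabs_real (r : R) : cabs (r%:C)%C = `|r|.
Proof. by rewrite /cabs /= expr0n addr0 sqrtr_sqr. Qed.

Lemma cabs0 : cabs (0 : CC R) = 0.
Proof. by rewrite (cabs_real 0) normr0. Qed.

Lemma cabs1 : cabs (1 : CC R) = 1.
Proof. by rewrite (cabs_real 1) normr1. Qed.

Lemma cabs_eq0 z : (cabs z == 0) = (z == 0).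
Proof.
apply/eqP/eqP => [|->]; last exact: cabs0.
by rewrite cabsE => /Normc.eq0_normc.
Qed.

Lemma cabs_gt0 z : (0 < cabs z) = (z != 0).
Proof. by rewrite lt_def cabs_ge0 andbT cabs_eq0. Qed.

Lemma ler_cabsB z w : cabs z - cabs w <= cabs (z + w).
Proof. by rewrite lerBlDr -{1}(addrK w z) -(cabsN w) ler_cabsD. Qed.

Lemma sqr_cabs z : cabs z ^+ 2 = Re z ^+ 2 + Im z ^+ 2.
Proof. by rewrite sqr_sqrtr // addr_ge0 // sqr_ge0. Qed.

Lemma ler_sqr_cabs (r : R) z : 0 <= r -> Re z ^+ 2 + Im z ^+ 2 <= r ^+ 2 -> cabs z <= r.
Proof. by move=> r0 h; rewrite -(@ler_pXn2r _ 2) ?nnegrE ?cabs_ge0 // sqr_cabs. Qed.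

Lemma normr_Re_le z : `|Re z| <= cabs z.
Proof. by rewrite -sqrtr_sqr ler_wsqrtr // lerDl sqr_ge0. Qed.

Lemma normr_Im_le z : `|Im z| <= cabs z.
Proof. by rewrite -sqrtr_sqr ler_wsqrtr // lerDr sqr_ge0. Qed.

Lemma cabs_le_ReIm z : cabs z <= `|Re z| + `|Im z|.
Proof.
apply: ler_sqr_cabs; first by rewrite addr_ge0.
have := normr_ge0 (Re z); have := normr_ge0 (Im z).
rewrite -(real_normK (num_real (Re z))) -(real_normK (num_real (Im z))); nra.
Qed.

Lemma unimodular_rotation z : exists2 e : CC R, cabs e = 1 & Re (e * z) = cabs z.
Proof.
have [->|z0] := eqVneq z 0; first by exists 1; rewrite ?mulr0 ?cabs0 ?cabs1.
have cz : cabs z != 0 by rewrite cabs_eq0.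
exists ((Re z / cabs z) +i* (- Im z / cabs z))%C; last first.
  rewrite cReM /= -[RHS](mulfK cz) -expr2 sqr_cabs; field; exact: cz.
apply/eqP; rewrite -sqrp_eq1 ?cabs_ge0 // sqr_cabs /= !exprMn sqrrN exprVn.
by rewrite -mulrDl -sqr_cabs divff // sqrf_eq0.
Qed.

Lemma ltc_real_pos (e : CC R) : 0 < e -> exists2 r : R, 0 < r & e = (r%:C)%C.
Proof.
move=> e0; exists (Re e); move: e0; rewrite ltcE /= => /andP[/eqP h1 h2] //.
by case: e h1 h2 => a b /= -> _.
Qed.

Lemma real_pos_ltc (r : R) : 0 < r -> (0 : CC R) < (r%:C)%C.
Proof. by move=> r0; rewrite ltcR. Qed.

End ComplexModulus.

Section EuclideanNorm.
Context {R : realType} {n : nat}.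
Implicit Types (u v x y : Cn R n) (t : R).

Lemma enormE v : enorm v = Num.sqrt (rinner v v).
Proof. by congr Num.sqrt; apply: eq_bigr => i _; rewrite !expr2. Qed.

Lemma rinnerC u v : rinner u v = rinner v u.
Proof. by apply: eq_bigr => i _; rewrite mulrC [X in _ + X]mulrC. Qed.

Lemma rinnerDl u v x : rinner (u + v) x = rinner u x + rinner v x.
Proof.
rewrite -big_split; apply: eq_bigr => i _ /=.
by rewrite !mxE cReD cImD; ring.
Qed.

Lemma rinnerDr u v x : rinner x (u + v) = rinner x u + rinner x v.
Proof. by rewrite rinnerC rinnerDl !(rinnerC x). Qed.

Lemma rinnerNl u v : rinner (- u) v = - rinner u v.
Proof.
rewrite -sumrN; apply: eq_bigr => i _ /=.
by rewrite !mxE cReN cImN; ring.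
Qed.

Lemma rinnerNr u v : rinner v (- u) = - rinner v u.
Proof. by rewrite rinnerC rinnerNl rinnerC. Qed.

Lemma rinnerZl t u v : rinner (rscale t u) v = t * rinner u v.
Proof.
rewrite mulr_sumr; apply: eq_bigr => i _ /=.
by rewrite /rscale !mxE cReM cImM /=; ring.
Qed.

Lemma rinnerZr t u v : rinner u (rscale t v) = t * rinner u v.
Proof. by rewrite rinnerC rinnerZl rinnerC. Qed.

Lemma rinner_ge0 v : 0 <= rinner v v.
Proof. by apply: sumr_ge0 => i _; rewrite -!expr2 addr_ge0 ?sqr_ge0. Qed.

Lemma sqr_enorm v : enorm v ^+ 2 = rinner v v.
Proof. by rewrite enormE sqr_sqrtr ?rinner_ge0. Qed.

Lemma enorm_ge0 v : 0 <= enorm v.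
Proof. exact: sqrtr_ge0. Qed.

Lemma enorm0 : enorm (0 : Cn R n) = 0.
Proof.
by rewrite /enorm big1 ?sqrtr0 // => i _; rewrite !mxE /= expr0n addr0.
Qed.

Lemma enorm_scale (a : CC R) v : enorm (a *: v) = cabs a * enorm v.
Proof.
rewrite /enorm /cabs -sqrtrM ?addr_ge0 ?sqr_ge0 //; congr Num.sqrt.
by rewrite mulr_sumr; apply: eq_bigr => i _; rewrite mxE cReM cImM; ring.
Qed.

Lemma enorm_rscale t v : enorm (rscale t v) = `|t| * enorm v.
Proof. by rewrite enorm_scale cabs_real. Qed.

Lemma enormN v : enorm (- v) = enorm v.
Proof. by rewrite !enormE rinnerNl rinnerNr opprK. Qed.

Lemma enormBC u v : enorm (u - v) = enorm (v - u).
Proof. by rewrite -enormN opprB. Qed.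

Lemma enorm_eq0 v : enorm v = 0 -> v = 0.
Proof.
move=> h; have : rinner v v = 0 by rewrite -sqr_enorm h expr0n.
move/eqP; rewrite psumr_eq0 => [/allP h0|i _]; last first.
  by rewrite -!expr2 addr_ge0 ?sqr_ge0.
apply/rowP => i; rewrite mxE; apply/eqP; rewrite -cabs_eq0 -sqrf_eq0 sqr_cabs.
by have := h0 i; rewrite mem_index_enum !expr2 /=; apply.
Qed.

Lemma rinner_le u v : rinner u v <= enorm u * enorm v.
Proof.
have [u0|u0] := eqVneq (enorm u) 0.
  by rewrite (enorm_eq0 u0) enorm0 mul0r -[0](scale0r 0) rinnerZl mul0r.
have up : 0 < enorm u by rewrite lt_def u0 enorm_ge0.
have := rinner_ge0 (rscale (enorm v) u - rscale (enorm u) v).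
rewrite rinnerDl !rinnerDr !rinnerNl !rinnerNr !rinnerZl !rinnerZr.
rewrite -!sqr_enorm (rinnerC v u) => h.
have [v0|v0] := eqVneq (enorm v) 0.
  by rewrite (enorm_eq0 v0) enorm0 mulr0 rinnerC -[0](scale0r 0) rinnerZl mul0r.
have vp : 0 < enorm v by rewrite lt_def v0 enorm_ge0.
have : 0 <= (2 * (enorm u * enorm v)) * (enorm u * enorm v - rinner u v).
  by apply: le_trans h _; rewrite le_eqVlt; apply/orP; left; apply/eqP; ring.
by rewrite pmulr_rge0 ?subr_ge0 // !mulr_gt0.
Qed.

Lemma ler_enormD u v : enorm (u + v) <= enorm u + enorm v.
Proof.
rewrite -(@ler_pXn2r _ 2) ?nnegrE ?addr_ge0 ?enorm_ge0 //.
rewrite sqr_enorm rinnerDl !rinnerDr (rinnerC v u) -!sqr_enorm.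
have := rinner_le u v; nra.
Qed.

Lemma ler_enorm_dist x y z : enorm (x - z) <= enorm (x - y) + enorm (y - z).
Proof. by rewrite -{1}(subrK y x) -addrA ler_enormD. Qed.

Lemma cabs_coord_le v i : cabs (v 0 i) <= enorm v.
Proof.
apply: ler_wsqrtr; rewrite (bigD1 i) //= lerDl.
by apply: sumr_ge0 => j _; rewrite addr_ge0 ?sqr_ge0.
Qed.

Lemma enorm_le_coord (c : R) v :
  0 <= c -> (forall i, cabs (v 0 i) <= c) -> enorm v <= n%:R * c.
Proof.
move=> c0 h; rewrite -(@ler_pXn2r _ 2) ?nnegrE ?enorm_ge0 ?mulr_ge0 //.
rewrite sqr_enorm exprMn.
have : rinner v v <= \sum_(i < n) c ^+ 2.
  apply: ler_sum => i _; rewrite -!expr2 -sqr_cabs.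
  by rewrite ler_pXn2r ?nnegrE ?cabs_ge0.
move=> /le_trans; apply; rewrite sumr_const card_ord -[leLHS]mulr_natl.
rewrite ler_wpM2r ?sqr_ge0 // -natrX ler_nat.
by case: (n) => // m; rewrite expnS leq_pmulr.
Qed.

End EuclideanNorm.

(** * Neighbourhoods and differentials in terms of real radii *)

Section Epsilon.
Context {R : realType}.

(** The norm of [CC R] takes values in [CC R] itself, so balls have complex radii; a positive one is
    real, which allows real radii from here on. *)
Lemma nbhs_CCP (z : CC R) (P : set (CC R)) :
  nbhs z P <-> exists2 r : R, 0 < r & forall w, cabs (w - z) < r -> P w.
Proof.
split=> [/nbhs_ballP[e /= /ltc_real_pos[r r0 ->] h]|[r r0 h]].
  exists r => // w hw; apply: h; rewrite -ball_normE /ball_ /= norm_cabs.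
  by rewrite ltcR -cabsN opprB.
apply/nbhs_ballP; exists (r%:C)%C; first exact: real_pos_ltc.
move=> w; rewrite -ball_normE /ball_ /= norm_cabs ltcR -cabsN opprB; exact: h.
Qed.

Lemma nbhs_CnP (n : nat) (z : Cn R n) (P : set (Cn R n)) :
  nbhs z P <-> exists2 r : R, 0 < r & forall w, enorm (w - z) < r -> P w.
Proof.
split=> [/nbhs_ballP[e /= /ltc_real_pos[r r0 ->] h]|[r r0 h]].
  exists r => // w hw; apply: h; split; first exact: real_pos_ltc.
  move=> i j; rewrite -ball_normE /ball_ /= norm_cabs ltcR ord1.
  apply: le_lt_trans hw; rewrite -cabsN opprB.
  by have := cabs_coord_le (w - z) j; rewrite !mxE.
(* Passing from coordinates to [enorm] costs at most a factor [n]; dividing by [n + 1] also covers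
   dimension 0. *)
have n0 : 0 < n%:R + 1 :> R by rewrite ltr_wpDl.
apply/nbhs_ballP; exists ((r / (n%:R + 1))%:C)%C.
  by apply: real_pos_ltc; rewrite divr_gt0.
move=> w [_ hw]; apply: h.
have c0 : 0 <= r / (n%:R + 1) by rewrite ltW // divr_gt0.
have : enorm (w - z) <= n%:R * (r / (n%:R + 1)).
  apply: enorm_le_coord => // i; have := hw 0 i.
  rewrite -ball_normE /ball_ /= norm_cabs ltcR -cabsN opprB !mxE; exact: ltW.
move=> /le_lt_trans; apply.
rewrite mulrCA gtr_pMr // ltr_pdivrMr // mul1r ltrDl; exact: ltr01.
Qed.

Lemma mx_norm_enorm (n : nat) (v : Cn R n) (c : R) :
  0 <= c -> `|v| <= (c%:C)%C -> enorm v <= n%:R * c.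
Proof.
move=> c0 hv; apply: enorm_le_coord => // i.
rewrite -lecR -norm_cabs; apply: le_trans hv.
have -> : `|v| = mx_norm v by [].
rewrite mx_normE -[leLHS]nngE num_le.
exact: (le_bigmax _ (fun i => `|v i.1 i.2|%:nng) (0, i)).
Qed.

Lemma differentiable_approx (n : nat) (phi : CC R -> Cn R n) z :
  differentiable phi z -> forall e : R, 0 < e -> exists2 d : R, 0 < d &
    forall w, cabs w < d ->
      enorm (phi (z + w) - phi z - w *: 'D_1 phi z) <= e * cabs w.
Proof.
move=> dphi e e0.
have n0 : 0 < n%:R + 1 :> R by rewrite ltr_wpDl.
have := diff_locally dphi; move/eqaddoP => /(_ ((e / (n%:R + 1))%:C)%C); rewrite real_pos_ltc ?divr_gt0 //.
move=> /(_ isT) /nbhs_CCP[d d0 h]; exists d => // w wd.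
have := h w; rewrite subr0 => /(_ wd) /=.
rewrite norm_cabs -rmorphM /= => /mx_norm_enorm h1.
rewrite deriveE // -linearZ_LR /= -[_ *: 1]/(w * 1) mulr1.
have -> : phi (z + w) - phi z - 'd phi z w
          = (phi (w + z) - (cst (phi z) + 'd phi z) w).
  by rewrite [w + z]addrC fctE opprD addrA.
apply: le_trans (h1 _) _; first by rewrite mulr_ge0 ?cabs_ge0 // ltW // divr_gt0.
rewrite mulrA ler_wpM2r ?cabs_ge0 // mulrCA ler_piMr ?(ltW e0) //.
by rewrite ler_pdivrMr // mul1r lerDl ler01.
Qed.
End Epsilon.

Section ScalarApprox.
Context {R : realType}.

Lemma cdifferentiable_approx (f : CC R -> CC R) z :
  differentiable f z -> forall e : R, 0 < e -> exists2 d : R, 0 < d &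
    forall w, cabs w < d ->
      cabs (f (z + w) - f z - 'D_1 f z * w) <= e * cabs w.
Proof.
move=> df e e0; have := diff_locally df; move/eqaddoP => /(_ ((e%:C)%C)).
rewrite real_pos_ltc // => /(_ isT) /nbhs_CCP[d d0 h]; exists d => // w wd.
have := h w; rewrite subr0 => /(_ wd) /=.
rewrite !norm_cabs -rmorphM /= lecR.
have -> : 'D_1 f z * w = 'd f z w.
  by rewrite deriveE // mulrC -[LHS]/(w *: _) -linearZ_LR /= -[_ *: 1]/(w * 1) mulr1.
have -> // : f (z + w) - f z - 'd f z w = f (w + z) - (cst (f z) + 'd f z) w.
by rewrite [w + z]addrC fctE opprD addrA.
Qed.

End ScalarApprox.

(** * Goursat's theorem on rectangles *)

Section Bisection.
Context {R : realType}.


Variables (S : R -> R -> R -> R -> R) (a l b m : R).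
Hypotheses (l0 : 0 < l) (m0 : 0 < m).
Hypothesis S_addl : forall x x' x'' y y' : R, a <= x -> x <= x' -> x' <= x'' ->
  x'' <= a + l -> b <= y -> y <= y' -> y' <= b + m ->
  S x x'' y y' = S x x' y y' + S x' x'' y y'.
Hypothesis S_addr : forall x x' y y' y'' : R, a <= x -> x <= x' -> x' <= a + l ->
  b <= y -> y <= y' -> y' <= y'' -> y'' <= b + m ->
  S x x' y y'' = S x x' y y' + S x x' y' y''.
Hypothesis S_small : forall e : R, 0 < e -> forall x0 y0 : R,
  a <= x0 <= a + l -> b <= y0 <= b + m -> exists2 d : R, 0 < d &
  forall x y t : R, a <= x -> x <= x0 -> x0 <= x + t * l -> x + t * l <= a + l ->
    b <= y -> y <= y0 -> y0 <= y + t * m -> y + t * m <= b + m ->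
    0 < t -> t < d -> `|S x (x + t * l) y (y + t * m)| <= e * t ^+ 2.

Section Descent.
Variable e : R.
Hypothesis e0 : 0 < e.
(** The threshold scales like area: four quarters below it put the whole rectangle below it. Hence
    [child] need not test the last quarter. *)
Let bad t (p : R * R) :=
  e * t ^+ 2 < `|S p.1 (p.1 + t * l) p.2 (p.2 + t * m)|.
Let inbox t (p : R * R) := [&& a <= p.1, p.1 + t * l <= a + l,
   b <= p.2 & p.2 + t * m <= b + m].
Let child t (p : R * R) : R * R :=
  let x := p.1 in let y := p.2 in
  if bad t (x, y) then (x, y) else if bad t (x + t * l, y) then (x + t * l, y)
  else if bad t (x, y + t * m) then (x, y + t * m) else (x + t * l, y + t * m).
Let h (k : nat) : R := 2^-1 ^+ k.
Fixpoint corner (k : nat) : R * R :=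
  if k is k'.+1 then child (h k) (corner k') else (a, b).

Let h_gt0 k : 0 < h k.
Proof. by rewrite exprn_gt0. Qed.

Let hS k : h k = h k.+1 + h k.+1.
Proof. by rewrite /h exprS; field. Qed.

Lemma child_bad t p : 0 < t -> bad (t + t) p -> inbox (t + t) p ->
  [/\ bad t (child t p), inbox t (child t p),
      p.1 <= (child t p).1 & p.2 <= (child t p).2].
Proof.
case: p => x y t0 bp /and4P[/= h1 h2 h3 h4].
have tl : 0 < t * l by rewrite mulr_gt0.
have tm : 0 < t * m by rewrite mulr_gt0.
move: bp; rewrite /bad /= !mulrDl !addrA in h2 h4 * => bp.
rewrite /child /=.
case: ifPn => b1.
  by rewrite /inbox; split; rewrite //=; try apply/and4P; try split; lra.
case: ifPn => b2.
  by rewrite /inbox; split; rewrite //=; try apply/and4P; try split; lra.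
case: ifPn => b3.
  by rewrite /inbox; split; rewrite //=; try apply/and4P; try split; lra.
rewrite /inbox /bad /=; split; try apply/and4P; try split; try lra.
move: b1 b2 b3; rewrite /bad /= -!leNgt => b1 b2 b3.
rewrite ltNge; apply/negP => b4; move: bp; apply/negP; rewrite -leNgt.
rewrite (@S_addl x (x + t * l)); try lra.
rewrite (@S_addr x (x + t * l) y (y + t * m)); try lra.
rewrite (@S_addr (x + t * l) (x + t * l + t * l) y (y + t * m)); try lra.
have n1 := ler_normD (S x (x + t * l) y (y + t * m)
  + S x (x + t * l) (y + t * m) (y + t * m + t * m))
 (S (x + t * l) (x + t * l + t * l) y (y + t * m)
  + S (x + t * l) (x + t * l + t * l) (y + t * m) (y + t * m + t * m)).
have n2 := ler_normD (S x (x + t * l) y (y + t * m))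
  (S x (x + t * l) (y + t * m) (y + t * m + t * m)).
have n3 := ler_normD (S (x + t * l) (x + t * l + t * l) y (y + t * m))
  (S (x + t * l) (x + t * l + t * l) (y + t * m) (y + t * m + t * m)).
have -> : e * (t + t) ^+ 2 = (e * t ^+ 2) * 4%:R by ring.
lra.
Qed.

Lemma corner_bad k : bad 1 (a, b) -> bad (h k) (corner k) /\ inbox (h k) (corner k).
Proof.
move=> b0; elim: k => [|k [ih1 ih2]].
  by split => //; rewrite /inbox /h expr0 !mul1r /= !lexx.
rewrite hS in ih1 ih2.
by have [] := child_bad (h_gt0 k.+1) ih1 ih2.
Qed.

(** [h k - h (k + j)] is the sum of the sides [h (k + 1)] to [h (k + j)], the farthest that the
    corner can move. *)
Lemma corner_nested k j : bad 1 (a, b) ->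
  (corner k).1 <= (corner (k + j)).1 <= (corner k).1 + (h k - h (k + j)) * l /\
  (corner k).2 <= (corner (k + j)).2 <= (corner k).2 + (h k - h (k + j)) * m.
Proof.
move=> b0; elim: j => [|j [/andP[i1 i2] /andP[i3 i4]]].
  by rewrite addn0 subrr !mul0r !addr0 !lexx.
rewrite addnS.
have [c1 c2] := corner_bad (k + j) b0.
rewrite hS in c1 c2.
have [_ _ m1 m2] := child_bad (h_gt0 (k + j).+1) c1 c2.
rewrite -[corner (k + j).+1]/(child (h (k + j).+1) (corner (k + j))).
have : (child (h (k + j).+1) (corner (k + j))).1 <= (corner (k + j)).1 + h (k + j).+1 * l
  /\ (child (h (k + j).+1) (corner (k + j))).2 <= (corner (k + j)).2 + h (k + j).+1 * m.
  have p1 := mulr_gt0 (h_gt0 (k + j).+1) l0.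
  have p2 := mulr_gt0 (h_gt0 (k + j).+1) m0.
  by rewrite /child; do 3 (case: ifP => _ /=; first by split; lra).
move=> [u1 u2]; rewrite (hS (k + j)) in i2 i4.
by split; apply/andP; split; lra.
Qed.

(** The corners increase and the bad rectangles are nested, so the suprema of the corner coordinates
    give a common point, where [S_small] contradicts badness. *)
Lemma bisection_le : `|S a (a + l) b (b + m)| <= e.
Proof.
rewrite leNgt; apply/negP => bad0.
have b0 : bad 1 (a, b) by rewrite /bad /= expr1n !mul1r mulr1.
have lim (f : nat -> R) (c : R) : 0 < c -> 
    (forall k j, f k <= f (k + j)%N <= f k + (h k - h (k + j)) * c) ->
    exists x0, forall k, f k <= x0 <= f k + h k * c.
  move=> c0 hf; exists (sup (range f)) => k.
  have ub j : f j <= f k + h k * c.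
    have hk := mulr_gt0 (h_gt0 k) c0.
    have hj := mulr_gt0 (h_gt0 j) c0.
    case: (leqP j k) => [jk|/ltnW kj].
      have := hf j (k - j)%N; rewrite subnKC // => /andP[? _]; lra.
    have := hf k (j - k)%N; rewrite subnKC // => /andP[_]; rewrite mulrBl; lra.
  apply/andP; split.
    apply: ub_le_sup; last by exists k.
    by exists (f k + h k * c) => _ [j _ <-].
  apply: ge_sup; first by exists (f 0); exists 0.
  by move=> _ [j _ <-].
have [x0 hx] := lim (fun k => (corner k).1) l l0 (fun k j => proj1 (corner_nested k j b0)).
have [y0 hy] := lim (fun k => (corner k).2) m m0 (fun k j => proj2 (corner_nested k j b0)).
have x0a : a <= x0 <= a + l by have := hx 0%N; rewrite /h expr0 mul1r.
have y0b : b <= y0 <= b + m by have := hy 0%N; rewrite /h expr0 mul1r.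
have [d d0 hd] := S_small e0 x0a y0b.
have [k hk] : exists k, h k < d.
  have := @cvg_expr R 2^-1; rewrite ger0_norm ?invr_ge0 // invf_lt1 // ltr1n.
  move=> /(_ isT) /cvgrPdist_lt /(_ d d0) [k _ hk]; exists k.
  by have := hk k (leqnn k); rewrite sub0r normrN ger0_norm // ltW.
have [] := corner_bad k b0; rewrite /bad /inbox => c1 /and4P[i1 i2 i3 i4].
have /andP[j1 j2] := hx k; have /andP[j3 j4] := hy k.
have := hd _ _ _ i1 j1 j2 i2 i3 j3 j4 i4 (h_gt0 k) hk.
by rewrite leNgt c1.
Qed.

End Descent.

Lemma bisection_eq0 : S a (a + l) b (b + m) = 0.
Proof.
apply/eqP; rewrite -normr_le0; apply/ler_addgt0Pl => e e0.
by rewrite addr0 bisection_le.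
Qed.

End Bisection.

Section IntervalIntegral.
Context {R : realType}.
Implicit Types (f g : R -> R) (a b c : R).

Definition continuous_on_itv f a b :=
  forall x, a <= x <= b -> {for x, continuous f}.

Definition itv_int f a b : R := (\int[@lebesgue_measure R]_(x in `[a, b]) f x)%R.

Lemma continuous_on_itvB f g a b : continuous_on_itv f a b ->
  continuous_on_itv g a b -> continuous_on_itv (fun x => f x - g x) a b.
Proof. by move=> cf cg x xab; apply: cvgB; [exact: cf | exact: cg]. Qed.

Lemma continuous_on_itv_integrable f a b : continuous_on_itv f a b ->
  (@lebesgue_measure R).-integrable `[a, b] (EFin \o f).
Proof.
move=> cf; apply: continuous_compact_integrable; first exact: segment_compact.
apply: continuous_in_subspaceT => x; rewrite inE /= in_itv /=; exact: cf.
Qed.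

Lemma itv_int_split f a c b : a <= c -> c <= b -> continuous_on_itv f a b ->
  itv_int f a b = itv_int f a c + itv_int f c b.
Proof.
move=> ac cb cf; have if_ := continuous_on_itv_integrable cf.
have := @Rintegral_itvB R f (BLeft a) (BRight b) c if_.
rewrite !bnd_simp => /(_ ac cb).
rewrite Rintegral_itv_obnd_cbnd; last first.
  apply: integrableS if_ => //; apply: subset_itvr; by rewrite bnd_simp.
by rewrite /itv_int => <-; rewrite addrC subrK.
Qed.

Lemma itv_intB f g a b : continuous_on_itv f a b -> continuous_on_itv g a b ->
  itv_int (fun x => f x - g x) a b = itv_int f a b - itv_int g a b.
Proof.
move=> cf cg; rewrite /itv_int RintegralB //;
  exact: continuous_on_itv_integrable.
Qed.

Let itv_int_cst a b c : a <= b -> itv_int (cst c) a b = c * (b - a).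
Proof.
move=> ab; rewrite /itv_int Rintegral_cst //; congr (_ * _).
by rewrite /= lebesgue_measure_itv /= lte_fin; case: ltgtP ab => // ->; rewrite subrr.
Qed.

Let cst_itv_integrable a b c :
  (@lebesgue_measure R).-integrable `[a, b] (EFin \o cst c).
Proof. by apply: continuous_on_itv_integrable => x _; exact: cvg_cst. Qed.

Lemma itv_int_le f a b c : a <= b -> continuous_on_itv f a b ->
  (forall x, a <= x <= b -> f x <= c) -> itv_int f a b <= c * (b - a).
Proof.
move=> ab cf h; rewrite -itv_int_cst // /itv_int.
apply: le_Rintegral => //; exact: continuous_on_itv_integrable.
Qed.

Lemma itv_int_ge f a b c : a <= b -> continuous_on_itv f a b ->
  (forall x, a <= x <= b -> c <= f x) -> c * (b - a) <= itv_int f a b.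
Proof.
move=> ab cf h; rewrite -itv_int_cst // /itv_int.
apply: le_Rintegral => //; exact: continuous_on_itv_integrable.
Qed.

Lemma itv_int_bounds f a b c1 c2 : a <= b -> continuous_on_itv f a b ->
  (forall x, a <= x <= b -> c1 <= f x <= c2) ->
  c1 * (b - a) <= itv_int f a b <= c2 * (b - a).
Proof.
move=> ab cf h; apply/andP; split.
  by apply: itv_int_ge => // x /h /andP[].
by apply: itv_int_le => // x /h /andP[].
Qed.

End IntervalIntegral.

Section Goursat.
Context {R : realType}.
Variables (P V : R -> R -> R) (a l b m : R).
Hypotheses (l0 : 0 < l) (m0 : 0 < m).
(* With [f = P + iV] and [f' = A + iB], the closed form below is
   [P dth + V ds], the imaginary part of [f (ds + i dth)]. *)
Hypothesis dPV : forall s th : R, a <= s <= a + l -> b <= th <= b + m ->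
  exists A B : R, forall e : R, 0 < e -> exists2 d : R, 0 < d &
  forall s' th' : R, `|s' - s| < d -> `|th' - th| < d ->
   `|P s' th' - P s th - (A * (s' - s) - B * (th' - th))|
      <= e * (`|s' - s| + `|th' - th|) /\
   `|V s' th' - V s th - (B * (s' - s) + A * (th' - th))|
      <= e * (`|s' - s| + `|th' - th|).

Let norm_addK (x y c : R) : `|x + y| <= c -> `|x| <= c + `|y|.
Proof. by move=> h; rewrite -[in leLHS](addrK y x) (le_trans (ler_normB _ _)) // lerD2r. Qed.

Let bound_cvg (f : R -> R) (x k d : R) : 0 < d ->
  (forall y : R, `|y - x| < d -> `|f y - f x| <= k * `|y - x|) ->
  {for x, continuous f}.
Proof.
move=> d0 h; apply/cvgrPdist_le => e e0.
have k0 : 0 < `|k| + 1 by rewrite ltr_wpDl.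
apply/nbhs_ballP; exists (Num.min d (e / (`|k| + 1))).
  by rewrite /= lt_min d0 divr_gt0.
move=> y; rewrite /ball /= distrC lt_min => /andP[yd ye].
rewrite distrC; apply: le_trans (h y yd) _.
move: ye; rewrite ltr_pdivlMr //.
have := ler_norm k; have := normr_ge0 (y - x); nra.
Qed.

Lemma goursat_contr (s th : R) : a <= s <= a + l -> b <= th <= b + m -> {for th, continuous (P s)}.
Proof.
move=> hs ht; have [A [B /(_ 1 ltr01)[d d0 h]]] := dPV hs ht.
apply: (bound_cvg (k := `|B| + 1) d0) => y yd.
have [] := h s y; rewrite ?subrr ?normr0 // mulr0 sub0r opprK add0r mul1r => h1 _.
rewrite mulrDl mul1r -normrM.
by rewrite [leRHS]addrC; apply: norm_addK.
Qed.

Let V_contl (s th : R) : a <= s <= a + l -> b <= th <= b + m ->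
  {for s, continuous (fun x => V x th)}.
Proof.
move=> hs ht; have [A [B /(_ 1 ltr01)[d d0 h]]] := dPV hs ht.
apply: (bound_cvg (k := `|B| + 1) d0) => y yd.
have [] := h y th; rewrite ?subrr ?normr0 // !mulr0 !addr0 mul1r => _ h1.
rewrite mulrDl mul1r -normrM.
by rewrite [leRHS]addrC -[X in _ <= _ + X]normrN; apply: norm_addK.
Qed.

Let S x x' y y' :=
  itv_int (fun th => P x' th - P x th) y y' +
  itv_int (fun s => V s y - V s y') x x'.

Lemma goursat :
  itv_int (fun th => P (a + l) th - P a th) b (b + m) +
  itv_int (fun s => V s b - V s (b + m)) a (a + l) = 0.
Proof.
have cP (x y y' : R) : a <= x <= a + l -> b <= y -> y' <= b + m ->
    continuous_on_itv (P x) y y'.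
  by move=> hx h1 h2 th hth; apply: goursat_contr => //; lra.
have cV (y x x' : R) : b <= y <= b + m -> a <= x -> x' <= a + l ->
    continuous_on_itv (fun s => V s y) x x'.
  by move=> hy h1 h2 s hs; apply: V_contl => //; lra.
apply: (@bisection_eq0 _ S) => //.
- move=> x x' x'' y y' h1 h2 h3 h4 h5 h6 h7; rewrite /S.
  rewrite (@itv_int_split _ _ x x' x'') //; last first.
    by apply: continuous_on_itvB; apply: cV; lra.
  rewrite !itv_intB; try (apply: cP; lra); try (apply: cV; lra).
  by ring.
- move=> x x' y y' y'' h1 h2 h3 h4 h5 h6 h7; rewrite /S.
  rewrite (@itv_int_split _ _ y y' y'') //; last first.
    by apply: continuous_on_itvB; apply: cP; lra.
  rewrite !itv_intB; try (apply: cP; lra); try (apply: cV; lra).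
  by ring.
move=> e e0 x0 y0 hx0 hy0; have [A [B h]] := dPV hx0 hy0.
(* To first order the two integrals are [A * (t * l) * (t * m)] and its opposite, while the [B]
   terms cancel within each integrand. The remainder is at most [2 * (e / M) * r ^+ 2] with
   [r = t * (l + m)], half of [e * t ^+ 2]. *)
pose M := 4 * (l + m) ^+ 2.
have M0 : 0 < M by rewrite mulr_gt0 // exprn_gt0 // addr_gt0.
have [d d0 {}h] := h (e / M) (divr_gt0 e0 M0).
exists (d / (l + m)); first by rewrite divr_gt0 // addr_gt0.
move=> x y t h1 h2 h3 h4 h5 h6 h7 h8 t0; rewrite ltr_pdivlMr ?addr_gt0 // => td.
have tl : 0 < t * l by rewrite mulr_gt0.
have tm : 0 < t * m by rewrite mulr_gt0.
rewrite mulrDr in td.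
pose r := t * l + t * m.
have near (s th : R) : x <= s <= x + t * l -> y <= th <= y + t * m ->
   `|P s th - P x0 y0 - (A * (s - x0) - B * (th - y0))| <= e / M * r /\
   `|V s th - V x0 y0 - (B * (s - x0) + A * (th - y0))| <= e / M * r.
  move=> hs ht.
  have n1 : `|s - x0| <= t * l by rewrite ler_norml; lra.
  have n2 : `|th - y0| <= t * m by rewrite ler_norml; lra.
  have [||u1 u2] := h s th; [lra|lra|].
  have eM : 0 <= e / M by rewrite ltW // divr_gt0.
  split; [apply: le_trans u1 _|apply: le_trans u2 _];
  by rewrite ler_wpM2l // lerD.
pose k := e / M * r.
have /andP[b1 b2] : (A * (t * l) - 2 * k) * (y + t * m - y)
    <= itv_int (fun th => P (x + t * l) th - P x th) y (y + t * m)
    <= (A * (t * l) + 2 * k) * (y + t * m - y).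
  apply: itv_int_bounds; [lra|by apply: continuous_on_itvB; apply: cP; lra|].
  move=> th hth.
  have [|//|+ _] := near (x + t * l) th; first lra.
  have [|//|+ _] := near x th; first lra.
  rewrite !ler_norml -/k; set Bt := B * (th - y0).
  rewrite !mulrBr !mulrDr; lra.
have /andP[b3 b4] : (- A * (t * m) - 2 * k) * (x + t * l - x)
    <= itv_int (fun s => V s y - V s (y + t * m)) x (x + t * l)
    <= (- A * (t * m) + 2 * k) * (x + t * l - x).
  apply: itv_int_bounds; [lra|by apply: continuous_on_itvB; apply: cV; lra|].
  move=> s hs.
  have [//||_ +] := near s (y + t * m); first lra.
  have [//||_ +] := near s y; first lra.
  rewrite !ler_norml -/k; set Bt := B * (s - x0).
  rewrite mulNr !mulrBr !mulrDr; lra.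
have kr : 2 * k * r <= e * t ^+ 2.
  have -> : 2 * k * r = e * t ^+ 2 * (2 * (l + m) ^+ 2 / M).
    by rewrite /k /r; ring.
  have -> : 2 * (l + m) ^+ 2 / M = 2^-1.
    rewrite /M; field; lra.
  rewrite ler_piMr ?invf_le1 ?ler1n //.
  by rewrite mulr_ge0 ?sqr_ge0 // ltW.
rewrite ler_norml /S; rewrite /r mulrDr in kr; apply/andP; split; lra.
Qed.

End Goursat.

(** * The Schwarz lemma *)

Section RealApprox.
Context {R : realType}.

Lemma is_derive_approx (f : R -> R) (x l : R) : is_derive x (1 : R) f l ->
  forall e : R, 0 < e -> exists2 d : R, 0 < d &
    forall h : R, `|h| < d -> `|f (x + h) - f x - l * h| <= e * `|h|.
Proof.
move=> [/derivable1_diffP df <-] e e0.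
have := diff_locally df; move/eqaddoP => /(_ e e0) /nbhs_ballP[d d0 h].
exists d => // w wd; have := h w; rewrite /ball /= sub0r normrN => /(_ wd).
have <- : 'd f x w = 'D_1 f x * w.
  by rewrite deriveE // [RHS]mulrC -[RHS]/(w *: _) -linearZ_LR /= -[_ *: 1]/(w * 1) mulr1.
have -> // : f (x + w) - f x - 'd f x w = (f \o shift x - (cst (f x) + 'd f x)) w.
by rewrite fctE opprD addrA /= [w + x]addrC.
Qed.

End RealApprox.

(** * Means over circles in logarithmic polar coordinates *)

Section Polar.
Context {R : realType}.

Definition polar (s th : R) : CC R := ((expR s * cos th)%R +i* (expR s * sin th)%R)%C.

Lemma cabs_polar (s th : R) : cabs (polar s th) = expR s.
Proof.
rewrite /cabs /polar /= !exprMn -mulrDr cos2Dsin2 mulr1 sqrtr_sqr.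
by rewrite ger0_norm // expR_ge0.
Qed.

Lemma polarD (s th h k : R) : polar (s + h) (th + k) = polar s th * polar h k.
Proof.
rewrite /polar; apply/eqP; rewrite eq_complex cReM cImM /= expRD cosD sinD.
by apply/andP; split; apply/eqP; ring.
Qed.

Lemma polar2pi (s : R) : polar s (0 + pi *+ 2) = polar s 0.
Proof. by rewrite /polar cosD2pi sinD2pi. Qed.

Lemma polar_approx0 (e : R) : 0 < e -> exists2 d : R, 0 < d &
  forall h k : R, `|h| < d -> `|k| < d ->
    cabs (polar h k - 1 - (h +i* k)%C) <= e * (`|h| + `|k|).
Proof.
move=> e0; pose e' := Num.min 1 (e / 12).
have e'0 : 0 < e' by rewrite lt_min ltr01 divr_gt0.
have e'1 : e' <= 1 by rewrite ge_min lexx.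
have e'e : e' <= e / 12 by rewrite ge_min lexx orbT.
have [d1 d10 h1] := is_derive_approx (is_derive_expR (0 : R)) e'0.
have [d2 d20 h2] := is_derive_approx (is_derive_cos (0 : R)) e'0.
have [d3 d30 h3] := is_derive_approx (is_derive_sin (0 : R)) e'0.
exists (Num.min (Num.min d1 d2) (Num.min d3 (e' / 2))).
  by rewrite !lt_min d10 d20 d30 divr_gt0.
move=> h k; rewrite !lt_min => /andP[/andP[hd1 _] /andP[_ he]].
move=> /andP[/andP[_ kd2] /andP[kd3 _]].
have := h1 h hd1; have := h2 k kd2; have := h3 k kd3.
rewrite !add0r expR0 cos0 sin0 oppr0 mul0r !mul1r !subr0 !addr0 => s1 c1 x1.
have xb : `|expR h - 1| <= e'.
  have : `|expR h - 1| <= `|expR h - 1 - h| + `|h|.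
    by rewrite -{1}(subrK h (expR h - 1)) ler_normD.
  have := normr_ge0 h; nra.
have xb3 : `|expR h| <= 3.
  have : `|expR h| <= `|expR h - 1| + `|1 : R|.
    by rewrite -{1}(subrK 1 (expR h)) ler_normD.
  rewrite normr1; lra.
have k0 := normr_ge0 k; have h0 := normr_ge0 h.
apply: le_trans (cabs_le_ReIm _) _; rewrite !cReD !cImD !cReN !cImN /= oppr0 addr0.
have -> : expR h * cos k - 1 - h = (expR h - 1 - h) + expR h * (cos k - 1) by ring.
have -> : expR h * sin k - k = expR h * (sin k - k) + (expR h - 1) * k by ring.
have t1 := ler_normD (expR h - 1 - h) (expR h * (cos k - 1)).
have t2 := ler_normD (expR h * (sin k - k)) ((expR h - 1) * k).
rewrite !normrM in t1 t2.
have u1 : `|expR h| * `|cos k - 1| <= 3 * (e' * `|k|) by apply: ler_pM.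

have u2 : `|expR h| * `|sin k - k| <= 3 * (e' * `|k|) by apply: ler_pM.
have u3 : `|expR h - 1| * `|k| <= e' * `|k| by apply: ler_wpM2r.
have u4 : e' * `|k| <= e / 12 * `|k| by apply: ler_wpM2r.
have u5 : e' * `|h| <= e / 12 * `|h| by apply: ler_wpM2r.
apply: le_trans (lerD t1 t2) _.
have : 0 <= e * `|k| by rewrite mulr_ge0 // ltW.
have : 0 <= e * `|h| by rewrite mulr_ge0 // ltW.
set A := `|expR h| * _ in u1 *; set B := `|expR h| * _ in u2 *.
set C := `|expR h - 1| * _ in u3 *.
rewrite mulrDr; lra.
Qed.

(** An increment of the coordinates multiplies the point by [polar h k], so the expansion of [polar]
    at the origin suffices. The number [c] is the derivative of [Q] composed with the
    exponential. *)
Lemma polar_comp_approx (Q : CC R -> CC R) (s th : R) :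
  differentiable Q (polar s th) -> exists A B : R,
  forall e : R, 0 < e -> exists2 d : R, 0 < d &
  forall s' th' : R, `|s' - s| < d -> `|th' - th| < d ->
   cabs (Q (polar s' th') - Q (polar s th)
        - (A +i* B)%C * ((s' - s) +i* (th' - th))%C)
   <= e * (`|s' - s| + `|th' - th|).
Proof.
move=> dQ; pose E0 := polar s th; pose c := 'D_1 Q E0 * E0.
exists (Re c), (Im c) => e e0.
have -> : (Re c +i* Im c)%C = c by case: c.
have E00 : 0 < cabs E0 by rewrite cabs_polar expR_gt0.
pose e1 := Num.min 1 (e / (2 * (cabs c + 1))).
have cc : 0 < cabs c + 1 by rewrite ltr_wpDl // cabs_ge0.
have e10 : 0 < e1 by rewrite lt_min ltr01 divr_gt0 // mulr_gt0.
have e11 : e1 <= 1 by rewrite ge_min lexx.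
have e1c : cabs c * e1 <= e / 2.
  apply: (@le_trans _ _ (cabs c * (e / (2 * (cabs c + 1))))).
    by rewrite ler_wpM2l ?cabs_ge0 // ge_min lexx orbT.
  rewrite mulrA ler_pdivrMr ?mulr_gt0 //; have := cabs_ge0 c; nra.
pose e2 := e / (4 * cabs E0).
have e20 : 0 < e2 by rewrite divr_gt0 // mulr_gt0.
have [d2 d20 h2] := cdifferentiable_approx dQ e20.
have [d1 d10 h1] := polar_approx0 e10.
pose d3 := d2 / (4 * cabs E0).
have d30 : 0 < d3 by rewrite divr_gt0 // mulr_gt0.
exists (Num.min d1 d3); first by rewrite lt_min d10.
move=> s' th'; rewrite !lt_min => /andP[hd1 hd3] /andP[kd1 kd3].
set h := s' - s in hd1 hd3 *; set k := th' - th in kd1 kd3 *.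
have := h1 h k hd1 kd1; set rho := _ - _ => hr.
pose w := E0 * (polar h k - 1).
have wE : polar s' th' = E0 + w.
  rewrite /w mulrBr mulr1 -polarD /h /k /E0 addrC subrK.
  by congr polar; ring.
have hk0 : 0 <= `|h| + `|k| by rewrite addr_ge0.
have hkc : cabs (h +i* k)%C <= `|h| + `|k| by exact: cabs_le_ReIm.
have wc : cabs w <= cabs E0 * (2 * (`|h| + `|k|)).
  rewrite cabsM ler_wpM2l ?cabs_ge0 //.
  have -> : polar h k - 1 = rho + (h +i* k)%C by rewrite /rho subrK.
  apply: le_trans (ler_cabsD _ _) _; nra.
have wd : cabs w < d2.
  apply: le_lt_trans wc _; rewrite mulrA -ltr_pdivlMl ?mulr_gt0 //.
  have : d3 * 2 = (cabs E0 * 2)^-1 * d2.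
    by rewrite /d3; field; rewrite gt_eqF.
  lra.
have := h2 w wd; rewrite -wE; set r := _ - _ => hr2.
have -> : Q (polar s' th') - Q (polar s th) - c * (h +i* k)%C = r + c * rho.
  rewrite /r /rho /c /w /E0; ring.
apply: le_trans (ler_cabsD _ _) _; rewrite cabsM.
have v1 : cabs c * cabs rho <= e / 2 * (`|h| + `|k|).
  apply: le_trans (ler_wpM2l (cabs_ge0 c) hr) _.
  by rewrite mulrA ler_wpM2r.
have v2 : e2 * cabs w <= e / 2 * (`|h| + `|k|).
  apply: le_trans (ler_wpM2l (ltW e20) wc) _.
  rewrite le_eqVlt; apply/orP; left; apply/eqP.
  by rewrite /e2; field; rewrite gt_eqF.
apply: le_trans (lerD (le_trans hr2 v2) v1) _; lra.
Qed.

(* In the coordinate [s + i th] with [z = exp (s + i th)], the horizontal sides of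
   the rectangle [ln q, ln r] x [0, 2 pi] cancel by periodicity, so the mean of
   [Re Q] over circles does not depend on the radius; no differentiability is
   needed at the centre. *)
Lemma circle_maximum (Q : CC R -> CC R) (L : CC R) (r B : R) :
  0 < r < 1 ->
  (forall z, 0 < cabs z < 1 -> differentiable Q z) ->
  (forall e : R, 0 < e -> exists2 d : R, 0 < d &
     forall w, 0 < cabs w < d -> cabs (Q w - L) <= e) ->
  (forall z, cabs z = r -> Re (Q z) <= B) -> Re L <= B.
Proof.
move=> /andP[r0 r1] dQ QL QB; rewrite leNgt; apply/negP => BL.
(* The real part is at most [B] on the circle of radius [r] and at least [Re L - e] on a small one;
   for this [e] the difference is at most [- e], although its mean is zero. *)
pose e := (Re L - B) / 2.
have e0 : 0 < e by rewrite divr_gt0 // subr_gt0.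
have [d d0 hd] := QL e e0.
pose q := Num.min (d / 2) (r / 2).
have q0 : 0 < q by rewrite lt_min !divr_gt0.
have qd : q < d by rewrite gt_min; apply/orP; left; lra.
have qr : q < r by rewrite gt_min; apply/orP; right; lra.
pose a := ln q; pose l := ln r - ln q.
have l0 : 0 < l by rewrite subr_gt0 ltr_ln ?posrE.
have m0 : 0 < (pi : R) *+ 2 by rewrite pmulrn_lgt0 // pi_gt0.
pose P s th := Re (Q (polar s th)); pose V s th := Im (Q (polar s th)).
have al : a + l = ln r by rewrite /a /l addrC subrK.
have dPV : forall s th : R, a <= s <= a + l -> 0 <= th <= 0 + pi *+ 2 ->
  exists A B : R, forall e : R, 0 < e -> exists2 d : R, 0 < d &
  forall s' th' : R, `|s' - s| < d -> `|th' - th| < d ->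
   `|P s' th' - P s th - (A * (s' - s) - B * (th' - th))|
      <= e * (`|s' - s| + `|th' - th|) /\
   `|V s' th' - V s th - (B * (s' - s) + A * (th' - th))|
      <= e * (`|s' - s| + `|th' - th|).
  move=> s th /andP[_ sl] _.
  have [|A [B' h]] := @polar_comp_approx Q s th.
    apply: dQ; rewrite cabs_polar expR_gt0 /= (le_lt_trans _ r1) //.
    by rewrite -(lnK r0) ler_expR -al.
  exists A, B' => e1 e10; have [d1 d10 h1] := h e1 e10.
  exists d1 => // s' th' hs ht; have := h1 s' th' hs ht.
  set X := _ - _ => hX; split; apply: le_trans hX.
    apply: le_trans (normr_Re_le X); rewrite /X /P cReD cReN cReM /=.
    by rewrite cReD cReN.
  apply: le_trans (normr_Im_le X); rewrite /X /V cImD cImN cImM /=.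
  by rewrite cImD cImN [A * _ + _]addrC.
have := goursat l0 m0 dPV.
have -> : (fun s => V s 0 - V s (0 + pi *+ 2)) = cst 0.
  by apply/funext => s; rewrite /V polar2pi subrr.
have -> : itv_int (cst 0) a (a + l) = 0 :> R.
  by rewrite /itv_int Rintegral_cst //= mul0r.
rewrite addr0 => I0.
have : itv_int (fun th => P (a + l) th - P a th) 0 (0 + pi *+ 2)
       <= - e * (0 + pi *+ 2 - 0).
  apply: itv_int_le; first by rewrite add0r ltW.
    by apply: continuous_on_itvB => th hth; apply: (goursat_contr dPV) => //;
      rewrite ?lexx ?lerDl ?lerDr ?ltW.
  move=> th _.
  have p1 : P (a + l) th <= B by apply: QB; rewrite cabs_polar al lnK.
  have : cabs (Q (polar a th) - L) <= e.
    by apply: hd; rewrite cabs_polar lnK // q0.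
  move=> /(le_trans (normr_Re_le _)); rewrite cReD cReN ler_norml => /andP[p2 _].
  rewrite -/(P a th) in p2; rewrite /e in p2 *; lra.
rewrite I0 add0r subr0 mulNr oppr_ge0 leNgt mulr_gt0 //.
Qed.

End Polar.

Section Schwarz.
Context {R : realType}.
Implicit Types (f g : CC R -> CC R).

(* The function [f z / z] extends by [f'(0)] at the origin, and a rotation makes
   this value real and nonnegative. *)
Lemma schwarz_derive f : f 0 = 0 ->
  (forall z, disc z -> differentiable f z) ->
  (forall z, disc z -> cabs (f z) <= 1) -> cabs ('D_1 f 0) <= 1.
Proof.
move=> f0 df fb.
have d0 : disc (0 : CC R) by rewrite /disc /= cabs0 ltr01.
have [u u1 <-] := unimodular_rotation ('D_1 f 0).
have key (r : R) : 0 < r < 1 -> r * Re (u * 'D_1 f 0) <= 1.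
  move=> /andP[r0 r1]; rewrite mulrC -ler_pdivlMr // mul1r.
  apply: (@circle_maximum _ (fun z => u * (f z * z^-1)) _ r) => //.
  - by rewrite r0.
  - move=> z /andP[z0 z1]; apply: differentiableM; first exact: differentiable_cst.
    apply: differentiableM; first exact: df.
    by apply: differentiableV => //; rewrite -cabs_gt0.
  - move=> e e0; have [d dp h] := cdifferentiable_approx (df 0 d0) e0.
    exists d => // w /andP[w0 wd]; have wn : w != 0 by rewrite -cabs_gt0.
    have -> : u * (f w * w^-1) - u * 'D_1 f 0 = u * ((f w - 'D_1 f 0 * w) * w^-1).
      by rewrite mulrBl mulfK // mulrBr.
    rewrite !cabsM u1 mul1r cabsV ler_pdivrMr //.
    by have := h w wd; rewrite add0r f0 subr0.
  move=> z zr; apply: le_trans (ler_norm _) _; apply: le_trans (normr_Re_le _) _.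
  rewrite !cabsM u1 mul1r cabsV zr ler_piMl ?invr_ge0 ?(ltW r0) //.
  by apply: fb; rewrite /disc /= zr.
rewrite leNgt; apply/negP => h.
set x := Re _ in key h.
have x0 : 0 < x by apply: lt_trans h.
(* Midway between [x^-1] and 1, this radius times [x] is [(1 + x) / 2 > 1], against [key]. *)
have : 0 < (1 + x^-1) / 2 < 1.
  rewrite divr_gt0 ?addr_gt0 ?invr_gt0 //= ltr_pdivrMr // mul1r.
  by rewrite -[ltRHS]/(1 + 1) ltrD2l invf_lt1.
move=> /key; rewrite mulrAC mulrDl mul1r mulVf ?gt_eqF //.
by rewrite ler_pdivrMr // mul1r -lerBrDr -[2]/(1 + 1) addrK leNgt h.
Qed.

(* Schwarz lemma for the Cayley transform [(g - g 0) / (g + conj (g 0))]. *)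
Lemma halfplane_schwarz g :
  (forall z, disc z -> differentiable g z /\ 0 < Re (g z)) ->
  cabs ('D_1 g 0) <= 2 * Re (g 0).
Proof.
move=> hg; have d0 : disc (0 : CC R) by rewrite /disc /= cabs0 ltr01.
have [dg0 g0] := hg 0 d0.
pose k : CC R := (Re (g 0) -i* Im (g 0))%C.
pose f z := (g z - g 0) * (g z + k)^-1.
have gk z : disc z -> g z + k != 0.
  move=> /hg[_ gz]; apply/eqP => /(congr1 (@complex.Re R)); rewrite cReD /=.
  by apply/eqP; rewrite gt_eqF // addr_gt0.
have dgk z : disc z -> differentiable (fun z => g z + k) z.
  by move=> dz; apply: differentiableD; [exact: (hg z dz).1|exact: differentiable_cst].
have dgB z : disc z -> differentiable (fun z => g z - g 0) z.
  by move=> dz; apply: differentiableB; [exact: (hg z dz).1|exact: differentiable_cst].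
have := @schwarz_derive f; rewrite {1}/f subrr mul0r => /(_ erefl).
have -> : 'D_1 f 0 = 'D_1 g 0 * (2 * Re (g 0))%:C%C^-1.
  have gk0 : g 0 + k = (2 * Re (g 0))%:C%C.
    apply/eqP; rewrite eq_complex cReD cImD /= subrr eqxx andbT.
    by apply/eqP; ring.
  have dd : is_derive (0 : CC R) (1 : CC R) g ('D_1 g 0).
    by apply: derivableP; exact: diff_derivable.
  have d1 : is_derive (0 : CC R) (1 : CC R) (fun z => g z - g 0) ('D_1 g 0 - 0).
    by apply: is_deriveB.
  have d2 : derivable (fun z => (g z + k)^-1) (0 : CC R) 1.
    by apply: derivableV; [exact: gk|apply: diff_derivable; exact: dgk].
  have d1' : derivable (fun z => g z - g 0) (0 : CC R) 1 by case: d1.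
  have fE : f = (fun z => g z - g 0) * (fun z => (g z + k)^-1) by [].
  rewrite fE (deriveM d1' d2) (@derive_val _ _ _ _ _ _ _ d1).
  have -> : (fun z => g z - g 0) 0 = 0 by rewrite /= subrr.
  rewrite scale0r add0r subr0 [LHS]mulrC; congr (_ / _).
  exact: gk0.
rewrite cabsM cabsV cabs_real (@ger0_norm _ (2 * _)) ?mulr_ge0 ?(ltW g0) //.
rewrite ler_pdivrMr ?mulr_gt0 // mul1r; apply.
- move=> z dz; apply: differentiableM; first exact: dgB.
  by apply: differentiableV; [exact: dgk|exact: gk].
- move=> z dz; have [_ gz] := hg z dz.
  rewrite /f cabsM cabsV ler_pdivrMr ?cabs_gt0 ?gk // mul1r.
  (* The squared moduli of denominator and numerator differ by [4 * Re (g z) * Re (g 0)]. *)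
  apply: ler_sqr_cabs; first exact: cabs_ge0.
  rewrite sqr_cabs !cReD !cImD !cReN !cImN /=; nra.
Qed.

(** Adding [M + 1] moves the values into the right half-plane, with real part at most [2 * M + 1] at
    0. *)
Lemma bounded_schwarz g (M : R) :
  (forall z, disc z -> differentiable g z /\ cabs (g z) <= M) ->
  cabs ('D_1 g 0) <= 4 * (M + 1).
Proof.
move=> hg; have d0 : disc (0 : CC R) by rewrite /disc /= cabs0 ltr01.
have [dg0 g0] := hg 0 d0.
pose c : CC R := (M + 1)%:C%C.
have := @halfplane_schwarz (cst c + g).
have -> : 'D_1 (cst c + g) 0 = 'D_1 g 0.
  rewrite deriveD ?derive_cst ?add0r //; exact: diff_derivable.
have cgE z : (cst c + g) z = c + g z by [].
have Reg z : cabs (g z) <= M -> `|Re (g z)| <= M.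
  exact: le_trans (normr_Re_le _).
move=> h; apply: le_trans (h _) _.
  move=> z /hg[dz /Reg]; rewrite ler_norml => /andP[gz _]; split.
    have dc : differentiable (cst c : CC R -> CC R) z := differentiable_cst _ _.
    exact: (differentiableD dc dz).
  rewrite cgE cReD /=; lra.
have := Reg 0 g0; rewrite ler_norml cgE cReD /= => /andP[_]; lra.
Qed.

End Schwarz.

(** * Infinitesimal bounds along holomorphic discs *)

Section Recentering.
Context {R : realType}.

Lemma derive_comp_disc (W : normedModType (CC R)) (phi : CC R -> W)
    (m : CC R -> CC R) (z : CC R) :
  differentiable m z -> differentiable phi (m z) ->
  'D_1 (phi \o m) z = 'D_1 m z *: 'D_1 phi (m z).
Proof.
move=> dm dphi.
have dc : differentiable (phi \o m) z := differentiable_comp dm dphi.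
have -> : 'D_1 (phi \o m) z = 'd (phi \o m) z 1 := deriveE _ dc.
have -> : 'D_1 m z = 'd m z 1 := deriveE _ dm.
have -> : 'D_1 phi (m z) = 'd phi (m z) 1 := deriveE _ dphi.
have lin (f : {linear CC R -> W}) (a : CC R) : f a = a *: f 1.
  by rewrite -linearZ_LR; congr (f _); rewrite -[RHS]/(a * 1) mulr1.
have E : 'd (phi \o m) z 1 = 'd phi (m z) ('d m z 1).
  exact (congr1 (fun F : CC R -> W => F 1) (diff_comp dm dphi)).
exact (etrans E (lin _ _)).
Qed.

Variables (c : CC R) (rho : R).
Hypotheses (c1 : cabs c < 1) (rho01 : 0 < rho <= 1).

Let cj : CC R := (Re c -i* Im c)%C.
Let mob (z : CC R) : CC R := (z + c) * (1 + cj * z)^-1.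
Let rc : CC R := (rho%:C)%C.

(* The Moebius automorphism of the disc sending 0 to [c], precomposed with the
   contraction by [rho]. *)
Definition recenter (z : CC R) : CC R := mob (rc * z).

Let cabs_cj : cabs cj = cabs c.
Proof. by rewrite /cabs /cj /= sqrrN. Qed.

Let den_neq0 (z : CC R) : disc z -> 1 + cj * z != 0.
Proof.
move=> z1; rewrite -cabs_gt0; have := ler_cabsB 1 (cj * z).
rewrite cabs1 cabsM cabs_cj => h.
have := cabs_ge0 c; have := cabs_ge0 z; move: z1 c1; rewrite /disc /=; nra.
Qed.

Let scale_disc (z : CC R) : disc z -> disc (rc * z).
Proof.
have /andP[r0 r1] := rho01.
rewrite /disc /= cabsM cabs_real gtr0_norm // => z1.
have := cabs_ge0 z; nra.
Qed.

Lemma recenter_disc (z : CC R) : disc z -> disc (recenter z).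
Proof.
move=> /scale_disc; rewrite /recenter; move: (rc * z) => w w1.
rewrite /disc /= cabsM cabsV ltr_pdivrMr ?cabs_gt0 ?den_neq0 // mul1r.
rewrite -(@ltr_pXn2r _ 2) ?nnegrE ?cabs_ge0 // !sqr_cabs.
have a1 : cabs c ^+ 2 < 1 by rewrite expr_lt1 ?cabs_ge0.
have b1 : cabs w ^+ 2 < 1 by rewrite expr_lt1 ?cabs_ge0.
rewrite !sqr_cabs in a1 b1.
(* This product equals the squared modulus of [1 + cj * w] minus that of [w + c]. *)
have ab : 0 < (1 - (Re c ^+ 2 + Im c ^+ 2)) * (1 - (Re w ^+ 2 + Im w ^+ 2)).
  by rewrite mulr_gt0 // subr_gt0.
rewrite !cReD !cImD !cReM !cImM /cj /= -subr_gt0; apply: lt_le_trans ab _.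
rewrite le_eqVlt; apply/orP; left; apply/eqP; ring.
Qed.

Lemma recenter0 : recenter 0 = c.
Proof. by rewrite /recenter /mob !mulr0 add0r addr0 invr1 mulr1. Qed.

Lemma differentiable_recenter (z : CC R) : disc z -> differentiable recenter z.
Proof.
move=> z1.
have dl : differentiable (fun z => rc * z) z.
  by apply: differentiableM; [exact: differentiable_cst|apply/derivable1_diffP; exact: derivable_id].
have dn : differentiable (fun z => rc * z + c) z.
  by apply: differentiableD; [exact: dl|exact: differentiable_cst].
have dd : differentiable (fun z => 1 + cj * (rc * z)) z.
  apply: differentiableD; first exact: differentiable_cst.
  by apply: differentiableM; [exact: differentiable_cst|exact: dl].
apply: differentiableM; first exact: dn.
by apply: differentiableV; [exact: dd|apply: den_neq0; exact: scale_disc].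
Qed.

Lemma derive_recenter : 'D_1 recenter 0 = ((rho * (1 - cabs c ^+ 2))%:C)%C.
Proof.
have d0 : disc (0 : CC R) by rewrite /disc /= cabs0 ltr01.
pose k : CC R := ((rho * (1 - cabs c ^+ 2))%:C)%C.
pose g (z : CC R) := (1 + cj * (rc * z))^-1.
have dg : derivable g (0 : CC R) 1.
  apply: diff_derivable; apply: differentiableV; last exact: (den_neq0 (scale_disc d0)).
  apply: differentiableD; first exact: differentiable_cst.
  apply: differentiableM; first exact: differentiable_cst.
  by apply: differentiableM; [exact: differentiable_cst|apply/derivable1_diffP; exact: derivable_id].
have did : derivable (id : CC R -> CC R) (0 : CC R) 1 by exact: derivable_id.
have dM : derivable (id * g) (0 : CC R) 1 := derivableM did dg.
have dZ : derivable (k *: (id * g)) (0 : CC R) 1 := derivableZ dM.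
(* Splitting off the value at 0 leaves [k] times [z / (1 + cj * (rc * z))], whose derivative at 0
   can be read off. *)
have E (z : CC R) : disc z -> recenter z = (cst c + k *: (id * g)) z.
  move=> z1; have zd := den_neq0 (scale_disc z1).
  rewrite /recenter /mob -[RHS]/(c + k * (z * (1 + cj * (rc * z))^-1)).
  set d := 1 + _ in zd *.
  have h2 : (c + k * (z / d)) * d = c * d + k * z by rewrite mulrDl -mulrA mulfVK.
  apply: (mulIf zd); rewrite h2; apply: etrans (mulfVK zd _) _; rewrite /d.
  rewrite /k /cj; case: (c) => a b; rewrite sqr_cabs /=.
  apply/eqP; rewrite eq_complex !(cReD, cImD, cReM, cImM) /rc /=.
  by apply/andP; split; apply/eqP; ring.
rewrite (@near_eq_derive _ _ _ _ (cst c + k *: (id * g))); last first.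
  apply/nbhs_CCP; exists 1 => // w; rewrite subr0 => w1; exact: E.
rewrite (deriveD (derivable_cst _ _ _) dZ) derive_cst add0r (deriveZ _ dM).
rewrite (deriveM did dg) derive_id.
rewrite scale0r add0r /g !mulr0 addr0 invr1.
by rewrite -[LHS]/(k * (1 * 1)) !mulr1.
Qed.

End Recentering.

Section DiscBounds.
Context {R : realType} {n : nat}.
Variable Om : set (Cn R n).

Lemma hol_disc_recenter (phi : CC R -> Cn R n) (c : CC R) (rho : R) :
  hol_disc Om phi -> cabs c < 1 -> 0 < rho <= 1 ->
  hol_disc Om (phi \o recenter c rho).
Proof.
move=> hphi c1 r1 z dz; have md := recenter_disc c1 r1 dz.
have [d o] := hphi _ md; split; last exact: o.
exact (differentiable_comp (differentiable_recenter c1 r1 dz) d).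
Qed.

Lemma kr_derive_le (phi : CC R -> Cn R n) :
  hol_disc Om phi -> kr Om (phi 0) ('D_1 phi 0) <= 1.
Proof.
move=> hphi; apply: ge_inf; first by exists 0 => r [a [psi [_ _ _ ->]]]; exact: cabs_ge0.
by exists 1, phi; split; rewrite ?scale1r ?cabs1.
Qed.

(** The disc recentred at [c] is a competitor for [kr] of its own derivative, which the automorphism
    multiplies by [1 - cabs c ^+ 2]. The left-hand side is thus [c0] times the speed per unit of
    Poincare time. *)
Lemma disc_speed (c0 : R) (w : R -> R) :
  (forall x v, Om x -> c0 * enorm v / w (bdist Om x) <= kr Om x v) ->
  (forall x, Om x -> 0 < w (bdist Om x)) ->
  forall (phi : CC R -> Cn R n) (c : CC R), hol_disc Om phi -> cabs c < 1 ->
  c0 * ((1 - cabs c ^+ 2) * enorm ('D_1 phi c)) <= w (bdist Om (phi c)).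
Proof.
move=> hkr w0 phi c hphi c1; have r1 : 0 < (1 : R) <= 1 by rewrite ltr01 lexx.
have h := hol_disc_recenter hphi c1 r1.
have := kr_derive_le h.
have d0 : disc (0 : CC R) by rewrite /disc /= cabs0 ltr01.
have [dc oc] := hphi c c1.
have dr : differentiable phi (recenter c 1 0) by rewrite recenter0.
rewrite (derive_comp_disc (differentiable_recenter c1 r1 d0) dr).
rewrite (derive_recenter c1 r1) mul1r /= recenter0.
move=> /(le_trans (hkr _ _ oc)); rewrite ler_pdivrMr ?w0 // mul1r.
rewrite enorm_scale cabs_real ger0_norm //.
by rewrite subr_ge0 expr_le1 ?cabs_ge0 // ltW.
Qed.

(* Royden localization: the disc recentred at [c] and shrunk by [rho] stays in
   [U], so the half-plane Schwarz lemma applies to [h] along it. *)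
Lemma disc_growth (U : set (Cn R n)) (h : Cn R n -> CC R)
    (phi : CC R -> Cn R n) (c : CC R) (rho : R) :
  (forall z, Om z -> U z -> differentiable h z /\ 0 < Re (h z)) ->
  hol_disc Om phi -> cabs c < 1 -> 0 < rho <= 1 ->
  (forall psi, hol_disc Om psi -> psi 0 = phi c ->
     forall z, cabs z < rho -> U (psi z)) ->
  rho * ((1 - cabs c ^+ 2) * cabs ('D_1 (h \o phi) c)) <= 2 * Re (h (phi c)).
Proof.
move=> hh hphi c1 r1 hU; have r11 : 0 < (1 : R) <= 1 by rewrite ltr01 lexx.
have d0 : disc (0 : CC R) by rewrite /disc /= cabs0 ltr01.
have /andP[r0 _] := r1.
(* The hypothesis concerns discs of full radius, so it is applied to the unshrunk recentring; the
   shrunk disc at [z] is that one at [rho * z]. *)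
have U1 := hU _ (hol_disc_recenter hphi c1 r11).
rewrite /= recenter0 in U1.
have Uc z : disc z -> U (phi (recenter c rho z)).
  move=> z1; have := U1 erefl ((rho%:C)%C * z).
  rewrite /recenter /= mul1r; apply.
  rewrite cabsM cabs_real gtr0_norm // gtr_pMr //.
have hz z : disc z -> differentiable h (phi (recenter c rho z)) /\
    0 < Re (h (phi (recenter c rho z))).
  by move=> z1; apply: hh; [exact: (hol_disc_recenter hphi c1 r1 z1).2|exact: Uc].
have := @halfplane_schwarz _ ((h \o phi) \o recenter c rho).
have [dc oc] := hphi c c1.
have := hz 0 d0; rewrite recenter0 => -[dh0 _].
have dr : differentiable (h \o phi) (recenter c rho 0).
  by rewrite recenter0; exact (differentiable_comp dc dh0).
rewrite (derive_comp_disc (differentiable_recenter c1 r1 d0) dr).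
rewrite (derive_recenter c1 r1) /= recenter0 -[_ *: _]/(_ * _) cabsM cabs_real.
rewrite ger0_norm; last first.
  by rewrite mulr_ge0 ?(ltW r0) // subr_ge0 expr_le1 ?cabs_ge0 // ltW.
rewrite mulrA; apply => z z1; split; last exact: (hz z z1).2.
have dphi := (hphi _ (recenter_disc c1 r1 z1)).1.
exact (differentiable_comp (differentiable_recenter c1 r1 z1)
  (differentiable_comp dphi (hz z z1).1)).
Qed.

End DiscBounds.

(** * Continuity method and Poincare length along a radius *)

Section RealInduction.
Context {R : realType}.

(** Let [T] be the supremum of the initial segments on which [P] holds: the closing condition gives
    [P T], and the opening condition excludes [T < 1]. *)
Lemma real_induction (P : R -> Prop) :
  P 0 ->
  (forall t : R, 0 <= t < 1 -> P t -> exists2 d : R, 0 < d &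
     forall s : R, t < s < t + d -> P s) ->
  (forall t : R, 0 < t <= 1 -> (forall s : R, 0 <= s < t -> P s) -> P t) ->
  P 1.
Proof.
move=> P0 Popen Pclosed.
pose S := [set t : R | 0 <= t <= 1 /\ forall s : R, 0 <= s <= t -> P s].
have S0 : S 0.
  split; first by rewrite lexx ler01.
  by move=> s; rewrite -eq_le => /eqP <-.
have ubS : ubound S 1 by move=> t [/andP[]].
have hS : has_sup S by split; [exists 0|exists 1].
pose T := sup S.
have T0 : 0 <= T by apply: ub_le_sup => //; exists 1.
have T1 : T <= 1 by apply: ge_sup => //; exists 0.
have below (s : R) : 0 <= s < T -> P s.
  move=> /andP[s0 sT]; have [t [_ tP] st] := sup_gt hS.1 sT.
  by apply: tP; rewrite s0 ltW.
have PT : P T.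
  have [->//|Tn] := eqVneq T 0.
  by apply: Pclosed => //; rewrite lt_def Tn T0.
have [<-//|Tn1] := eqVneq T 1.
have Tl1 : T < 1 by rewrite lt_def eq_sym Tn1.
have [|d d0 hd] := Popen T _ PT; first by rewrite T0.
pose T' := Num.min 1 (T + d / 2).
have TT' : T < T' by rewrite lt_min Tl1 ltrDl divr_gt0.
have ST' : S T'.
  split; first by rewrite (le_trans T0 (ltW TT')) ge_min lexx.
  move=> s /andP[s0]; rewrite le_min => /andP[s1 sT].
  case: (ltgtP s T) => [sT1|Ts|->//]; first by apply: below; rewrite s0.
  by apply: hd; rewrite Ts /=; lra.
have : T' <= T by apply: ub_le_sup => //; exists 1.
by rewrite leNgt TT'.
Qed.

End RealInduction.

Section PoincareRadial.
Context {R : realType}.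
Implicit Types m t h x : R.

(** The Poincare distance from 0 to [t * zeta] when [cabs zeta = m]; its derivative in [t] is
    [m / (1 - t ^+ 2 * m ^+ 2)]. *)
Definition pdist_radial m t : R := 2^-1 * ln ((1 + t * m) / (1 - t * m)).

Lemma ln_ge_1subV x : 0 < x -> 1 - x^-1 <= ln x.
Proof.
move=> x0; have := expR_ge1Dx (- ln x).
by rewrite expRN lnK ?posrE // => h; lra.
Qed.

Lemma one_sub_expRN_ge x : 0 <= x -> x - x ^+ 2 <= 1 - expR (- x).
Proof.
move=> x0; rewrite expRN.
have x1 : 0 < 1 + x by rewrite ltr_wpDr.
have : (expR x)^-1 <= (1 + x)^-1 by rewrite lef_pV2 ?posrE ?expR_gt0 // expR_ge1Dx.
have : (1 + x)^-1 <= 1 - x + x ^+ 2.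
  rewrite -[leLHS]mul1r ler_pdivrMr //.
  have : 0 <= x * x ^+ 2 by rewrite mulr_ge0 // sqr_ge0.
  have -> : (1 - x + x ^+ 2) * (1 + x) = 1 + x * x ^+ 2 by ring.
  lra.
lra.
Qed.

(** Both logarithms are bounded below by [1 - x^-1]. A lower bound on the elapsed time is what is
    wanted, since it has to dominate displacement and growth; the error [h ^+ 2] is left to the
    slack of the induction. *)
Lemma pdist_radial_incr m t h : 0 <= m < 1 -> 0 <= t -> 0 < h -> t + h <= 1 ->
  h * (m / (1 - t ^+ 2 * m ^+ 2)) - h ^+ 2
    <= pdist_radial m (t + h) - pdist_radial m t.
Proof.
move=> /andP[m0 m1] t0 h0 th.
have tm0 : 0 <= t * m by rewrite mulr_ge0.
have hm0 : 0 <= h * m by rewrite mulr_ge0 // ltW.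
have thm : t * m + h * m < 1 by rewrite -mulrDl; nra.
have a1 : 0 < 1 + t * m by lra.
have a2 : 0 < 1 - t * m by lra.
have a3 : 0 < 1 + t * m + h * m by lra.
have a4 : 0 < 1 - t * m - h * m by lra.
rewrite /pdist_radial -[leRHS]mulrBr.
have -> : 1 + (t + h) * m = 1 + t * m + h * m by ring.
have -> : 1 - (t + h) * m = 1 - t * m - h * m by ring.
rewrite !ln_div ?posrE //.
have l1 := @ln_ge_1subV ((1 + t * m + h * m) / (1 + t * m)) (divr_gt0 a3 a1).
have l2 := @ln_ge_1subV ((1 - t * m) / (1 - t * m - h * m)) (divr_gt0 a2 a4).
rewrite ln_div ?posrE // in l1; rewrite ln_div ?posrE // in l2.
have e1 : 1 - ((1 + t * m + h * m) / (1 + t * m))^-1 = h * m / (1 + t * m + h * m).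
  by field; rewrite !gt_eqF.
have e2 : 1 - ((1 - t * m) / (1 - t * m - h * m))^-1 = h * m / (1 - t * m).
  by field; rewrite !gt_eqF.
rewrite e1 in l1; rewrite e2 in l2.
have e3 : h * m / (1 + t * m) - (h * m) ^+ 2 <= h * m / (1 + t * m + h * m).
  rewrite -subr_ge0.
  have -> : h * m / (1 + t * m + h * m) - (h * m / (1 + t * m) - (h * m) ^+ 2)
    = (h * m) ^+ 2 * (1 - ((1 + t * m + h * m) * (1 + t * m))^-1).
    by field; rewrite !gt_eqF.
  rewrite mulr_ge0 ?sqr_ge0 // subr_ge0 invf_le1 ?mulr_gt0 //; nra.
have e4 : h * (m / (1 - t ^+ 2 * m ^+ 2))
    = 2^-1 * (h * m / (1 + t * m) + h * m / (1 - t * m)).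
  have -> : 1 - t ^+ 2 * m ^+ 2 = (1 + t * m) * (1 - t * m) by ring.
  by field; rewrite !gt_eqF.
have e5 : (h * m) ^+ 2 <= h ^+ 2.
  by rewrite exprMn ler_piMr ?sqr_ge0 // expr_le1 // ltW.
have := sqr_ge0 h; rewrite e4; lra.
Qed.

Lemma pdist_radial_mono m s t : 0 <= m < 1 -> 0 <= s -> s <= t -> t <= 1 ->
  pdist_radial m s <= pdist_radial m t.
Proof.
move=> /andP[m0 m1] s0 st t1; rewrite /pdist_radial.
have b1 : s * m <= t * m by rewrite ler_wpM2r.
have b2 : t * m < 1 by nra.
have b3 : 0 <= s * m by rewrite mulr_ge0.
rewrite ler_wpM2l // ler_ln ?posrE ?divr_gt0 //; try lra.
rewrite ler_pM ?invr_ge0 //; try lra.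
by rewrite lef_pV2 ?posrE; lra.
Qed.

Lemma pdist_radial0 m : pdist_radial m 0 = 0.
Proof. by rewrite /pdist_radial mul0r addr0 subr0 divr1 ln1 mulr0. Qed.

Lemma pdist_radial1 (z : CC R) : pdist_radial (cabs z) 1 = pdist0 z.
Proof. by rewrite /pdist_radial mul1r. Qed.

Lemma pdist0_ge0 (z : CC R) : disc z -> 0 <= pdist0 z.
Proof.
move=> z1; rewrite -pdist_radial1 -(pdist_radial0 (cabs z)).
by apply: pdist_radial_mono => //; rewrite cabs_ge0.
Qed.

End PoincareRadial.

Section LocalLipschitz.
Context {R : realType}.

Lemma disc_local_lipschitz (n : nat) (phi : CC R -> Cn R n) (c : CC R) :
  differentiable phi c -> forall e : R, 0 < e -> exists2 d : R, 0 < d &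
    forall w, cabs w < d ->
      enorm (phi (c + w) - phi c) <= (enorm ('D_1 phi c) + e) * cabs w.
Proof.
move=> dphi e e0; have [d d0 h] := differentiable_approx dphi e0.
exists d => // w wd; have := h w wd.
have := ler_enormD (phi (c + w) - phi c - w *: 'D_1 phi c) (w *: 'D_1 phi c).
rewrite subrK enorm_scale mulrDl [enorm _ * cabs _]mulrC; lra.
Qed.

Lemma holo_local_lipschitz (f : CC R -> CC R) (c : CC R) :
  differentiable f c -> forall e : R, 0 < e -> exists2 d : R, 0 < d &
    forall w, cabs w < d ->
      `|Re (f (c + w)) - Re (f c)| <= (cabs ('D_1 f c) + e) * cabs w.
Proof.
move=> df e e0; have [d d0 h] := cdifferentiable_approx df e0.
exists d => // w wd; have := h w wd.
have := ler_cabsD (f (c + w) - f c - 'D_1 f c * w) ('D_1 f c * w).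
rewrite subrK cabsM mulrDl -cReN -cReD.
have := normr_Re_le (f (c + w) - f c); lra.
Qed.

Lemma is_derive_incr_le (G : R -> R) (u l : R) : is_derive u (1 : R) G l ->
  0 <= l -> forall e : R, 0 < e -> exists2 d : R, 0 < d &
    forall v : R, `|v| < d -> `|G (u + v) - G u| <= (l + e) * `|v|.
Proof.
move=> dG l0 e e0; have [d d0 h] := is_derive_approx dG e0.
exists d => // v vd; have := h v vd.
have := ler_normD (G (u + v) - G u - l * v) (l * v).
rewrite subrK normrM (ger0_norm l0) mulrDl; lra.
Qed.

Lemma mul_add_small (X Y e : R) : 0 <= X -> 0 <= Y -> 0 < e ->
  exists2 d : R, 0 < d & (X + d) * (Y + d) <= X * Y + e.
Proof.
move=> X0 Y0 e0; pose k := X + Y + 1.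
have k0 : 0 < k by rewrite /k; lra.
pose d := Num.min 1 (e / k).
have d0 : 0 < d by rewrite lt_min ltr01 divr_gt0.
exists d => //.
have d1 : d <= 1 by rewrite ge_min lexx.
have : d * k <= e by rewrite -ler_pdivlMr // ge_min lexx orbT.
rewrite /k; nra.
Qed.

End LocalLipschitz.

(** * Growth of the boundary distance along a disc *)

Section Propagation.
Context {R : realType} {n : nat}.
Variables (Om : set (Cn R n)) (c0 : R) (w W : R -> R) (s0 : R).
Hypothesis c0_gt0 : 0 < c0.
Hypothesis w_gt0 : forall t : R, 0 < t -> 0 < w t.
Hypothesis bdist_gt0 : forall z, Om z -> 0 < bdist Om z.
Hypothesis speed : forall (phi : CC R -> Cn R n) (c : CC R),
  hol_disc Om phi -> cabs c < 1 ->
  c0 * ((1 - cabs c ^+ 2) * enorm ('D_1 phi c)) <= w (bdist Om (phi c)).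
(* [W] stands for the primitive of [w s / s]; [(b - a) / b] replaces [ln (b / a)],
   from which it differs to second order only. *)
Hypothesis W_incr : forall s a b : R, 0 < s -> s <= a -> a <= b -> b <= s0 ->
  w s * ((b - a) / b) <= W b - W a.

(* [K] is the admissible growth rate of [G u], with [u = Re h], per unit of
   Poincare time; [rho z] is a radius below which discs centred at [z] stay in the
   domain [U] of [h]. *)
Variables (h : Cn R n -> CC R) (U : set (Cn R n)) (x : Cn R n) (d : R).
Variables (rho : Cn R n -> R) (G dG : R -> R) (K A : R).
Hypothesis K_gt0 : 0 < K.
Hypothesis A_gt0 : 0 < A.
Hypothesis h_holo :
  forall z, Om z -> U z -> differentiable h z /\ 0 < Re (h z).
Hypothesis rho_loc : forall z, Om z -> enorm (z - x) < d ->
  0 < rho z <= 1 /\ forall psi, hol_disc Om psi -> psi 0 = z ->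
     forall xi, cabs xi < rho z -> U (psi xi).
Hypothesis dGP : forall u : R, 0 < u -> is_derive u (1 : R) G (dG u) /\ 0 <= dG u.
Hypothesis dG_rho : forall z, Om z -> enorm (z - x) < d ->
  dG (Re (h z)) * (2 * Re (h z)) <= K * rho z.
Hypothesis bdist_G : forall z, Om z -> enorm (z - x) < d ->
  forall tau : R, G (Re (h z)) <= G (Re (h x)) + K * tau ->
  bdist Om z <= A * expR (K * tau).

(** When the distance bound grows by the factor [expR (K * dtau)], its [W] gains about
    [K * w * dtau], while the displacement is at most [w / c0 * dtau]; so [kap * W] dominates the
    displacement. *)
Let kap := (K * c0)^-1.
Let kap_gt0 : 0 < kap.
Proof. by rewrite invr_gt0 mulr_gt0. Qed.

Let W_mono (a b : R) : 0 < a -> a <= b -> b <= s0 -> W a <= W b.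
Proof.
move=> a0 ab bs; rewrite -subr_ge0; apply: le_trans (W_incr a0 (lexx a) ab bs).
by rewrite mulr_ge0 ?(ltW (w_gt0 a0)) // divr_ge0 ?subr_ge0 // (le_trans (ltW a0)).
Qed.

Section Disc.
Variables (phi : CC R -> Cn R n) (zeta : CC R) (tau0 s1 : R).
Hypothesis hphi : hol_disc Om phi.
Hypothesis zeta1 : cabs zeta < 1.
Hypothesis s1s0 : s1 <= s0.
Hypothesis Ws1 : kap * W s1 < d.

Let m := cabs zeta.
Let p := pdist_radial m.
Let c (t : R) : CC R := ((t%:C)%C * zeta).
(** Will bound the boundary distance at [z t]; the factor 2 makes room for [expR e], the effect of
    the slack in the induction. *)
Let a (t : R) := 2 * A * expR (K * (tau0 + p t)).
Hypothesis as1 : a 1 <= s1.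
Let z (t : R) := phi (c t).
Let gu (t : R) := G (Re (h (z t))).
Let speed_at (t : R) := enorm ('D_1 phi (c t)).
Let growth_at (t : R) := dG (Re (h (z t))) * cabs ('D_1 (h \o phi) (c t)).

Let m01 : 0 <= m < 1.
Proof. by rewrite cabs_ge0 zeta1. Qed.

Let cabs_c (t : R) : 0 <= t -> cabs (c t) = t * m.
Proof. by move=> t0; rewrite cabsM cabs_real ger0_norm. Qed.

Let c_disc (t : R) : 0 <= t <= 1 -> cabs (c t) < 1.
Proof.
by move=> /andP[t0 t1]; rewrite cabs_c //; have /andP[? ?] := m01; nra.
Qed.

Let Om_z (t : R) : 0 <= t <= 1 -> Om (z t).
Proof. by move=> t01; exact: (hphi (c_disc t01)).2. Qed.

Let c_step (s t : R) : c s = c t + ((s - t)%:C)%C * zeta.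
Proof.
rewrite /c -mulrDl -rmorphD /=; congr (_%:C%C * _); ring.
Qed.

Let cabs_step (s t : R) : cabs (((s - t)%:C)%C * zeta) = m * `|s - t|.
Proof. by rewrite cabsM cabs_real mulrC. Qed.

Let step_small (s t e : R) : `|s - t| < e -> cabs (((s - t)%:C)%C * zeta) < e.
Proof.
move=> st; rewrite cabs_step; apply: le_lt_trans st.
by rewrite ler_piMl // ltW //; have /andP[] := m01.
Qed.

Let path_lipschitz (t e : R) : 0 <= t <= 1 -> 0 < e -> exists2 b : R, 0 < b &
  forall s : R, `|s - t| < b ->
    enorm (z s - z t) <= (speed_at t * m + e) * `|s - t|.
Proof.
move=> t01 e0; have [dphi _] := hphi (c_disc t01).
have [b b0 hb] := disc_local_lipschitz dphi e0.
exists b => // s st; have := hb _ (step_small st).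
rewrite -c_step => /le_trans; apply.
by rewrite cabs_step mulrA ler_wpM2r // mulrDl lerD2l ler_piMr ?ltW.
Qed.

Let in_U (t : R) : 0 <= t <= 1 -> enorm (z t - x) < d -> U (z t).
Proof.
move=> t01 zx; have Oz := Om_z t01.
have [/andP[r0 r1] hr] := rho_loc Oz zx.
have r11 : 0 < (1 : R) <= 1 by rewrite ltr01 lexx.
have := hr _ (hol_disc_recenter hphi (c_disc t01) r11); rewrite /= recenter0.
by move=> /(_ erefl 0); rewrite cabs0 recenter0; apply.
Qed.

Let growth_lipschitz (t e : R) : 0 <= t <= 1 -> enorm (z t - x) < d -> 0 < e ->
  exists2 b : R, 0 < b &
  forall s : R, `|s - t| < b -> `|gu s - gu t| <= (growth_at t * m + e) * `|s - t|.
Proof.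
move=> t01 zx e0; have Oz := Om_z t01; have Uz := in_U t01 zx.
have [dphi _] := hphi (c_disc t01).
have [dh hp] := h_holo Oz Uz.
have [dGu dG0] := dGP hp.
have [e1 e10 he1] := mul_add_small dG0 (cabs_ge0 ('D_1 (h \o phi) (c t))) e0.
have [b1 b10 hb1] := is_derive_incr_le dGu dG0 e10.
have [b2 b20 hb2] := holo_local_lipschitz (differentiable_comp dphi dh) e10.
set Y := cabs _ in he1 hb2; set X := dG _ in he1 hb1.
have Y0 : 0 <= Y by exact: cabs_ge0.
exists (Num.min b2 (b1 / (Y + e1))).
  by rewrite lt_min b20 divr_gt0 // ltr_wpDl.
move=> s; rewrite lt_min => /andP[st1 st2].
have := hb2 _ (step_small st1); rewrite -c_step cabs_step /=.
set v := _ - _ => hv.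
have /andP[m0 m1] := m01.
have hv' : `|v| <= (Y + e1) * `|s - t|.
  apply: le_trans hv _; rewrite ler_wpM2l ?addr_ge0 ?(ltW e10) //.
  by rewrite ler_piMl // ltW.
have vb : `|v| < b1.
  apply: le_lt_trans hv' _; rewrite mulrC -ltr_pdivlMr // ltr_wpDl //.
have := hb1 v vb; rewrite /v [_ + (_ - _)]addrC subrK => /le_trans; apply.
rewrite -/v; apply: le_trans (ler_wpM2l (addr_ge0 dG0 (ltW e10)) hv) _.
rewrite !mulrA ler_wpM2r // /growth_at -/X -/Y.
apply: le_trans (ler_wpM2r m0 he1) _.
by rewrite mulrDl lerD2l ler_piMr ?ltW.
Qed.

Section Epsilon.
Variable e : R.
Hypotheses (e0 : 0 < e) (e12 : e <= 2^-1) (Wse : kap * W s1 + e < d).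

(* The slack [e * t] makes the two inequalities extend to the right of [t]. *)
Let P (t : R) := enorm (z t - x) <= kap * W (a t) + e * t /\
  gu t <= G (Re (h x)) + K * (tau0 + p t) + e * t.

Let a_gt0 (t : R) : 0 < a t.
Proof. by rewrite mulr_gt0 ?mulr_gt0 ?expR_gt0. Qed.

Let p_mono (s t : R) : 0 <= s -> s <= t -> t <= 1 -> p s <= p t.
Proof. by move=> *; apply: pdist_radial_mono. Qed.

Let a_mono (s t : R) : 0 <= s -> s <= t -> t <= 1 -> a s <= a t.
Proof.
move=> s0' st t1; rewrite ler_wpM2l ?mulr_ge0 ?(ltW A_gt0) //.
by rewrite ler_expR ler_wpM2l ?(ltW K_gt0) // lerD2l p_mono.
Qed.

Let Wa_mono (s t : R) : 0 <= s -> s <= t -> t <= 1 ->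
  kap * W (a s) <= kap * W (a t).
Proof.
move=> s0' st t1; rewrite ler_wpM2l ?(ltW kap_gt0) // W_mono ?a_gt0 ?a_mono //.
by rewrite (le_trans _ s1s0) // (le_trans _ as1) // a_mono // (le_trans s0').
Qed.

Let Wa_lt (t : R) : 0 <= t <= 1 -> kap * W (a t) + e * t < d.
Proof.
move=> /andP[t0 t1]; apply: le_lt_trans Wse; apply: lerD.
  apply: le_trans (Wa_mono t0 t1 (lexx 1)) _.
  rewrite ler_wpM2l ?(ltW kap_gt0) // W_mono ?a_gt0 //.
by rewrite ler_piMr // ltW.
Qed.

Let P_near (t : R) : 0 <= t <= 1 -> enorm (z t - x) <= kap * W (a t) + e * t ->
  enorm (z t - x) < d.
Proof. by move=> t01 /le_lt_trans; apply; exact: Wa_lt. Qed.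

(** The derivative of [p]: the Poincare speed of the path [c]. *)
Let q (t : R) := m / (1 - t ^+ 2 * m ^+ 2).

Let tm_lt1 (t : R) : 0 <= t <= 1 -> 0 < 1 - t ^+ 2 * m ^+ 2.
Proof.
move=> t01; rewrite -exprMn subr_gt0 -cabs_c; last by case/andP: t01.
by rewrite expr_lt1 ?cabs_ge0 // c_disc.
Qed.

Let speed_q (t : R) : 0 <= t <= 1 ->
  speed_at t * m <= kap * w (bdist Om (z t)) * (K * q t).
Proof.
move=> t01; have := speed hphi (c_disc t01).
have /andP[t0 _] := t01; have /andP[m0 _] := m01.
rewrite cabs_c // exprMn -/(speed_at t) -/(z t) => hs.
have k0 := tm_lt1 t01.
have -> : kap * w (bdist Om (z t)) * (K * q t)
    = w (bdist Om (z t)) / c0 / (1 - t ^+ 2 * m ^+ 2) * m.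
  rewrite /kap /q; field.
  by rewrite exprMn (gt_eqF k0) (gt_eqF c0_gt0) (gt_eqF K_gt0).
rewrite ler_wpM2r // ler_pdivlMr // ler_pdivlMr //.
by rewrite mulrC [X in _ * X]mulrC.
Qed.

Let growth_q (t : R) : 0 <= t <= 1 -> enorm (z t - x) < d ->
  growth_at t * m <= K * q t.
Proof.
move=> t01 zx; have Oz := Om_z t01; have Uz := in_U t01 zx.
have [r01 hr] := rho_loc Oz zx; have /andP[r0 _] := r01.
have := disc_growth h_holo hphi (c_disc t01) r01 hr.
have /andP[t0 _] := t01; have /andP[m0 _] := m01.
rewrite cabs_c // exprMn -/(z t).
have [dh hp] := h_holo Oz Uz; have [_ dG0] := dGP hp.
have k0 := tm_lt1 t01; have hG := dG_rho Oz zx.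
move=> /(ler_wpM2l dG0) /le_trans /(_ hG).
rewrite mulrCA mulrC ler_pM2r // => hg.
rewrite /q mulrA ler_pdivlMr // /growth_at.
by move: (ler_wpM2r m0 hg); congr (_ <= _); ring.
Qed.

Let exp_e_le2 : expR e <= 2.
Proof.
have ep : 0 < expR e := expR_gt0 e.
have := expR_ge1Dx (- e); rewrite expRN -[(expR e)^-1]mul1r ler_pdivlMr // => h1.
have := ler_wpM2l (ltW ep) e12; lra.
Qed.

Let bdist_le_a (t : R) : 0 <= t <= 1 -> P t -> bdist Om (z t) <= a t.
Proof.
move=> t01 [P1 P2]; have Oz := Om_z t01.
have /andP[t0 t1] := t01.
have := bdist_G Oz (P_near t01 P1) (tau := tau0 + p t + e / K).
have -> : K * (tau0 + p t + e / K) = K * (tau0 + p t) + e.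
  by field; rewrite gt_eqF.
rewrite expRD -/(gu t) => hb; apply: le_trans (hb _) _.
  apply: le_trans P2 _; rewrite addrA lerD2l ler_piMr //; exact: ltW.
have -> : a t = A * expR (K * (tau0 + p t)) * 2 by rewrite /a; ring.
rewrite mulrA.
by rewrite ler_wpM2l // mulr_ge0 ?expR_ge0 // ltW.
Qed.

Let P_open (t : R) : 0 <= t < 1 -> P t -> exists2 b : R, 0 < b &
  forall s : R, t < s < t + b -> P s.
Proof.
move=> /andP[t0 t1] Pt; have [P1 P2] := Pt.
have t01 : 0 <= t <= 1 by rewrite t0 ltW.
have zx := P_near t01 P1; have /andP[m0 m1] := m01.
have e2 : 0 < e / 2 by rewrite divr_gt0.
have [b1 b10 hb1] := path_lipschitz t01 e2.
have [b2 b20 hb2] := growth_lipschitz t01 zx e2.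
have q0 : 0 <= q t by rewrite divr_ge0 // ltW // tm_lt1.
have del0 := bdist_gt0 (Om_z t01).
pose v := kap * w (bdist Om (z t)).
have v0 : 0 < v by rewrite mulr_gt0 // w_gt0.
(* Collects the coefficients of [k ^+ 2] in the errors of a step of length [k], which are then kept
   below [e / 2 * k]; the other [e / 2] pays for the local Lipschitz bounds. *)
pose C := v * (K + (K * q t) ^+ 2) + K.
have C0 : 0 < C by rewrite addr_gt0 // mulr_gt0 // ltr_wpDr // sqr_ge0.
exists (Num.min (Num.min b1 b2) (Num.min (1 - t) (e / 2 / C))).
  by rewrite !lt_min b10 b20 subr_gt0 t1 divr_gt0.
move=> s /andP[ts]; rewrite -ltrBlDl !lt_min => /andP[/andP[sb1 sb2] /andP[st1 sC]].
pose k := s - t; rewrite -/k in sb1 sb2 st1 sC.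
have k0 : 0 < k by rewrite subr_gt0.
have sE : s = t + k by rewrite /k addrC subrK.
have s1' : s <= 1 by rewrite sE; lra.
have nk : `|s - t| = k by rewrite gtr0_norm.
rewrite ltr_pdivlMr // in sC.
have hp := @pdist_radial_incr R m t k m01 t0 k0 ltac:(lra).
rewrite -sE -/p -/(q t) in hp.
have kC : k * (k * C) <= k * (e / 2) by rewrite ler_pM2l // ltW.
have pst : 0 <= p s - p t by rewrite subr_ge0 p_mono // ltW.
split.
  (* For the exponential [a], the relative increment of [W_incr] depends on the elapsed Poincare
     time only. *)
  have aE : (a s - a t) / a s = 1 - expR (- (K * (p s - p t))).
    have as0 : a s != 0 by rewrite gt_eqF // a_gt0.
    rewrite mulrBl divff //; congr (_ - _); apply: (mulIf as0).
    rewrite mulfVK // /a mulrCA -expRD; congr (_ * expR _); ring.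
  have hexp : K * k * q t - K * k ^+ 2 - (K * k * q t) ^+ 2
      <= 1 - expR (- (K * (p s - p t))).
    pose y := K * (k * q t - k ^+ 2).
    have yp : y <= K * (p s - p t) by rewrite ler_pM2l.
    have yE : y = K * k * q t - K * k ^+ 2 by rewrite /y; ring.
    have Kk : 0 <= K * k ^+ 2 by rewrite mulr_ge0 ?sqr_ge0 // ltW.
    (* The term [- k ^+ 2] can make [y] negative; the left-hand side is then negative and the
       right-hand side nonnegative. *)
    rewrite -yE; have [y0|y0] := leP 0 y.
      have y1 := one_sub_expRN_ge y0.
      have y2 : expR (- (K * (p s - p t))) <= expR (- y) by rewrite ler_expR lerN2.
      have y3 : y ^+ 2 <= (K * k * q t) ^+ 2.
        by rewrite ler_pXn2r ?nnegrE //; lra.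
      lra.
    have : expR (- (K * (p s - p t))) <= 1.
      by rewrite expR_le1 oppr_le0 mulr_ge0 // ltW.
    have := sqr_ge0 (K * k * q t); lra.
  have hW := W_incr del0 (bdist_le_a t01 Pt) (a_mono t0 (ltW ts) s1')
     (le_trans (a_mono (le_trans t0 (ltW ts)) s1' (lexx 1)) (le_trans as1 s1s0)).
  rewrite aE in hW.
  have hW2 : v * (K * k * q t - K * k ^+ 2 - (K * k * q t) ^+ 2)
      <= kap * W (a s) - kap * W (a t).
    rewrite -mulrBr /v -mulrA ler_pM2l //; apply: le_trans hW.
    by rewrite ler_pM2l // w_gt0.
  have hz := hb1 s; rewrite nk in hz.
  have {}hz := hz sb1; rewrite -/(speed_at t) in hz.
  have hsp := ler_wpM2r (ltW k0) (speed_q t01); rewrite -/v in hsp.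
  have := ler_enorm_dist (z s) (z t) x.
  have Kk : 0 <= K * k ^+ 2 by rewrite mulr_ge0 ?sqr_ge0 // ltW.
  have kC' : v * (K * k ^+ 2 + (K * k * q t) ^+ 2) <= e / 2 * k.
    apply: le_trans _ (_ : k * (k * C) <= _); last by rewrite [leRHS]mulrC.
    by rewrite /C mulrDr mulrDr; move: Kk; nra.
  rewrite sE mulrDr -/k -sE; rewrite mulrDl in hz; nra.
have hg := hb2 s; rewrite nk in hg.
have {}hg := hg sb2; rewrite ler_norml in hg; have /andP[_ {}hg] := hg.
have hgq := ler_wpM2r (ltW k0) (growth_q t01 zx).
have hKp := ler_wpM2l (ltW K_gt0) hp.
have X0 : 0 <= K + (K * q t) ^+ 2 := addr_ge0 (ltW K_gt0) (sqr_ge0 _).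
have vv : 0 <= k * (k * (v * (K + (K * q t) ^+ 2))) :=
  mulr_ge0 (ltW k0) (mulr_ge0 (ltW k0) (mulr_ge0 (ltW v0) X0)).
have kK : K * k ^+ 2 <= e / 2 * k by move: vv kC; rewrite /C; lra.
have -> : e * s = e * t + e * k by rewrite sE; ring.
lra.
Qed.

Let P_closed (t : R) : 0 < t <= 1 -> (forall s : R, 0 <= s < t -> P s) -> P t.
Proof.
move=> /andP[t0 t1] Pt.
have t01 : 0 <= t <= 1 by rewrite ltW.
(* Passage to the limit from the left: a step back of length [r] changes [f] by at most [L * r]. By
   monotonicity the bounds at earlier parameters are below the bound [B] at [t]. *)
have key (f : R -> R) (B L b : R) : 0 < b -> 0 <= L ->
    (forall s : R, `|s - t| < b -> f t <= f s + L * `|s - t|) ->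
    (forall s : R, 0 <= s < t -> f s <= B) -> f t <= B.
  move=> b0 L0 hf hB; apply/ler_addgt0Pl => y y0.
  pose r := Num.min (Num.min (t / 2) (b / 2)) (y / (L + 1)).
  have L1 : 0 < L + 1 by rewrite ltr_wpDl.
  have r0 : 0 < r by rewrite !lt_min !divr_gt0.
  have rt : r <= t / 2 by rewrite !ge_min lexx.
  have rb : r <= b / 2 by rewrite !ge_min lexx orbT.
  have ry : r * (L + 1) <= y by rewrite -ler_pdivlMr // !ge_min lexx !orbT.
  have nr : `|t - r - t| = r by rewrite addrAC subrr sub0r normrN gtr0_norm.
  have := hf (t - r); rewrite nr => h1.
  have h2 : f (t - r) <= B by apply: hB; lra.
  have := h1 ltac:(lra); nra.
have P1 : enorm (z t - x) <= kap * W (a t) + e * t.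
  have [b b0 hb] := path_lipschitz t01 ltr01.
  have /andP[m0 _] := m01.
  apply: (key (fun s => enorm (z s - x)) _ (speed_at t * m + 1) b) => //.
  - by rewrite addr_ge0 // mulr_ge0 // enorm_ge0.
  - move=> s st; have := ler_enorm_dist (z t) (z s) x.
    have := hb s st; rewrite enormBC; lra.
  - move=> s /andP[s0' st]; have [|h1 _] := Pt s; first by rewrite s0'.
    apply: le_trans h1 _; apply: lerD; first by apply: Wa_mono => //; exact: ltW.
    by rewrite ler_wpM2l ?ltW.
split => //; have zx := P_near t01 P1.
have [b b0 hb] := growth_lipschitz t01 zx ltr01.
apply: (key gu _ (growth_at t * m + 1) b) => //.
- have [_ hp] := h_holo (Om_z t01) (in_U t01 zx); have [_ dG0] := dGP hp.
  have /andP[m0 _] := m01.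
  by rewrite addr_ge0 // mulr_ge0 // mulr_ge0 // cabs_ge0.
- move=> s st; have := hb s st; rewrite ler_norml => /andP[h1 _]; lra.
- move=> s /andP[s0' st]; have [|_ h1] := Pt s; first by rewrite s0'.
  apply: le_trans h1 _; apply: lerD; last by rewrite ler_wpM2l ?ltW.
  by rewrite lerD2l ler_wpM2l ?(ltW K_gt0) // lerD2l p_mono ?(ltW st).
Qed.

(** The two halves of [P] feed each other: a displacement below [d] keeps the point in the chart,
    which bounds the growth; the growth bounds [bdist] by [a], which bounds the speed and with it
    the displacement. *)
Lemma propagation_eps :
  enorm (phi 0 - x) <= kap * W (2 * A * expR (K * tau0)) ->
  G (Re (h (phi 0))) <= G (Re (h x)) + K * tau0 ->
  enorm (phi zeta - x) <= kap * W (2 * A * expR (K * (tau0 + pdist0 zeta))) + e /\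
  G (Re (h (phi zeta))) <= G (Re (h x)) + K * (tau0 + pdist0 zeta) + e.
Proof.
move=> h1 h2.
have c00 : c 0 = 0 by rewrite /c mul0r.
have c11 : c 1 = zeta by rewrite /c mul1r.
have := @real_induction _ P _ P_open P_closed.
rewrite /P /gu /a /z /p c00 c11 pdist_radial1 mulr1; apply.
by rewrite pdist_radial0 mulr0 !addr0.
Qed.

End Epsilon.

(** The conclusion is the hypothesis with [tau0] advanced by [pdist0 zeta], so consecutive discs
    concatenate without loss, however many there are. It is the limit of [propagation_eps] as the
    slack tends to 0. *)
Lemma propagation :
  enorm (phi 0 - x) <= kap * W (2 * A * expR (K * tau0)) ->
  G (Re (h (phi 0))) <= G (Re (h x)) + K * tau0 ->
  enorm (phi zeta - x) <= kap * W (2 * A * expR (K * (tau0 + pdist0 zeta))) /\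
  G (Re (h (phi zeta))) <= G (Re (h x)) + K * (tau0 + pdist0 zeta).
Proof.
move=> h1 h2; pose r := Num.min 2^-1 ((d - kap * W s1) / 2).
have r0 : 0 < r by rewrite lt_min invr_gt0 ltr0n divr_gt0 // subr_gt0.
have small (e : R) : 0 < e -> exists2 e' : R, 0 < e' <= e &
    e' <= 2^-1 /\ kap * W s1 + e' < d.
  move=> e0; exists (Num.min e r); first by rewrite lt_min e0 r0 ge_min lexx.
  have e1 : Num.min e r <= 2^-1 by rewrite !ge_min lexx orbT.
  have e2 : Num.min e r <= (d - kap * W s1) / 2 by rewrite !ge_min lexx !orbT.
  by split => //; move: e2 Ws1; lra.
split; apply/ler_addgt0Pl => e /small[e' /andP[e0 ee] [e1 e2]];
  have [u1 u2] := propagation_eps e0 e1 e2 h1 h2.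
  by apply: le_trans u1 _; rewrite addrC lerD2r.
by apply: le_trans u2 _; rewrite [leLHS]addrC lerD2r.
Qed.

End Disc.

End Propagation.

(** * Primitive of the Goldilocks modulus *)

Section GoldilocksPrimitive.
Context {R : realType}.
Variable w : R -> R.
Hypothesis w_gt0 : forall t : R, 0 < t -> 0 < w t.
Hypothesis w_div : forall s t : R, 0 < s -> s <= t -> w t / t <= w s / s.
Hypothesis w_ln : forall s t : R, 0 < s -> s <= t ->
  w s * ln (w s / s) <= w t * ln (w t / t).
Hypothesis w_int : forall eps : R, 0 < eps ->
  (\int[@lebesgue_measure R]_(x in Ioc0 eps)
     ((w x / x) * ln (w x / x))%R%:E < +oo)%E.

(* Once [w s0 / s0 > 1], [w * ln (w / id)] is nondecreasing while [ln (w / id)] is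
   nonincreasing and positive on [(0, s0]]; if there is no such [s0], then
   [w <= id]. *)
Lemma goldilocks_bounded (M : R) :
  exists2 B : R, 0 < B & forall t : R, 0 < t -> t <= M -> w t <= B.
Proof.
have [[s0 s00 ws0]|small] := pselect (exists2 s : R, 0 < s & 1 < w s / s).
  exists (Num.max (w s0) (`|M| * (w s0 / s0))).
    by rewrite lt_max w_gt0.
  move=> t t0 tM; rewrite le_max; have [ts|st] := leP t s0; apply/orP.
    left; have d1 := w_div t0 ts; have l1 := w_ln t0 ts.
    have l0 : 0 < ln (w s0 / s0) by apply: ln_gt0.
    rewrite -(ler_pM2r l0); apply: le_trans l1.
    by rewrite ler_pM2l ?w_gt0 // ler_ln ?posrE ?divr_gt0 ?w_gt0.
  right; have := w_div s00 (ltW st).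
  rewrite ler_pdivrMr // => /le_trans; apply; rewrite mulrC ler_wpM2r //.
    by rewrite divr_ge0 // ltW // w_gt0.
  by rewrite (le_trans tM) // ler_norm.
exists (`|M| + 1); first by rewrite ltr_wpDl.
move=> t t0 tM; have : w t / t <= 1.
  by rewrite leNgt; apply/negP => h; apply: small; exists t.
rewrite ler_pdivrMr // mul1r => /le_trans; apply.
by rewrite (le_trans tM) // (le_trans (ler_norm _)) // lerDl.
Qed.

(** Monotonicity is given on the positive half-line only; composed with [expR] it holds on the whole
    line, and [ln] brings measurability back. *)
Let measurable_w_div : measurable_fun (`]0, +oo[ : set R) (fun x => w x / x).
Proof.
have mg : measurable_fun [set: R] (fun u : R => w (expR u) / expR u).
  apply: nonincreasing_measurable => // u v uv.
  by apply: w_div; rewrite ?expR_gt0 // ler_expR.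
have mc : measurable_fun (`]0, +oo[ : set R)
    ((fun u : R => w (expR u) / expR u) \o @ln R).
  by apply: (measurableT_comp mg); apply: measurable_funTS; exact: measurable_ln.
apply: eq_measurable_fun mc => x; rewrite inE /= in_itv /= andbT => x0.
by rewrite lnK.
Qed.

(** On []0, s0]] the logarithm is at least [l0 > 0], so for [s <= x] the monotonicity of
    [w * ln (w / id)] gives [l0 * (w s / x) <= f x]. Integrating over []a, b]], where
    [x^-1 >= b^-1], bounds the increment for every [s <= a] at once. If [w <= id], the identity
    serves as [W]. *)
Lemma goldilocks_primitive : exists (s0 : R) (W : R -> R),
  [/\ 0 < s0,
      forall s a b : R, 0 < s -> s <= a -> a <= b -> b <= s0 ->
        w s * ((b - a) / b) <= W b - W a,
      forall s : R, 0 < s -> s <= s0 -> 0 <= W s &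
      forall e : R, 0 < e -> exists2 s1 : R, 0 < s1 <= s0 & W s1 <= e].
Proof.
have [[s0 s00 ws0]|small] := pselect (exists2 s : R, 0 < s & 1 < w s / s);
  last first.
  have wle (t : R) : 0 < t -> w t <= t.
    move=> t0; have : w t / t <= 1.
      by rewrite leNgt; apply/negP => h; apply: small; exists t.
    by rewrite ler_pdivrMr // mul1r.
  exists 1, id; split => //.
  - move=> s a b s0 sa ab b1 /=; have b0 : 0 < b by lra.
    rewrite mulrA ler_pdivrMr // mulrC ler_wpM2l ?subr_ge0 //.
    by have := wle s s0; lra.
  - by move=> s s0' _; exact: ltW.
  - move=> e e0; exists (Num.min 1 e); last by rewrite ge_min lexx orbT.
    by rewrite lt_min ltr01 e0 ge_min lexx.
pose mu := @lebesgue_measure R.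
pose l0 := ln (w s0 / s0).
have l00 : 0 < l0 by apply: ln_gt0.
pose f (x : R) := (w x / x) * ln (w x / x).
have f_ge (s x : R) : 0 < s -> s <= x -> x <= s0 -> l0 * (w s / x) <= f x.
  move=> sp sx xs; have x0 : 0 < x by lra.
  rewrite /f mulrA ler_pdivrMr // mulrAC mulfVK ?gt_eqF //.
  have ss0 : s <= s0 by lra.
  apply: le_trans (w_ln sp sx); rewrite mulrC ler_pM2l ?w_gt0 //.
  by rewrite ler_ln ?posrE ?divr_gt0 ?w_gt0 // w_div.
have f_ge0 (x : R) : 0 < x -> x <= s0 -> 0 <= f x.
  move=> x0 xs; apply: le_trans (f_ge x x x0 (lexx x) xs).
  by rewrite mulr_ge0 ?divr_ge0 ?ltW // w_gt0.
have mf (s : R) : measurable_fun (`]0, s] : set R) f.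
  have m1 : measurable_fun (`]0, s] : set R) (fun x => w x / x).
    apply: measurable_funS measurable_w_div => //.
    by move=> x; rewrite /= !in_itv /= andbT => /andP[].
  apply: measurable_funM => //.
  exact (measurableT_comp (@measurable_ln R) m1).
have itvE : Ioc0 s0 = (`]0, s0] : set R).
  by apply/seteqP; split => x; rewrite /Ioc0 /= in_itv /= => ?.
have intf : mu.-integrable `]0, s0] (EFin \o f).
  apply/integrableP; split; first by apply/measurable_EFinP; exact: mf.
  apply: le_lt_trans (w_int s00); rewrite itvE.
  rewrite le_eqVlt; apply/orP; left; apply/eqP.
  apply: eq_integral => x; rewrite inE /= in_itv /= => /andP[x0 xs].
  by rewrite ger0_norm // f_ge0.
pose V (s : R) := (\int[mu]_(x in `]0, s]) f x)%R / l0.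
have intb (b : R) : b <= s0 -> mu.-integrable `]0, b] (EFin \o f).
  move=> bs; apply: integrableS intf => //.
  by apply: subset_itvl; rewrite bnd_simp.
have V_incr (s a b : R) : 0 < s -> s <= a -> a <= b -> b <= s0 ->
    w s * ((b - a) / b) <= V b - V a.
  move=> sp sa ab bs; have b0 : 0 < b by lra.
  rewrite /V -mulrBl ler_pdivlMr // /Rintegral.
  have := @Rintegral_itvB R f (BRight 0) (BRight b) a (intb b bs).
  rewrite !bnd_simp => /(_ (ltac:(lra)) ab) ->.
  have mab : fine (mu `]a, b]) = b - a.
    rewrite /mu lebesgue_measure_itv /= lte_fin; case: ltgtP ab => // ->.
    by rewrite subrr.
  apply: le_trans (_ : (\int[mu]_(x in `]a, b]) (l0 * (w s / b)))%R <= _).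
    by rewrite Rintegral_cst // mab le_eqVlt; apply/orP; left; apply/eqP; ring.
  apply: le_Rintegral => //.
  - apply: (@integrableS _ _ _ mu `[a, b]) => //.
      by apply: subset_itvr; rewrite bnd_simp.
    by apply: continuous_on_itv_integrable => x _; exact: cvg_cst.
  - apply: integrableS (intb b bs) => //.
    by apply: subset_itvr; rewrite bnd_simp; lra.
  - move=> x; rewrite /= in_itv /= => /andP[ax xb].
    apply: le_trans (f_ge s x sp _ _); [|lra|lra].
    rewrite ler_pM2l // ler_pM2l ?w_gt0 // lef_pV2 ?posrE; lra.
have V_ge0 (s : R) : 0 < s -> s <= s0 -> 0 <= V s.
  move=> sp ss; rewrite divr_ge0 ?(ltW l00) //; apply: Rintegral_ge0 => x.
  by rewrite /= in_itv /= => /andP[x0 xs]; apply: f_ge0 => //; lra.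
(* Subtracting the infimum gives nonnegative, arbitrarily small values with the same increments,
   without computing the limit of the integral at 0. *)
pose S := [set V s | s in [set s : R | 0 < s <= s0]].
have S0 : S !=set0 by exists (V s0); exists s0; rewrite //= s00 lexx.
have lbS : has_lbound S by exists 0 => _ [s /andP[sp ss] <-]; exact: V_ge0.
exists s0, (fun s => V s - inf S); split => //.
- move=> s a b sp sa ab bs; apply: le_trans (V_incr s a b sp sa ab bs) _.
  by rewrite opprB addrA subrK.
- move=> s sp ss; rewrite subr_ge0; apply: ge_inf => //.
  by exists s; rewrite //= sp.
- move=> e e0; have [_ [s1 hs1 <-] h] := inf_adherent e0 (conj S0 lbS).
  by exists s1 => //; rewrite lerBlDl ltW.
Qed.

End GoldilocksPrimitive.

(** * Supporting half-planes in a convexifying chart *)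

Section BoundaryDistance.
Context {R : realType} {n : nat}.
Variable Om : set (Cn R n).
Hypothesis Om_open : open Om.
Implicit Types x y z b : Cn R n.

Lemma openCnP x : Om x -> exists2 r : R, 0 < r & forall y, enorm (y - x) < r -> Om y.
Proof. by move=> Ox; apply/nbhs_CnP; exact: open_nbhs_nbhs. Qed.

(** The exit point at the infimum [T] of the parameters outside [Om]: openness keeps it out of [Om],
    and the earlier points put it in the closure. *)
Lemma segment_boundary x y : Om x -> ~ Om y ->
  exists2 b, boundary Om b & enorm (x - b) <= enorm (x - y).
Proof.
move=> Ox Oy.
pose g (t : R) := x + rscale t (y - x).
have gB (s t : R) : g s - g t = rscale (s - t) (y - x).
  by rewrite /g opprD addrACA subrr add0r /rscale -scalerBl -rmorphB.
have g0 : g 0 = x by rewrite /g /rscale scale0r addr0.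
have g1 : g 1 = y by rewrite /g /rscale scale1r addrC subrK.
pose S := [set t : R | 0 <= t <= 1 /\ ~ Om (g t)].
have S1 : S 1 by rewrite /S /= ler01 lexx g1.
have lbS : has_lbound S by exists 0 => t [/andP[]].
pose T := inf S.
have T0 : 0 <= T by apply: lb_le_inf; [exists 1|move=> t [/andP[]]].
have T1 : T <= 1 by apply: ge_inf.
have below (t : R) : 0 <= t < T -> Om (g t).
  move=> /andP[t0 tT]; apply: contrapT => nt.
  have : T <= t by apply: (ge_inf lbS); split; [rewrite t0 (le_trans (ltW tT) T1)|].
  by rewrite leNgt tT.
have v0 : 0 <= enorm (y - x) by exact: enorm_ge0.
have nOT : ~ Om (g T).
  move=> /openCnP[r r0 hr].
  have e0 : 0 < r / (enorm (y - x) + 1) by rewrite divr_gt0 // ltr_wpDl.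
  have [t St tT] := inf_adherent e0 (conj (ex_intro _ _ S1) lbS).
  have Tt : T <= t by apply: ge_inf.
  case: St => _; apply; apply: hr; rewrite gB enorm_rscale ger0_norm ?subr_ge0 //.
  have : t - T < r / (enorm (y - x) + 1) by rewrite ltrBlDl.
  rewrite ltr_pdivlMr ?ltr_wpDl //; nra.
have Tp : 0 < T.
  by rewrite lt_def T0 andbT; apply/eqP => T00; apply: nOT; rewrite T00 g0.
exists (g T).
  split => // B /nbhs_CnP[r r0 hr].
  pose e := Num.min (T / 2) (r / 2 / (enorm (y - x) + 1)).
  have e0 : 0 < e by rewrite lt_min !divr_gt0 // ltr_wpDl.
  have eT : e <= T / 2 by rewrite ge_min lexx.
  have er : e * (enorm (y - x) + 1) <= r / 2.
    by rewrite -ler_pdivlMr ?ltr_wpDl // ge_min lexx orbT.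
  exists (g (T - e)); split; first by apply: below; lra.
  apply: hr; rewrite gB enorm_rscale addrAC subrr sub0r normrN gtr0_norm //; nra.
have := gB 0 T; rewrite g0 => ->; rewrite enorm_rscale sub0r normrN ger0_norm //.
by rewrite [enorm (x - y)]enormBC ler_piMl.
Qed.

Lemma bdist_le x b : boundary Om b -> bdist Om x <= enorm (x - b).
Proof.
move=> bb; apply: ge_inf; last by exists b.
by exists 0 => _ [c _ <-]; exact: enorm_ge0.
Qed.

Hypothesis boundary_neq0 : boundary Om !=set0.

Let dist_set x : has_inf [set enorm (x - y) | y in boundary Om].
Proof.
split; first by have [b bb] := boundary_neq0; exists (enorm (x - b)); exists b.
by exists 0 => _ [c _ <-]; exact: enorm_ge0.
Qed.

Lemma bdist_approx x (e : R) : 0 < e ->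
  exists2 b, boundary Om b & enorm (x - b) < bdist Om x + e.
Proof.
by move=> e0; have [_ [b bb <-] h] := inf_adherent e0 (dist_set x); exists b.
Qed.

Lemma bdist_gt0 x : Om x -> 0 < bdist Om x.
Proof.
move=> Ox; have [r r0 hr] := openCnP Ox; apply: lt_le_trans r0 _.
apply: lb_le_inf; first exact: (dist_set x).1.
move=> _ [b [_ nOb] <-]; rewrite leNgt; apply/negP => h.
by apply: nOb; apply: hr; rewrite enormBC.
Qed.

Lemma bdist_ball x y : Om x -> enorm (y - x) < bdist Om x -> Om y.
Proof.
move=> Ox h; apply: contrapT => nO; have [b bb hb] := segment_boundary Ox nO.
have := bdist_le x bb; rewrite enormBC in h => h1.
by have := lt_le_trans h (le_trans h1 hb); rewrite ltxx.
Qed.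

Lemma bdist_lipschitz x y : bdist Om x <= bdist Om y + enorm (x - y).
Proof.
apply/ler_addgt0Pl => e e0; have [b bb hb] := bdist_approx y e0.
have := bdist_le x bb; have := ler_enorm_dist x y b; lra.
Qed.

End BoundaryDistance.

(** * Lipschitz bounds from the Schwarz lemma *)

Section LipschitzHolo.
Context {R : realType}.

(** The distance [D] is abstract so as to serve both [cabs] of a scalar function and [enorm] of a
    path in [Cn R n]. *)
Lemma mean_value_dist (D : R -> R -> R) (B : R) :
  (forall s : R, D s s = 0) -> (forall s t : R, D s t = D t s) ->
  (forall s t u : R, D s u <= D s t + D t u) ->
  (forall t : R, 0 <= t <= 1 -> forall e : R, 0 < e -> exists2 d : R, 0 < d &
     forall s : R, `|s - t| < d -> D s t <= (B + e) * `|s - t|) ->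
  D 1 0 <= B.
Proof.
move=> D0 Dsym Dtri hD; apply/ler_addgt0Pl => e e0; rewrite [leRHS]addrC.
have ind := @real_induction _ (fun t : R => D t 0 <= (B + e) * t).
rewrite -[leRHS]mulr1; apply: ind.
- by rewrite D0 mulr0.
- move=> t /andP[t0 t1] h; have [|d d0 hd] := hD t _ e e0; first by rewrite t0 ltW.
  exists d => // s /andP[ts st].
  have st0 : 0 < s - t by rewrite subr_gt0.
  have := hd s; rewrite gtr0_norm // ltrBlDl => /(_ st) h1.
  have := Dtri s t 0.
  have -> : (B + e) * s = (B + e) * t + (B + e) * (s - t) by ring.
  lra.
- move=> t /andP[t0 t1] h; have [|d d0 hd] := hD t _ e e0; first by rewrite ltW.
  pose r := Num.min (t / 2) (d / 2).
  have r0 : 0 < r by rewrite lt_min !divr_gt0.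
  have rt : r <= t / 2 by rewrite ge_min lexx.
  have rd : r <= d / 2 by rewrite ge_min lexx orbT.
  have nr : `|t - r - t| = r by rewrite addrAC subrr sub0r normrN gtr0_norm.
  have := hd (t - r); rewrite nr => /(_ ltac:(lra)) h1.
  have := h (t - r) ltac:(lra) => h2.
  have := Dtri t (t - r) 0; rewrite (Dsym t (t - r)).
  have -> : (B + e) * t = (B + e) * (t - r) + (B + e) * r by ring.
  lra.
Qed.

(** A Cauchy estimate along the segment: around each of its points the complex line in direction [v]
    carries a disc of radius [r / 2] inside the ball, where [bounded_schwarz] gives [4 * (M + 1)]
    per length [r / 2]. *)
Lemma holo_lipschitz_ball (n : nat) (f : Cn R n -> CC R) (p : Cn R n) (r M : R) :
  0 < r -> (forall z, enorm (z - p) < r -> differentiable f z /\ cabs (f z) <= M) ->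
  forall z z', enorm (z - p) < r / 4 -> enorm (z' - p) < r / 4 ->
  cabs (f z' - f z) <= 8 * (M + 1) / r * enorm (z' - z).
Proof.
move=> r0 hf z z' zp zp'; set v := z' - z.
have M0 : 0 <= M.
  have [|_] := hf p; first by rewrite subrr enorm0.
  exact: le_trans (cabs_ge0 _).
have [v0|v0] := eqVneq (enorm v) 0.
  have := enorm_eq0 v0; rewrite /v => /eqP; rewrite subr_eq0 => /eqP ->.
  by rewrite !subrr cabs0 enorm0 mulr0.
have vp : 0 < enorm v by rewrite lt_def v0 enorm_ge0.
pose k := r / 2 / enorm v.
have k0 : 0 < k by rewrite !divr_gt0.
pose g (t : R) := z + rscale t v.
have g0 : g 0 = z by rewrite /g /rscale scale0r addr0.
have g1 : g 1 = z' by rewrite /g /rscale scale1r addrC subrK.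
have gp (t : R) : 0 <= t <= 1 -> enorm (g t - p) < r / 4.
  move=> /andP[t0 t1].
  have -> : g t - p = rscale t (z' - p) + rscale (1 - t) (z - p).
    rewrite /g /v /rscale rmorphB /= scalerBl scale1r !scalerBr.
    by apply/rowP => i; rewrite !mxE; ring.
  apply: le_lt_trans (ler_enormD _ _) _.
  rewrite !enorm_rscale !ger0_norm ?subr_ge0 //.
  move: (enorm (z' - p)) (enorm (z - p)) zp' zp => Y X hY hX.
  have a1 : 0 <= (1 - t) * (r / 4 - X) by rewrite mulr_ge0 ?subr_ge0 // ltW.
  have [tp|tn] := ltP 0 t.
    have a2 : 0 < t * (r / 4 - Y) by rewrite mulr_gt0 ?subr_gt0.
    lra.
  have -> : t = 0 by lra.
  lra.
have := @mean_value_dist (fun s t => cabs (f (g s) - f (g t)))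
  (8 * (M + 1) / r * enorm v).
rewrite /= g0 g1; apply.
- by move=> s; rewrite subrr cabs0.
- by move=> s t; rewrite -cabsN opprB.
- move=> s t u; have := ler_cabsD (f (g s) - f (g t)) (f (g t) - f (g u)).
  by rewrite addrA subrK.
move=> t t01 e e0.
pose s (xi : CC R) : Cn R n := g t + xi *: rscale k v.
have sp xi : disc xi -> enorm (s xi - p) < r.
  move=> xi1; rewrite /s addrAC; apply: le_lt_trans (ler_enormD _ _) _.
  rewrite enorm_scale enorm_rscale (gtr0_norm k0).
  have -> : k * enorm v = r / 2 by rewrite /k mulfVK.
  have := gp t t01; move: xi1; rewrite /disc /= => xi1; nra.
have ds xi : differentiable s xi.
  apply: differentiableD; first exact: differentiable_cst.
  apply: differentiableZl; apply/derivable1_diffP; exact: derivable_id.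
have dfs xi : disc xi -> differentiable (f \o s) xi.
  by move=> xi1; exact (differentiable_comp (ds xi) (hf _ (sp xi xi1)).1).
have D1 : cabs ('D_1 (f \o s) 0) <= 4 * (M + 1).
  by apply: bounded_schwarz => xi xi1; split; [exact: dfs|exact: (hf _ (sp xi xi1)).2].
have d0 : disc (0 : CC R) by rewrite /disc /= cabs0 ltr01.
have [d dp hd] := cdifferentiable_approx (dfs 0 d0) (mulr_gt0 e0 k0).
exists (d * k); first by rewrite mulr_gt0.
move=> t' ht'.
pose w : CC R := (((t' - t) / k)%:C)%C.
have cw : cabs w = `|t' - t| / k by rewrite cabs_real normrM [`|k^-1|]ger0_norm // invr_ge0 ltW.
have := hd w; rewrite cw ltr_pdivrMr // => /(_ ht') /=.
have -> : s (0 + w) = g t'.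
  rewrite add0r /s /w /rscale scalerA -rmorphM /= mulfVK ?gt_eqF // /g /rscale.
  by apply/rowP => i; rewrite !mxE /= rmorphB /=; ring.
have -> : s 0 = g t by rewrite /s scale0r addr0.
move=> h1; have := ler_cabsD (f (g t') - f (g t) - 'D_1 (f \o s) 0 * w) ('D_1 (f \o s) 0 * w).
rewrite subrK cabsM cw => /le_trans; apply.
have -> : (8 * (M + 1) / r * enorm v + e) * `|t' - t|
    = e * k * (`|t' - t| / k) + 4 * (M + 1) * (`|t' - t| / k).
  by rewrite /k; field; rewrite !gt_eqF.
by apply: lerD h1 _; rewrite ler_wpM2r // divr_ge0 // ltW.
Qed.

Lemma holo_locally_lipschitz (n : nat) (U : set (Cn R n)) (F : Cn R n -> Cn R n) p :
  open U -> U p -> holo_on U F -> exists (r L : R),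
  [/\ 0 < r, 0 < L, forall z, enorm (z - p) < r -> U z &
   forall z z', enorm (z - p) < r -> enorm (z' - p) < r ->
     enorm (F z' - F z) <= L * enorm (z' - z)].
Proof.
move=> oU Up dF.
have [r1 r10 h1] := openCnP oU Up.
have [r2 r20 h2] : exists2 r2 : R, 0 < r2 &
    forall z, enorm (z - p) < r2 -> enorm (F z - F p) < 1.
  have cF : {for p, continuous F} by apply: differentiable_continuous; exact: dF.
  have nB : nbhs (F p) [set w | enorm (w - F p) < 1].
    by apply/nbhs_CnP; exists 1.
  by have /nbhs_CnP[r2 r20 h2] := cF _ nB; exists r2.
pose r := Num.min r1 r2; have r0 : 0 < r by rewrite lt_min r10.
pose M := enorm (F p) + 1.
have M0 : 0 <= M by rewrite addr_ge0 // enorm_ge0.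
pose L1 := 8 * (M + 1) / r.
have L10 : 0 < L1 by rewrite !mulr_gt0 // ?invr_gt0 // ltr_wpDl.
have lip i z z' : enorm (z - p) < r / 4 -> enorm (z' - p) < r / 4 ->
    cabs (F z' 0 i - F z 0 i) <= L1 * enorm (z' - z).
  apply: (@holo_lipschitz_ball n (fun z => F z 0 i)) => // {}z.
  rewrite lt_min => /andP[z1 z2]; split.
    exact (differentiable_comp (dF z (h1 z z1)) (differentiable_coord (F z) 0 i)).
  apply: le_trans (cabs_coord_le (F z) i) _.
  rewrite -[F z](subrK (F p)); apply: le_trans (ler_enormD _ _) _.
  by rewrite addrC lerD2l ltW // h2.
exists (r / 4), (n%:R * L1 + 1); split.
- by rewrite divr_gt0.
- by rewrite ltr_wpDl // mulr_ge0 // ltW.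
- move=> z hz; apply: h1; apply: lt_le_trans hz _.
  have : r <= r1 by rewrite ge_min lexx.
  lra.
- move=> z z' hz hz'.
  have e0 := enorm_ge0 (z' - z).
  apply: le_trans (_ : n%:R * (L1 * enorm (z' - z)) <= _).
    apply: enorm_le_coord; first by rewrite mulr_ge0 // ltW.
    by move=> i; rewrite !mxE; apply: lip.
  by rewrite mulrDl mulrA mul1r lerDl.
Qed.

End LipschitzHolo.

(** * Separation by a real hyperplane and the resulting half-plane functions *)

Section Separation.
Context {R : realType} {n : nat}.
Implicit Types u v a : Cn R n.

Lemma sqr_enormD u v :
  enorm (u + v) ^+ 2 = enorm u ^+ 2 + 2 * rinner u v + enorm v ^+ 2.
Proof.
rewrite sqr_enorm rinnerDl !rinnerDr (rinnerC v u) -!sqr_enorm; ring.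
Qed.

(* [m] is an almost nearest point to [v] in [D]; boundedness of [D] absorbs the
   error in the first-order optimality condition. *)
Lemma convex_separation (D : set (Cn R n)) (v : Cn R n) (eta M : R) :
  cvx_set D -> D !=set0 -> 0 < eta ->
  (forall u, D u -> eta <= enorm (u - v)) ->
  (forall u u', D u -> D u' -> enorm (u - u') <= M) ->
  exists a, enorm a = 1 /\ forall u, D u -> 0 < rinner (u - v) a.
Proof.
move=> cD [u0 Du0] eta0 hD hM.
have M0 : 0 <= M by apply: le_trans (enorm_ge0 _) (hM u0 u0 Du0 Du0).
pose S := [set enorm (u - v) | u in D].
have S0 : S !=set0 by exists (enorm (u0 - v)); exists u0.
have lbS : has_lbound S by exists 0 => _ [u _ <-]; exact: enorm_ge0.
pose del := inf S.
have del_eta : eta <= del by apply: lb_le_inf => // _ [u Du <-]; exact: hD.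
have delP u : D u -> del <= enorm (u - v) by move=> Du; apply: ge_inf => //; exists u.
pose k := 1 + M ^+ 2.
have k0 : 0 < k by rewrite ltr_pwDl // sqr_ge0.
(* The step from [m] towards [u]. Optimality up to [e ^+ 2] gives
   [- (e * k) <= 2 * rinner (u - m) b], and [e * k <= eta ^+ 2 <= enorm b ^+ 2]. *)
pose e := Num.min 1 (eta ^+ 2 / k).
have e0 : 0 < e by rewrite lt_min ltr01 divr_gt0 // exprn_gt0.
have e1 : e <= 1 by rewrite ge_min lexx.
have ek : e * k <= eta ^+ 2 by rewrite -ler_pdivlMr // ge_min lexx orbT.
have del0 : 0 < del by apply: lt_le_trans del_eta.
(* Small enough for [(del + y) ^+ 2 <= del ^+ 2 + e ^+ 2]. *)
pose y := Num.min 1 (e ^+ 2 / (2 * del + 1)).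
have D1 : 0 < 2 * del + 1 by lra.
have y0 : 0 < y by rewrite lt_min ltr01 divr_gt0 // exprn_gt0.
have y1 : y <= 1 by rewrite ge_min lexx.
have yk : y * (2 * del + 1) <= e ^+ 2 by rewrite -ler_pdivlMr // ge_min lexx orbT.
have [_ [m Dm <-] hm] := inf_adherent y0 (conj S0 lbS).
pose b := m - v.
have bn : del <= enorm b by exact: delP.
have b2 : enorm b ^+ 2 <= del ^+ 2 + e ^+ 2.
  have : enorm b <= del + y by exact: ltW.
  have := enorm_ge0 b; nra.
have bp : 0 < enorm b by apply: lt_le_trans bn.
exists (rscale (enorm b)^-1 b); split.
  by rewrite enorm_rscale ger0_norm ?invr_ge0 ?(ltW bp) // mulVf ?gt_eqF.
move=> u Du; rewrite rinnerZr mulr_gt0 ?invr_gt0 //.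
have -> : u - v = (u - m) + b by rewrite /b addrA subrK.
rewrite rinnerDl -sqr_enorm.
have : del ^+ 2 <= enorm b ^+ 2 + 2 * e * rinner (u - m) b + e ^+ 2 * enorm (u - m) ^+ 2.
  have Dc : D (rscale e u + rscale (1 - e) m) by apply: cD => //; rewrite (ltW e0).
  have := delP _ Dc.
  have -> : rscale e u + rscale (1 - e) m - v = b + rscale e (u - m).
    by rewrite /b /rscale; apply/rowP => i; rewrite !mxE rmorphB /=; ring.
  rewrite -(@ler_pXn2r _ 2) ?nnegrE ?enorm_ge0 ?(ltW del0) //.
  rewrite (sqr_enormD b (rscale e (u - m))) rinnerZr (rinnerC b) enorm_rscale exprMn (gtr0_norm e0).
  lra.
have um : enorm (u - m) ^+ 2 <= M ^+ 2.
  by rewrite ler_pXn2r ?nnegrE ?enorm_ge0 // hM.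
have del2 : eta ^+ 2 <= del ^+ 2 by rewrite ler_pXn2r // nnegrE ltW.
have bn2 : del ^+ 2 <= enorm b ^+ 2 by rewrite ler_pXn2r // nnegrE ltW.
have e2 : 0 < e ^+ 2 by rewrite exprn_gt0.
have eM := ler_wpM2l (ltW e2) um.
move=> h.
have h2 : 0 <= e * (2 * rinner (u - m) b + e + e * M ^+ 2).
  have -> : e * (2 * rinner (u - m) b + e + e * M ^+ 2)
     = 2 * e * rinner (u - m) b + e ^+ 2 + e ^+ 2 * M ^+ 2 by ring.
  lra.
rewrite pmulr_rge0 // in h2.
have : e * k = e + e * M ^+ 2 by rewrite /k; ring.
have : 0 < eta ^+ 2 by rewrite exprn_gt0.
lra.
Qed.

End Separation.

Section Chart.
Context {R : realType} {n : nat}.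
Variable Om : set (Cn R n).
Hypothesis Om_open : open Om.

Lemma cvx_set_ball (q : Cn R n) : cvx_set [set w | enorm (w - q) < 1].
Proof.
move=> a b /= ha hb t /andP[t0 t1].
have -> : rscale t a + rscale (1 - t) b - q = rscale t (a - q) + rscale (1 - t) (b - q).
  by rewrite /rscale; apply/rowP => i; rewrite !mxE rmorphB /=; ring.
apply: le_lt_trans (ler_enormD _ _) _.
rewrite !enorm_rscale !ger0_norm ?subr_ge0 //.
move: (enorm (a - q)) (enorm (b - q)) ha hb => X Y hX hY.
have a1 : 0 <= (1 - t) * (1 - Y) by rewrite mulr_ge0 ?subr_ge0 // ltW.
have [tp|tn] := ltP 0 t.
  have a2 : 0 < t * (1 - X) by rewrite mulr_gt0 ?subr_gt0.
  lra.
have -> : t = 0 by lra.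
lra.
Qed.

(** The Hermitian pairing of [F z - v] with [a]: holomorphic where [F] is, with the separating real
    functional as real part. *)
Definition half_plane_functional (a v : Cn R n) (F : Cn R n -> Cn R n) (z : Cn R n) : CC R :=
  \sum_(i < n) (F z 0 i - v 0 i) * (Re (a 0 i) -i* Im (a 0 i))%C.

Lemma Re_half_plane_functional a v F z :
  Re (half_plane_functional a v F z) = rinner (F z - v) a.
Proof.
rewrite /half_plane_functional cRe_sum; apply: eq_bigr => i _.
by rewrite cReM !mxE cReD cImD cReN cImN /=; ring.
Qed.

Lemma differentiable_half_plane_functional a v F z :
  differentiable F z -> differentiable (half_plane_functional a v F) z.
Proof.
move=> dF; rewrite /half_plane_functional.
have -> : (fun z => \sum_(i < n) (F z 0 i - v 0 i) * (Re (a 0 i) -i* Im (a 0 i))%C)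
  = \sum_(i < n) (fun z => (F z 0 i - v 0 i) * (Re (a 0 i) -i* Im (a 0 i))%C).
  by apply/funext => y; rewrite fct_sumE.
apply: differentiable_sum => i.
have d1 : differentiable (fun z => F z 0 i) z.
  exact (differentiable_comp dF (differentiable_coord (F z) 0 i)).
apply: differentiableM; last exact: differentiable_cst.
by apply: differentiableB; [exact: d1|exact: differentiable_cst].
Qed.

(** The function [h] depends on [x], but [r] and [C] do not: they come from Lipschitz constants of
    [F] and of its inverse near [p]. *)
Lemma half_plane_chart (U V : set (Cn R n)) (F : Cn R n -> Cn R n) (p : Cn R n) :
  boundary Om p -> U p -> biholo U V F -> cvx_set (F @` (Om `&` U)) ->
  exists r C : R, [/\ 0 < r, 0 < C &
  forall x, Om x -> enorm (x - p) < r -> exists h : Cn R n -> CC R,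
    (forall z, Om z -> enorm (z - p) < r ->
       [/\ differentiable h z, 0 < Re (h z), Re (h z) <= C &
           bdist Om z <= C * Re (h z)]) /\
    Re (h x) <= C * bdist Om x].
Proof.
move=> bp Up [oU oV dF FU [G [dG GF FG]]] cvx.
have bn0 : boundary Om !=set0 by exists p.
have VFp : V (F p) by rewrite -FU; exists p.
have [r1 [L1 [r10 L10 U1 lip1]]] := holo_locally_lipschitz oU Up dF.
have [r2 [L2 [r20 L20 V2 lip2]]] := holo_locally_lipschitz oV VFp dG.
pose L := Num.max 1 (Num.max L1 L2).
have L1' : 1 <= L by rewrite le_max lexx.
have LL1 : L1 <= L by rewrite !le_max lexx orbT.
have LL2 : L2 <= L by rewrite !le_max lexx !orbT.
have L0 : 0 < L by lra.
have lipF z z' : enorm (z - p) < r1 -> enorm (z' - p) < r1 ->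
    enorm (F z' - F z) <= L * enorm (z' - z).
  move=> h1 h2; apply: le_trans (lip1 z z' h1 h2) _.
  by rewrite ler_wpM2r ?enorm_ge0.
have lipG z z' : enorm (z - F p) < r2 -> enorm (z' - F p) < r2 ->
    enorm (G z' - G z) <= L * enorm (z' - z).
  move=> h1 h2; apply: le_trans (lip2 z z' h1 h2) _.
  by rewrite ler_wpM2r ?enorm_ge0.
pose s := Num.min 1 r2.
have s0 : 0 < s by rewrite lt_min ltr01.
have s1 : s <= 1 by rewrite ge_min lexx.
have sr2 : s <= r2 by rewrite ge_min lexx orbT.
(* The first entry puts a boundary point within [2 * r] of [x] into the ball of radius [r1]; the
   second keeps [F z], and the ball of radius [r] around it, within [s] of [F p], since [1 <= L]. *)
pose r := Num.min (r1 / 3) (s / (2 * L)).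
have r0 : 0 < r by rewrite lt_min !divr_gt0 // mulr_gt0.
have rr1 : r <= r1 / 3 by rewrite ge_min lexx.
have rs : r * (2 * L) <= s by rewrite -ler_pdivlMr ?mulr_gt0 // ge_min lexx orbT.
have rr1' : r < r1 by lra.
pose E := F @` (Om `&` U).
(* The unit ball bounds the diameter, as the separation requires. *)
pose D := E `&` [set w | enorm (w - F p) < 1].
have cD : cvx_set D.
  move=> a b [Ea Ba] [Eb Bb] t t01; split; first exact: cvx.
  exact: cvx_set_ball.
have D_diam u u' : D u -> D u' -> enorm (u - u') <= 2.
  move=> [_ /= h1] [_ /= h2]; have := ler_enorm_dist u (F p) u'.
  rewrite [enorm (F p - u')]enormBC; lra.
have Fz1 z : enorm (z - p) < r -> enorm (F z - F p) <= L * r.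
  move=> zr; apply: le_trans (lipF p z _ _) _.
  - by rewrite subrr enorm0.
  - by apply: lt_trans zr _.
  by rewrite ler_wpM2l ?(ltW L0) // ltW.
have DF z : Om z -> enorm (z - p) < r -> D (F z).
  move=> Oz zr; split; last by have := Fz1 z zr => /= ?; nra.
  by exists z => //; split => //; apply: U1; apply: lt_trans zr _.
have ball_D z w : Om z -> enorm (z - p) < r ->
    enorm (w - F z) < bdist Om z / L -> D w.
  move=> Oz zr hw.
  have bz : bdist Om z < r by apply: le_lt_trans (bdist_le z bp) zr.
  have b0 := bdist_gt0 Om_open bn0 Oz.
  have wz : enorm (w - F z) < r.
    apply: lt_trans hw _; rewrite ltr_pdivrMr //; nra.
  have wp : enorm (w - F p) < s.
    have := ler_enorm_dist w (F z) (F p); have := Fz1 z zr; nra.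
  have Vw : V w by apply: V2; apply: lt_le_trans wp _.
  have Fzp : enorm (F z - F p) < r2 by have := Fz1 z zr; nra.
  have Uz : U z by apply: U1; apply: lt_trans zr _.
  have OG : Om (G w).
    apply: (bdist_ball Om_open Oz).
    have := lipG (F z) w Fzp (lt_le_trans wp sr2); rewrite GF //.
    move=> /le_lt_trans; apply; rewrite mulrC -ltr_pdivlMr //.
  split; last by apply: lt_le_trans wp _.
  exists (G w); last exact: FG.
  by split => //; have := Vw; rewrite -FU => -[u Uu <-]; rewrite GF.
(* Covers three bounds: [2 + 4 * L * bdist Om x <= 4] for the size of [Re (h z)], the ratio [2 * L]
   of [bdist Om z] to [Re (h z)], and the ratio [4 * L] at [x]. *)
pose C := 4 * L + 4.
have C0 : 0 < C by rewrite /C; lra.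
exists r, C; split => // x Ox xr.
have bx0 := bdist_gt0 Om_open bn0 Ox.
have [b bb hb] := bdist_approx bn0 x bx0.
have bxr : bdist Om x < r by apply: le_lt_trans (bdist_le x bp) xr.
have bpr : enorm (b - p) < r1.
  have := ler_enorm_dist b x p; rewrite [enorm (b - x)]enormBC; lra.
(* As [D] contains the ball of radius [bdist Om x / L] about [F x] and [F b] is not
   in [E], the reflection of [F x] through [F b] is that far from [D]. *)
pose v := F b + F b - F x.
have FbE : ~ E (F b).
  move=> [u [Ou Uu] Fu]; case: bb => _; apply.
  by rewrite -(GF b (U1 b bpr)) -Fu GF.
have vD u : D u -> bdist Om x / L <= enorm (u - v).
  move=> Du; rewrite leNgt; apply/negP => huv; apply: FbE.
  have Dd : D (F b + F b - u).
    apply: (ball_D x) => //; rewrite enormBC; congr (enorm _ < _): huv.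
    by rewrite /v; apply/rowP => i; rewrite !mxE; ring.
  have half01 : 0 <= (2^-1 : R) <= 1 by lra.
  have := cvx _ _ Du.1 Dd.1 2^-1 half01; congr (E _).
  have h2 : 1 - 2^-1 = 2^-1 :> R by lra.
  have c2 : ((2^-1)%:C)%C + ((2^-1)%:C)%C = 1 :> CC R.
    by rewrite -rmorphD -[LHS]/(((2^-1 + 2^-1)%:C)%C); congr (_%:C)%C; lra.
  rewrite h2 /rscale; apply/rowP => i; rewrite !mxE.
  rewrite -[RHS]mul1r -c2; ring.
have Dx : D (F x) by exact: DF.
have [a [a1 ha]] := convex_separation cD (ex_intro _ _ Dx) (divr_gt0 bx0 L0) vD D_diam.
have xb : enorm (F x - F b) <= 2 * L * bdist Om x.
  have xr1 : enorm (x - p) < r1 by apply: lt_trans xr _.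
  have := lipF b x bpr xr1; nra.
have xv : enorm (F x - v) <= 4 * L * bdist Om x.
  have -> : F x - v = (F x - F b) + (F x - F b).
    by rewrite /v; apply/rowP => i; rewrite !mxE; ring.
  have := ler_enormD (F x - F b) (F x - F b); lra.
exists (half_plane_functional a v F); split.
  move=> z Oz zr; have Uz : U z by apply: U1; apply: lt_trans zr _.
  rewrite !Re_half_plane_functional.
  have bz0 := bdist_gt0 Om_open bn0 Oz.
  split.
  - by apply: differentiable_half_plane_functional; exact: dF.
  - by apply: ha; exact: DF.
  - apply: le_trans (rinner_le _ _) _; rewrite a1 mulr1.
    have := ler_enorm_dist (F z) (F x) v.
    have := D_diam _ _ (DF z Oz zr) Dx.
    rewrite /C; nra.
  (* Moving [F z] by [k] against [a] stays in [D], where the functional is positive; hence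
     [k < Re (h z)]. *)
  pose k := bdist Om z / (2 * L).
  have k0 : 0 < k by rewrite divr_gt0 // mulr_gt0.
  have Dk : D (F z - rscale k a).
    apply: (ball_D z) => //; rewrite addrAC subrr sub0r enormN enorm_rscale a1.
    rewrite mulr1 gtr0_norm // /k invfM mulrA ltr_pM2r ?invr_gt0 //; lra.
  have := ha _ Dk.
  have -> : F z - rscale k a - v = (F z - v) + rscale (- k) a.
    by rewrite addrAC /rscale rmorphN scaleNr.
  rewrite (rinnerDl (F z - v)) rinnerZl -sqr_enorm a1 expr1n mulr1 subr_gt0 => kr.
  have : bdist Om z = k * (2 * L) by rewrite /k mulfVK // gt_eqF // mulr_gt0.
  rewrite /C; nra.
rewrite Re_half_plane_functional; apply: le_trans (rinner_le _ _) _.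
rewrite a1 mulr1; apply: le_trans xv _; rewrite ler_wpM2r ?(ltW bx0) // /C; lra.
Qed.

End Chart.

(** * The estimate near a boundary point *)

Section PoincareExp.
Context {R : realType}.

Lemma expR_pdist0 (z : CC R) (K : R) :
  expR (K * pdist0 z) = expR (K / 2 * ln ((1 + cabs z) / (1 - cabs z))).
Proof. by rewrite /pdist0 mulrA. Qed.

Variables (b c : R).
Hypotheses (b0 : 0 < b) (c0 : 0 < c).

(* A primitive of [1 / (u (1 + c u^b))]. *)
Definition damped_ln (u : R) : R := ln u - b^-1 * ln (1 + c * expR (b * ln u)).

Let den_gt0 (u : R) : 0 < 1 + c * expR (b * ln u).
Proof. by rewrite addr_gt0 // mulr_gt0 // expR_gt0. Qed.

Lemma is_derive_damped_ln (u : R) : 0 < u ->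
  is_derive u (1 : R) damped_ln (u^-1 / (1 + c * expR (b * ln u))).
Proof.
move=> u0; have d0 := den_gt0 u.
have l1 : is_derive u (1 : R) (@ln R) u^-1 by exact: is_derive1_ln.
have l2 : is_derive u (1 : R) (b *: @ln R) (b *: u^-1) by exact: is_deriveZ.
have l3 : is_derive u (1 : R) (expR \o (b *: @ln R))
    (expR (b * ln u) * (b *: u^-1)).
  by apply: is_derive1_comp; exact: is_derive_expR.
have l4 : is_derive u (1 : R) (cst 1 + c *: (expR \o (b *: @ln R)))
    (0 + c *: (expR (b * ln u) * (b *: u^-1))).
  exact: is_deriveD.
have l5 : is_derive u (1 : R) (@ln R \o (cst 1 + c *: (expR \o (b *: @ln R))))
    ((1 + c * expR (b * ln u))^-1 * (0 + c *: (expR (b * ln u) * (b *: u^-1)))).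
  by apply: is_derive1_comp; exact: is_derive1_ln.
have l6 : is_derive u (1 : R) (b^-1 *: (@ln R \o (cst 1 + c *: (expR \o (b *: @ln R)))))
    (b^-1 *: ((1 + c * expR (b * ln u))^-1 *
              (0 + c *: (expR (b * ln u) * (b *: u^-1))))).
  exact: is_deriveZ.
have l7 := is_deriveB l1 l6.
apply: (is_derive_eq l7).
rewrite -[LHS]/(u^-1 - b^-1 * ((1 + c * expR (b * ln u))^-1 *
              (0 + c * (expR (b * ln u) * (b * u^-1))))).
by field; rewrite !gt_eqF.
Qed.

Lemma damped_ln_le (u : R) : damped_ln u <= ln u.
Proof.
rewrite gerBl mulr_ge0 ?invr_ge0 ?(ltW b0) // ln_ge0 // lerDl.
by rewrite mulr_ge0 ?expR_ge0 // ltW.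
Qed.

Lemma damped_ln_ge (u M : R) : 0 < u -> u <= M ->
  ln u - b^-1 * ln (1 + c * expR (b * ln M)) <= damped_ln u.
Proof.
move=> u0 uM; rewrite lerD2l lerN2 ler_pM2l ?invr_gt0 // ler_ln ?posrE //.
rewrite lerD2l ler_pM2l // ler_expR ler_pM2l // ler_ln ?posrE //.
exact: lt_le_trans uM.
Qed.

End PoincareExp.

Section LocalEstimate.
Context {R : realType} {n : nat}.
Variables (Om : set (Cn R n)) (c0 : R) (w W : R -> R) (s0 Mb Bw : R).
Hypothesis c0_gt0 : 0 < c0.
Hypothesis w_gt0 : forall t : R, 0 < t -> 0 < w t.
Hypothesis Om_bdist_gt0 : forall z, Om z -> 0 < bdist Om z.
Hypothesis bdist_Mb : forall z, Om z -> bdist Om z <= Mb.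
Hypothesis speed : forall (phi : CC R -> Cn R n) (c : CC R),
  hol_disc Om phi -> cabs c < 1 ->
  c0 * ((1 - cabs c ^+ 2) * enorm ('D_1 phi c)) <= w (bdist Om (phi c)).
Hypothesis Bw_gt0 : 0 < Bw.
Hypothesis w_Bw : forall z, Om z -> w (bdist Om z) <= Bw.
Hypothesis s0_gt0 : 0 < s0.
Hypothesis W_incr : forall s a b : R, 0 < s -> s <= a -> a <= b -> b <= s0 ->
  w s * ((b - a) / b) <= W b - W a.
Hypothesis W_ge0 : forall s : R, 0 < s -> s <= s0 -> 0 <= W s.
Hypothesis W_small : forall e : R, 0 < e -> exists2 s1 : R, 0 < s1 <= s0 & W s1 <= e.

(** Where the modulus is below 1/2, the factor [1 - cabs c ^+ 2] is at least 1/2, so the bound on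
    [w] gives every disc Euclidean speed at most [K = 2 * Bw / c0]. *)
Lemma disc_displacement (d : R) : 0 < d -> exists2 alpha : R, 0 < alpha <= 2^-1 &
  forall phi, hol_disc Om phi -> forall zeta, cabs zeta < alpha ->
  enorm (phi zeta - phi 0) < d.
Proof.
move=> d0; pose K := 2 * Bw / c0.
have K0 : 0 < K by rewrite divr_gt0 // mulr_gt0.
pose alpha := Num.min 2^-1 (d / (2 * K)).
have a0 : 0 < alpha by rewrite lt_min invr_gt0 ltr0n divr_gt0 // mulr_gt0.
have a2 : alpha <= 2^-1 by rewrite ge_min lexx.
have K2 : 0 < 2 * K by rewrite mulr_gt0.
have aK : alpha * (2 * K) <= d by rewrite -(ler_pdivlMr _ _ K2) ge_min lexx orbT.
exists alpha; first by rewrite a0.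
move=> phi hphi zeta za; set m := cabs zeta in za *.
have m0 : 0 <= m by exact: cabs_ge0.
apply: le_lt_trans (_ : K * m < d); last by nra.
pose g (t : R) := phi ((t%:C)%C * zeta).
have := @mean_value_dist R (fun s t => enorm (g s - g t)) (K * m).
rewrite /g mul1r mul0r; apply.
- by move=> s; rewrite subrr enorm0.
- by move=> s t; rewrite enormBC.
- by move=> s t u; exact: ler_enorm_dist.
move=> t /andP[t0 t1] e e0.
have cc : cabs ((t%:C)%C * zeta) = t * m by rewrite cabsM cabs_real ger0_norm.
have ch : cabs ((t%:C)%C * zeta) < 2^-1 by rewrite cc; nra.
have c1 : cabs ((t%:C)%C * zeta) < 1 by lra.
have [dc oc] := hphi _ c1.
have hs := le_trans (speed hphi c1) (w_Bw oc).
have D0 := enorm_ge0 ('D_1 phi ((t%:C)%C * zeta)).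
have DK : enorm ('D_1 phi ((t%:C)%C * zeta)) <= K.
  rewrite /K ler_pdivlMr //.
  have : 2^-1 <= 1 - cabs ((t%:C)%C * zeta) ^+ 2.
    have := cabs_ge0 ((t%:C)%C * zeta); nra.
  move: (cabs _) hs => x hs xh.
  have := ler_wpM2l (ltW c0_gt0) (ler_wpM2r D0 xh); lra.
have [b b0 hb] := disc_local_lipschitz dc e0.
exists b => // s st.
have sz : cabs (((s - t)%:C)%C * zeta) = `|s - t| * m by rewrite cabsM cabs_real.
have := hb (((s - t)%:C)%C * zeta).
have -> : (t%:C)%C * zeta + ((s - t)%:C)%C * zeta = (s%:C)%C * zeta.
  by rewrite -mulrDl -rmorphD /= addrC subrK.
rewrite sz => h; have sm : `|s - t| * m <= `|s - t| by rewrite ler_piMr //; lra.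
apply: le_trans (h (le_lt_trans sm st)) _.
have X0 := normr_ge0 (s - t).
have q1 := ler_wpM2r (mulr_ge0 X0 m0) DK.
have q2 := ler_wpM2l (ltW e0) sm.
lra.
Qed.

Variables (p : Cn R n) (r C : R).
Hypotheses (r_gt0 : 0 < r) (C_gt0 : 0 < C).
Hypothesis chart : forall x, Om x -> enorm (x - p) < r -> exists h : Cn R n -> CC R,
    (forall z, Om z -> enorm (z - p) < r ->
       [/\ differentiable h z, 0 < Re (h z), Re (h z) <= C &
           bdist Om z <= C * Re (h z)]) /\
    Re (h x) <= C * bdist Om x.

(** Makes room for nested radii around [p]: chains start within [r / 4] and are followed within
    [r / 2]; a disc starting there is followed within [r / 2 + d], and one more displacement by [d]
    still lies in [U]. *)
Let d := r / 4.
Let d_gt0 : 0 < d. Proof. by rewrite divr_gt0. Qed.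
Let U : set (Cn R n) := [set z | enorm (z - p) < r].

Let near_U (x z : Cn R n) (k : R) :
  enorm (x - p) < k -> enorm (z - x) < d -> enorm (z - p) < k + d.
Proof. by have := ler_enorm_dist z x p; lra. Qed.

(* First conclusion: localization radius [alpha]. Second conclusion: a disc needs
   Poincare time about [(alpha / 2) * ln (1 / bdist)] to leave [U]. *)
Lemma crude_localization : exists alpha s1 : R,
  [/\ 0 < alpha <= 2^-1, 0 < s1,
    forall psi, hol_disc Om psi -> enorm (psi 0 - p) < r / 2 + d ->
      forall xi, cabs xi < alpha -> U (psi xi) &
    forall psi, hol_disc Om psi -> enorm (psi 0 - p) < r / 2 ->
      forall xi, disc xi ->
      2 * (C ^+ 2 * bdist Om (psi 0)) * expR (2 / alpha * pdist0 xi) <= s1 ->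
      U (psi xi)].
Proof.
have [alpha a01 ha] := disc_displacement d_gt0.
have /andP[a0 a2] := a01.
(* The half-plane Schwarz rate 2 divided by the localization radius; here [G] is [ln]. *)
pose K := 2 / alpha.
have K0 : 0 < K by rewrite divr_gt0.
have Kc : 0 < K * c0 by rewrite mulr_gt0.
have [s1 /andP[s10 s1s0] Ws1] := W_small (divr_gt0 (mulr_gt0 Kc d_gt0) (ltr0n R 2)).
have loc psi : hol_disc Om psi -> enorm (psi 0 - p) < r / 2 + d ->
      forall xi, cabs xi < alpha -> U (psi xi).
  move=> hpsi h0 xi hxi; have := near_U h0 (ha psi hpsi xi hxi).
  by rewrite /U /= /d; lra.
exists alpha, s1; split => // psi hpsi h0 xi xi1 hs1.
have d0 : disc (0 : CC R) by rewrite /disc /= cabs0 ltr01.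
have [_ Ox] := hpsi 0 d0; set x := psi 0 in h0 hs1 Ox.
have xr : enorm (x - p) < r by apply: lt_trans h0 _; move: r_gt0; lra.
have [h [hh hx]] := chart Ox xr.
have bx0 := Om_bdist_gt0 Ox.
(* One factor [C] from [bdist Om z <= C * Re (h z)], the other from [Re (h x) <= C * bdist Om x]. *)
have A0 : 0 < C ^+ 2 * bdist Om x by rewrite mulr_gt0 // exprn_gt0.
have in_r z : enorm (z - x) < d -> enorm (z - p) < r.
  by move=> zx; apply: lt_trans (near_U h0 zx) _; rewrite /d; move: r_gt0; lra.
have h_holo z : Om z -> U z -> differentiable h z /\ 0 < Re (h z).
  by move=> Oz Uz; have [] := hh z Oz Uz.
have rho_loc z : Om z -> enorm (z - x) < d -> 0 < alpha <= 1 /\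
    forall psi, hol_disc Om psi -> psi 0 = z ->
     forall xi, cabs xi < alpha -> U (psi xi).
  move=> Oz zx; split; first by rewrite a0; lra.
  by move=> psi' hpsi' psi0; apply: (loc _ hpsi'); rewrite psi0; exact: (near_U h0 zx).
have dGP (u : R) : 0 < u -> is_derive u (1 : R) (@ln R) u^-1 /\ 0 <= u^-1.
  by move=> u0; split; [exact: is_derive1_ln|rewrite invr_ge0 ltW].
have dG_rho z : Om z -> enorm (z - x) < d ->
    (Re (h z))^-1 * (2 * Re (h z)) <= K * alpha.
  move=> Oz zx; have [_ u0 _ _] := hh z Oz (in_r z zx).
  by rewrite mulrCA mulVf ?gt_eqF // mulr1 /K mulfVK // gt_eqF.
have bdist_G z : Om z -> enorm (z - x) < d -> forall tau : R,
    ln (Re (h z)) <= ln (Re (h x)) + K * tau ->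
    bdist Om z <= C ^+ 2 * bdist Om x * expR (K * tau).
  move=> Oz zx tau; have [_ u0 _ ub] := hh z Oz (in_r z zx).
  have [_ ux0 _ _] := hh x Ox xr.
  rewrite -ler_expR expRD !lnK ?posrE // => hu.
  apply: le_trans ub _; apply: le_trans (ler_wpM2l (ltW C_gt0) hu) _.
  have -> : C ^+ 2 * bdist Om x * expR (K * tau)
     = C * (C * bdist Om x * expR (K * tau)) by ring.
  by rewrite ler_pM2l // ler_wpM2r // expR_ge0.
have as1 : 2 * (C ^+ 2 * bdist Om x) * expR (K * (0 + pdist_radial (cabs xi) 1)) <= s1.
  by rewrite pdist_radial1 add0r.
have kap0 : 0 < (K * c0)^-1 by rewrite invr_gt0.
have Ws1d : (K * c0)^-1 * W s1 < d.
  have kd := mulr_gt0 Kc d_gt0.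
  rewrite -(ltr_pM2l Kc) mulrA divff ?gt_eqF // mul1r; move: Ws1 kd; lra.
have as0 : 2 * (C ^+ 2 * bdist Om x) <= s1.
  have e1 : 1 <= expR (K * pdist0 xi).
    by rewrite -[leLHS]expR0 ler_expR mulr_ge0 ?(ltW K0) // pdist0_ge0.
  by apply: le_trans hs1; rewrite ler_peMr // mulr_ge0 // ltW.
have A20 : 0 < 2 * (C ^+ 2 * bdist Om x) by rewrite mulr_gt0.
have [] := propagation c0_gt0 w_gt0 Om_bdist_gt0 speed W_incr K0 A0 h_holo rho_loc
  dGP dG_rho bdist_G hpsi xi1 s1s0 Ws1d as1.
- rewrite mulr0 expR0 mulr1 -/x subrr enorm0 mulr_ge0 ?(ltW kap0) //.
  by apply: W_ge0 => //; exact: le_trans s1s0.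
- by rewrite mulr0 addr0.
rewrite add0r => h1 _; apply: in_r; apply: le_lt_trans h1 _.
apply: le_lt_trans Ws1d; rewrite ler_pM2l // -subr_ge0.
have a3 : 0 < 2 * (C ^+ 2 * bdist Om x) * expR (K * pdist0 xi).
  by rewrite mulr_gt0 // expR_gt0.
apply: le_trans (W_incr a3 (lexx _) hs1 s1s0).
rewrite mulr_ge0 ?(ltW (w_gt0 a3)) // divr_ge0 ?subr_ge0 //; exact: ltW.
Qed.

Definition disc_chain (m : nat) (z : nat -> Cn R n) (zeta : nat -> CC R)
    (phi : nat -> CC R -> Cn R n) : Prop :=
  forall j, (j < m)%N -> [/\ hol_disc Om (phi j), disc (zeta j),
    phi j 0 = z j & phi j (zeta j) = z j.+1].

Lemma local_estimate : exists2 c : R, 0 < c &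
  forall m z zeta phi, disc_chain m z zeta phi -> Om (z 0%N) -> Om (z m) ->
  enorm (z 0%N - p) < d ->
  2^-1 * ln (bdist Om (z m) / bdist Om (z 0%N)) - c <= \sum_(j < m) pdist0 (zeta j).
Proof.
have [alpha [s1 [/andP[a0 a2] s10 loc1 loc2]]] := crude_localization.
(* Below, [Q] and [y u] are the powers of [q] and [u] with exponent [alpha]. An exponential factor
   at most [q / u] then meets the condition of [loc2], because [2 * C ^+ 3 * q = s1]. *)
pose q := s1 / (2 * C ^+ 3).
have q0 : 0 < q by rewrite divr_gt0 // mulr_gt0 // exprn_gt0.
pose Q := expR (alpha * ln q).
have Q0 : 0 < Q by exact: expR_gt0.
pose T := alpha^-1.
have T0 : 0 < T by rewrite invr_gt0.
pose C2 := 2 * (1 + T) / Q.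
have C20 : 0 < C2 by rewrite divr_gt0 // mulr_gt0 // addr_gt0.
pose y (u : R) := expR (alpha * ln u).
have y0 u : 0 < y u by exact: expR_gt0.
have den0 u : 0 < 1 + C2 * y u by rewrite addr_gt0 // mulr_gt0.
pose rho (h : Cn R n -> CC R) (z : Cn R n) := (1 + C2 * y (Re (h z)))^-1.
(* If [T <= C2 * y u], the radius is at most [alpha] and [loc1] applies. Otherwise
   [1 - cabs xi >= C2 * y u / (1 + T)], so that [X <= 2 / (1 - cabs xi) <= Q / y u]; [C2] is chosen
   for this. *)
have loc (u : R) psi : hol_disc Om psi -> enorm (psi 0 - p) < r / 2 ->
    0 < u -> bdist Om (psi 0) <= C * u ->
    forall xi, cabs xi < (1 + C2 * y u)^-1 -> U (psi xi).
  move=> hpsi hz u0 bu xi hxi.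
  have [small|large] := leP T (C2 * y u).
    apply: loc1 => //; first by move: hz d_gt0; lra.
    apply: lt_le_trans hxi _; rewrite -[leRHS]invrK lef_pV2 ?posrE ?invr_gt0 //.
    by apply: le_trans small _; rewrite lerDr.
  have m1 : cabs xi < 1.
    apply: lt_le_trans hxi _; rewrite invf_le1 // lerDl.
    by rewrite mulr_ge0 ?(ltW (y0 u)) // ltW.
  apply: loc2 => //.
  have m0 := cabs_ge0 xi.
  rewrite expR_pdist0.
  have -> : 2 / alpha / 2 = alpha^-1 by field; rewrite gt_eqF.
  set X := (1 + cabs xi) / (1 - cabs xi).
  have X0 : 0 < X by rewrite divr_gt0 //; lra.
  have XQ : X <= Q / y u.
    have mm : cabs xi * (1 + C2 * y u) < 1 by rewrite -ltr_pdivlMr // mul1r.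
    have C2y : C2 * y u * Q = 2 * (1 + T) * y u.
      by rewrite /C2; field; rewrite gt_eqF.
    have C2y0 : 0 < C2 * y u by rewrite mulr_gt0.
    have k0 : C2 * y u / (1 + T) <= 1 - cabs xi.
      rewrite ler_pdivrMr ?addr_gt0 //; nra.
    rewrite ler_pdivlMr // /X mulrAC ler_pdivrMr; last by lra.
    have h1 : Q * (C2 * y u / (1 + T)) <= Q * (1 - cabs xi) by rewrite ler_pM2l.
    have h2 : Q * (C2 * y u / (1 + T)) = 2 * y u.
      by rewrite mulrA [Q * _]mulrC C2y mulrAC mulfK // gt_eqF // addr_gt0.
    rewrite h2 in h1; have := y0 u; nra.
  have lnX : alpha^-1 * ln X <= ln q - ln u.
    rewrite mulrC ler_pdivrMr //.
    have lQ : ln (Q / y u) = alpha * ln q - alpha * ln u.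
      by rewrite ln_div ?posrE // /Q /y !expRK.
    have : ln X <= ln (Q / y u) by rewrite ler_ln // posrE divr_gt0.
    by rewrite lQ mulrBl ![_ * alpha]mulrC.
  have eX : expR (alpha^-1 * ln X) <= q / u.
    have -> : q / u = expR (ln q - ln u) by rewrite expRB !lnK.
    by rewrite ler_expR.
  have C2b : 2 * (C ^+ 2 * bdist Om (psi 0)) <= 2 * (C ^+ 2 * (C * u)).
    by rewrite ler_pM2l // ler_pM2l // exprn_gt0.
  have Cu : 0 <= 2 * (C ^+ 2 * (C * u)).
    by rewrite !mulr_ge0 ?exprn_ge0 ?(ltW C_gt0) // ltW.
  apply: le_trans (ler_wpM2r (expR_ge0 _) C2b) _.
  apply: le_trans (ler_wpM2l Cu eX) _.
  rewrite le_eqVlt; apply/orP; left; apply/eqP.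
  by rewrite /q; field; rewrite !gt_eqF.
pose Y := y C.
(* The factor lost between [damped_ln] and [ln] for values up to [C]. It enters when [bdist] is read
   off at a point and does not accumulate along the chain. *)
pose B := expR (alpha^-1 * ln (1 + C2 * Y)).
have B0 : 0 < B by exact: expR_gt0.
pose A' := C ^+ 2 * B.
have A'0 : 0 < A' by rewrite mulr_gt0 // exprn_gt0.
have c20 : 0 < 2 * c0 by rewrite mulr_gt0.
have [s2 /andP[s20 s2s0] Ws2] := W_small (divr_gt0 (mulr_gt0 c20 d_gt0) (ltr0n R 2)).
have Ws2d : (2 * c0)^-1 * W s2 < d.
  have kd := mulr_gt0 c20 d_gt0.
  rewrite -(ltr_pM2l c20) mulrA divff ?gt_eqF // mul1r; move: Ws2 kd; lra.
pose M1 := Num.max 1 Mb.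
have M10 : 0 < M1 by rewrite lt_max ltr01.
(* The entries serve positivity, chains that cannot leave the chart, and chains of large Poincare
   length, in this order. *)
pose k := Num.max 1 (Num.max (ln A') (ln (2 * A' * M1 / s2))).
have k0 : 0 < k by rewrite lt_max ltr01.
have kA : ln A' <= k by rewrite !le_max lexx orbT.
have kM : ln (2 * A' * M1 / s2) <= k by rewrite !le_max lexx !orbT.
exists (2^-1 * k); first by rewrite mulr_gt0 // invr_gt0.
move=> m z zeta phi hc Ox Oy xd; set x := z 0%N in Ox xd *.
set tot := \sum_(j < m) pdist0 (zeta j).
have bx0 := Om_bdist_gt0 Ox; have by0 := Om_bdist_gt0 Oy.
suff H : bdist Om (z m) / bdist Om x <= expR (k + 2 * tot).
  have := H; rewrite -ler_ln ?posrE ?divr_gt0 ?expR_gt0 // expRK; lra.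
pose A := A' * bdist Om x.
have A0 : 0 < A by rewrite mulr_gt0.
have pd0 (j : 'I_m) : 0 <= pdist0 (zeta j).
  by apply: pdist0_ge0; have [] := hc j (ltn_ord j).
(* Either the Poincare time is so long that the bound on [bdist] by [Mb] suffices,
   or the chain cannot leave the chart. *)
have [far|close] := ltP s2 (2 * A * expR (2 * tot)).
  have h1 : bdist Om (z m) <= M1 by rewrite le_max bdist_Mb // orbT.
  rewrite expRD ler_pdivrMr //.
  have hk : 2 * A' * M1 / s2 <= expR k.
    rewrite -ler_ln ?posrE ?expR_gt0 ?expRK // divr_gt0 ?mulr_gt0 //.
  apply: le_trans h1 _.
  have h2 : M1 * s2 <= M1 * (2 * A * expR (2 * tot)) by rewrite ler_pM2l // ltW.
  have e0 : 0 < expR (2 * tot) by exact: expR_gt0.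
  have h3 : 2 * A' * M1 / s2 * (expR (2 * tot) * bdist Om x)
      <= expR k * (expR (2 * tot) * bdist Om x).
    by rewrite ler_pM2r // mulr_gt0.
  rewrite -mulrA; apply: le_trans h3.
  rewrite mulrAC ler_pdivlMr //; apply: le_trans h2 _.
  by rewrite le_eqVlt; apply/orP; left; apply/eqP; rewrite /A; ring.
have xr : enorm (x - p) < r by apply: lt_trans xd _; rewrite /d; move: r_gt0; lra.
have [h [hh hx]] := chart Ox xr.
have in_r v : enorm (v - x) < d -> enorm (v - p) < r / 2.
  by move=> vx; apply: lt_le_trans (near_U xd vx) _; rewrite /d; lra.
have in_r' v : enorm (v - x) < d -> enorm (v - p) < r.
  by move=> vx; apply: lt_trans (in_r v vx) _; move: r_gt0; lra.
have [_ ux0 _ _] := hh x Ox xr.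
have h_holo v : Om v -> U v -> differentiable h v /\ 0 < Re (h v).
  by move=> Ov Uv; have [] := hh v Ov Uv.
have rho_loc v : Om v -> enorm (v - x) < d -> 0 < rho h v <= 1 /\
    forall psi, hol_disc Om psi -> psi 0 = v ->
     forall xi, cabs xi < rho h v -> U (psi xi).
  move=> Ov vx; have [_ u0 _ ub] := hh v Ov (in_r' v vx).
  split.
    rewrite invr_gt0 den0 /= invf_le1 // lerDl.
    by rewrite mulr_ge0 ?(ltW (y0 _)) // ltW.
  move=> psi hpsi psi0 xi hxi; apply: (loc (Re (h v)) psi hpsi) => //.
    by rewrite psi0; exact: in_r.
  by rewrite psi0.
have dGP (u : R) : 0 < u ->
    is_derive u (1 : R) (damped_ln alpha C2) (u^-1 / (1 + C2 * y u)) /\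
    0 <= u^-1 / (1 + C2 * y u).
  move=> u0; split; first exact: is_derive_damped_ln.
  by rewrite divr_ge0 ?invr_ge0 ?ltW.
have dG_rho v : Om v -> enorm (v - x) < d ->
    (Re (h v))^-1 / (1 + C2 * y (Re (h v))) * (2 * Re (h v)) <= 2 * rho h v.
  move=> Ov vx; have [_ u0 _ _] := hh v Ov (in_r' v vx).
  rewrite le_eqVlt; apply/orP; left; apply/eqP; rewrite /rho.
  by field; rewrite (gt_eqF (den0 _)) (gt_eqF u0).
have bdist_G v : Om v -> enorm (v - x) < d -> forall tau : R,
    damped_ln alpha C2 (Re (h v)) <= damped_ln alpha C2 (Re (h x)) + 2 * tau ->
    bdist Om v <= A * expR (2 * tau).
  move=> Ov vx tau hG; have [_ u0 uC ub] := hh v Ov (in_r' v vx).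
  have g1 := damped_ln_ge a0 C20 u0 uC.
  have g2 := damped_ln_le a0 C20 (Re (h x)).
  have g3 : ln (Re (h v)) <= ln (Re (h x)) + (2 * tau + alpha^-1 * ln (1 + C2 * Y)).
    by move: g1 g2 hG; rewrite /Y /y; lra.
  move: g3; rewrite -ler_expR expRD !lnK ?posrE // expRD -/B => g3.
  apply: le_trans ub _; apply: le_trans (ler_wpM2l (ltW C_gt0) g3) _.
  have eB : 0 <= expR (2 * tau) * B by rewrite mulr_ge0 ?expR_ge0 // ltW.
  have := ler_wpM2l (ltW C_gt0) (ler_wpM2r eB hx).
  move=> /le_trans; apply; rewrite le_eqVlt; apply/orP; left; apply/eqP.
  by rewrite /A /A'; ring.
pose tau (j : nat) := \sum_(i < m | (i < j)%N) pdist0 (zeta i).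
have tau_le j : tau j <= tot.
  rewrite /tau /tot big_mkcond /=; apply: ler_sum => i _.
  by case: ifP => // _; exact: pd0.
have tauS j : (j < m)%N -> tau j.+1 = tau j + pdist0 (zeta j).
  move=> jm; rewrite /tau (bigD1 (Ordinal jm)) //= addrC; congr (_ + _).
  apply: eq_bigl => i; rewrite ltnS ltn_neqAle andbC; congr (_ && _).
have tau_s2 j : 2 * A * expR (2 * tau j) <= s2.
  apply: le_trans close; rewrite ler_pM2l ?mulr_gt0 // ler_expR ler_pM2l //.
have kap0 : 0 < (2 * c0)^-1 by rewrite invr_gt0.
have two0 : 0 < 2 :> R by [].
(* The function [h] chosen for the starting point [x] is kept along the whole chain, and the state
   at the end of one disc is the initial state of the next. *)
have state j : (j <= m)%N ->
    enorm (z j - x) <= (2 * c0)^-1 * W (2 * A * expR (2 * tau j)) /\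
    damped_ln alpha C2 (Re (h (z j))) <= damped_ln alpha C2 (Re (h x)) + 2 * tau j.
  elim: j => [|j ih] jm.
    have -> : tau 0%N = 0 by rewrite /tau big1.
    rewrite mulr0 expR0 mulr1 addr0 -/x subrr enorm0; split => //.
    rewrite mulr_ge0 ?(ltW kap0) //; apply: W_ge0; first by rewrite mulr_gt0.
    have := tau_s2 0%N; have -> : tau 0%N = 0 by rewrite /tau big1.
    by rewrite mulr0 expR0 mulr1 => /le_trans; apply.
  have [i1 i2] := ih (ltnW jm); have [hphi zj phi0 phi1] := hc j jm.
  have as1 : 2 * A * expR (2 * (tau j + pdist_radial (cabs (zeta j)) 1)) <= s2.
    by rewrite pdist_radial1 -tauS.
  rewrite -phi0 in i1 i2.
  have := propagation c0_gt0 w_gt0 Om_bdist_gt0 speed W_incr two0 A0 h_holo rho_loc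
    dGP dG_rho bdist_G hphi zj s2s0 Ws2d as1 i1 i2.
  by rewrite phi1 -tauS.
have [u1 u2] := state m (leqnn m).
have taum : tau m = tot.
  by rewrite /tau /tot; apply: eq_bigl => i; rewrite ltn_ord.
rewrite taum in u1 u2.
have zmx : enorm (z m - x) < d.
  apply: le_lt_trans u1 _; apply: le_lt_trans Ws2d; rewrite ler_pM2l // -subr_ge0.
  have a3 : 0 < 2 * A * expR (2 * tot) by rewrite !mulr_gt0 // expR_gt0.
  apply: le_trans (W_incr a3 (lexx _) close s2s0).
  rewrite mulr_ge0 ?(ltW (w_gt0 a3)) // divr_ge0 ?subr_ge0 //; exact: ltW.
have := bdist_G _ Oy zmx tot u2.
rewrite ler_pdivrMr // => /le_trans; apply.
have hk : A' <= expR k by rewrite -ler_ln ?posrE ?expR_gt0 ?expRK.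
by rewrite expRD /A mulrAC ler_pM2r // ler_pM2r // expR_gt0.
Qed.

End LocalEstimate.

(** * Compactness and chains *)

Section Compactness.
Context {R : realType} {n : nat}.

Lemma compact_square (M : R) :
  compact [set z : CC R | `|Re z| <= M /\ `|Im z| <= M].
Proof.
pose f (ab : R * R) : CC R := (ab.1 +i* ab.2)%C.
have -> : [set z : CC R | `|Re z| <= M /\ `|Im z| <= M]
    = f @` (`[- M, M] `*` `[- M, M]).
  apply/seteqP; split => [z [zR zI]|_ [[a b] /= [+ +] <-]] /=.
    exists (Re z, Im z); last by rewrite /f; case: (z).
    by split; rewrite /= in_itv /= -ler_norml.
  by rewrite !in_itv /= -!ler_norml.
apply: continuous_compact; last by apply: compact_setX; exact: segment_compact.
apply: continuous_subspaceT => -[a b]; apply/cvgrPdist_lt => _ /ltc_real_pos[e e0 ->].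
have e2 : 0 < e / 2 by rewrite divr_gt0.
exists (ball a (e / 2), ball b (e / 2)) => /=.
  by split; apply: nbhsx_ballx.
move=> [a' b'] [/= h1 h2]; rewrite norm_cabs ltcR.
apply: le_lt_trans (cabs_le_ReIm _) _; rewrite /f cReD cImD cReN cImN /=.
by move: h1 h2; rewrite /ball /=; lra.
Qed.

Lemma compact_closure_bounded (Om : set (Cn R n)) :
  Defs.bounded_set Om -> compact (closure Om).
Proof.
move=> [M hM].
pose K := [set v : Cn R n | forall i, [set z : CC R | `|Re z| <= M + 1 /\
   `|Im z| <= M + 1] (v ord0 i)].
apply: (@subclosed_compact _ _ K); first exact: closed_closure.
  apply: (@rV_compact (CC R) n (fun=> [set z : CC R | `|Re z| <= M + 1 /\
    `|Im z| <= M + 1])) => _; exact: compact_square.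
move=> v clv i /=.
have [|u [Ou uv]] := clv [set u | enorm (u - v) < 1].
  by apply/nbhs_CnP; exists 1.
have hv : enorm v <= M + 1.
  have := ler_enormD u (v - u); rewrite addrCA subrr addr0 enormBC.
  have := hM u Ou; rewrite /= in uv; lra.
have := le_trans (cabs_coord_le v i) hv; rewrite ord1 => h.
by split; apply: le_trans h; [exact: normr_Re_le|exact: normr_Im_le].
Qed.

End Compactness.

Section Chains.
Context {R : realType} {n : nat}.
Variable Om : set (Cn R n).

Definition joined (x y : Cn R n) : Prop := exists m z zeta phi,
  [/\ z 0%N = x, z m = y & disc_chain Om m z zeta phi].

Lemma joined_refl x : joined x x.
Proof. by exists 0%N, (fun=> x), (fun=> 0), (fun _ _ => x); split. Qed.

Lemma joined_step x y y' (phi : CC R -> Cn R n) (zeta : CC R) : joined x y ->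
  hol_disc Om phi -> disc zeta -> phi 0 = y -> phi zeta = y' -> joined x y'.
Proof.
move=> [m [z [ze [ph [z0 zm hc]]]]] hphi dz p0 p1.
exists m.+1, (fun j => if (j <= m)%N then z j else y'),
  (fun j => if (j < m)%N then ze j else zeta),
  (fun j => if (j < m)%N then ph j else phi); split => //.
  by rewrite ltnn.
move=> j; rewrite ltnS leq_eqVlt => /predU1P[->|jm].
  by rewrite eqxx ltnn /=; split => //; rewrite p0.
by have := hc j jm; rewrite /= jm orbT.
Qed.

(** The complex line through both points, scaled so that [y'] sits at 1/2; its radius
    [2 * enorm (y' - y)] is below [e]. *)
Lemma affine_disc (y y' : Cn R n) (e : R) :
  (forall u, enorm (u - y) < e -> Om u) -> enorm (y' - y) < e / 2 ->
  exists (phi : CC R -> Cn R n) (zeta : CC R),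
    [/\ hol_disc Om phi, disc zeta, phi 0 = y & phi zeta = y'].
Proof.
move=> hy hyy'; pose k : CC R := (2%:C)%C.
have k0 : k != 0 by rewrite -cabs_gt0 cabs_real normr_gt0.
exists (fun xi => y + xi *: (k *: (y' - y))), k^-1; split.
- move=> xi xi1; split.
    apply: differentiableD; first exact: differentiable_cst.
    apply: differentiableZl; apply/derivable1_diffP; exact: derivable_id.
  apply: hy; rewrite addrAC subrr add0r !enorm_scale cabs_real gtr0_norm //.
  have := enorm_ge0 (y' - y); have := cabs_ge0 xi; move: xi1; rewrite /disc /=.
  move: (enorm _) (cabs xi) hyy' => X Y; nra.
- by rewrite /disc /= cabsV cabs_real gtr0_norm // invf_lt1 // ltr1n.
- by rewrite scale0r addr0.
- by rewrite scalerA mulVf // scale1r addrC subrK.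
Qed.

(** Ensures that the infimum in [kdist] runs over a nonempty set, [inf set0] being 0. The points of
    [Om] reached from [x] and those not reached form two open sets, and [Om] is connected. *)
Lemma domain_joined x y : domain Om -> Om x -> Om y -> joined x y.
Proof.
move=> [oO [cO _]] Ox Oy.
pose B := [set u | Om u /\ joined x u].
pose D := [set u | Om u /\ ~ joined x u].
have oB : open B.
  rewrite openE => u [Ou ju]; apply/nbhs_CnP.
  have [e e0 he] := openCnP oO Ou.
  exists (e / 2); first by rewrite divr_gt0.
  move=> u' hu; have [phi [zeta [h1 h2 h3 h4]]] := affine_disc he hu.
  split; last exact: joined_step ju h1 h2 h3 h4.
  by rewrite -h4; exact: (h1 _ h2).2.
have oD : open D.
  rewrite openE => u [Ou ju]; apply/nbhs_CnP.
  have [e e0 he] := openCnP oO Ou.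
  exists (e / 4); first by rewrite divr_gt0.
  move=> u' hu.
  have e4 : e / 4 < e by lra.
  split; first by apply: he; apply: lt_trans hu e4.
  move=> ju'; apply: ju.
  have he' v : enorm (v - u') < e / 2 -> Om v.
    move=> hv; apply: he; have := ler_enorm_dist v u' u; lra.
  have hu' : enorm (u - u') < e / 2 / 2 by rewrite enormBC; lra.
  have [phi [zeta [h1 h2 h3 h4]]] := affine_disc he' hu'.
  exact: joined_step ju' h1 h2 h3 h4.
have BO : B = Om.
  apply: cO.
  - by exists x; split => //; exact: joined_refl.
  - by exists B => //; apply/seteqP; split => [u [Ou ju]|u [_ []]].
  exists (~` D); first exact: open_closedC.
  apply/seteqP; split => [u [Ou ju]|u [Ou nD]].
    by split => // -[].
  by split => //; apply: contrapT => nj; apply: nD.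
by have [] : B y by rewrite BO.
Qed.

End Chains.

Theorem theorem4p9 (R : realType) (n : nat) (Om : set (Cn R n)) :
  domain Om -> convexifiable Om -> strongly_goldilocks Om ->
  exists c : R, 0 < c /\
    forall x y, Om x -> Om y ->
      2^-1 * ln (bdist Om y / bdist Om x) - c <= kdist Om x y.
Proof.
move=> dO cvxO [bO _ [c0 [w [[c00 w0] hkr wdiv wln wint]]]].
have [oO _] := dO.
have chains (c : R) x y : Om x -> Om y ->
    (forall m z zeta phi, disc_chain Om m z zeta phi -> z 0%N = x -> z m = y ->
       2^-1 * ln (bdist Om y / bdist Om x) - c <= \sum_(j < m) pdist0 (zeta j)) ->
    2^-1 * ln (bdist Om y / bdist Om x) - c <= kdist Om x y.
  move=> Ox Oy h; apply: lb_le_inf.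
    have [m [z [zeta [phi [z0 zm hc]]]]] := domain_joined dO Ox Oy.
    by exists (\sum_(j < m) pdist0 (zeta j)); exists m, z, zeta, phi; split.
  by move=> _ [m [z [zeta [phi [z0 zm hc ->]]]]]; exact: h hc z0 zm.
have sum_ge0 m z zeta phi : disc_chain Om m z zeta phi ->
    0 <= \sum_(j < m) pdist0 (zeta j).
  move=> hc; apply: sumr_ge0 => j _; apply: pdist0_ge0.
  by have [] := hc j (ltn_ord j).
(* If the boundary is empty, then [bdist] is [inf set0 = 0] and [ln (0 / 0) = 0]. *)
have [bE|/set0P bN] := eqVneq (boundary Om) set0.
  exists 1; split => // x y Ox Oy; apply: chains => // m z zeta phi hc _ _.
  have b0 v : bdist Om v = 0 by rewrite /bdist bE image_set0 inf0.
  rewrite !b0 mul0r ln0 // mulr0 sub0r.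
  by apply: le_trans (sum_ge0 _ _ _ _ hc); rewrite oppr_le0.
have [M hM] := bO; have [b0 bb0] := bN.
pose Mb := Num.max 1 (M + enorm b0).
have Mb0 : 0 < Mb by rewrite lt_max ltr01.
have bMb v : Om v -> bdist Om v <= Mb.
  move=> Ov; apply: le_trans (bdist_le v bb0) _; rewrite le_max; apply/orP; right.
  have := ler_enormD v (- b0); rewrite enormN; have := hM v Ov; lra.
have bgt0 v : Om v -> 0 < bdist Om v := @bdist_gt0 _ _ _ oO bN v.
have [Bw Bw0 hBw] := goldilocks_bounded w0 wdiv wln Mb.
have [s0 [W [s00 Wincr W0 Wsmall]]] := goldilocks_primitive w0 wdiv wln wint.
have wO v : Om v -> 0 < w (bdist Om v) by move=> Ov; apply: w0; exact: bgt0.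
have wB v : Om v -> w (bdist Om v) <= Bw.
  by move=> Ov; apply: hBw; [exact: bgt0|exact: bMb].
have sp := disc_speed hkr wO.
(* With integer constants, a local bound holds for all large [k] near each point of the closure, the
   form in which compactness yields a single [k]. *)
pose P (k : nat) (x : Cn R n) := forall m z zeta phi, disc_chain Om m z zeta phi ->
  z 0%N = x -> Om x -> Om (z m) ->
  2^-1 * ln (bdist Om (z m) / bdist Om x) - k%:R <= \sum_(j < m) pdist0 (zeta j).
have Pmono (c : R) (N k : nat) x : c < N%:R -> (N <= k)%N ->
    (forall m z zeta phi, disc_chain Om m z zeta phi ->
      z 0%N = x -> Om x -> Om (z m) ->
      2^-1 * ln (bdist Om (z m) / bdist Om x) - c <= \sum_(j < m) pdist0 (zeta j)) ->
    P k x.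
  move=> cN Nk h m z zeta phi hc z0 Ox Oy; apply: le_trans (h _ _ _ _ hc z0 Ox Oy).
  rewrite lerD2l lerN2; apply: le_trans (ltW cN) _; by rewrite ler_nat.
have /compact_near_coveringP clK := compact_closure_bounded bO.
have [N _ hN] : \forall k \near \oo, closure Om `<=` P k.
  apply: (clK nat (nbhs \oo) P) => p clp.
  have [[r c] /= r0 h] : exists2 rc : R * R, 0 < rc.1 &
      forall x, enorm (x - p) < rc.1 ->
      forall m z zeta phi, disc_chain Om m z zeta phi ->
      z 0%N = x -> Om x -> Om (z m) ->
      2^-1 * ln (bdist Om (z m) / bdist Om x) - rc.2 <= \sum_(j < m) pdist0 (zeta j).
    have [Op|nOp] := pselect (Om p).
      have bp := bgt0 _ Op.
      (* Near an interior point [bdist] stays above half its value at [p], so this constant makes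
         the left-hand side nonpositive. *)
      exists (bdist Om p / 2, 2^-1 * ln (Mb / (bdist Om p / 2))) => /=.
        by rewrite divr_gt0.
      move=> x xp m z zeta phi hc _ Ox Oy; apply: le_trans (sum_ge0 _ _ _ _ hc).
      rewrite -mulrBr pmulr_rle0 ?invr_gt0 // subr_le0.
      have bx := bgt0 _ Ox; have by_ := bgt0 _ Oy.
      rewrite ler_ln ?posrE ?divr_gt0 //.
      apply: ler_pM; rewrite ?invr_ge0 ?(ltW bx) ?(ltW by_) //; first exact: bMb.
      rewrite lef_pV2 ?posrE ?divr_gt0 //.
      have := bdist_lipschitz bN p x; rewrite enormBC; lra.
    have bp : boundary Om p by [].
    have [U [V [F [Up bF cF]]]] := cvxO p bp.
    have [r [C [r0 C0 hr]]] := half_plane_chart oO bp Up bF cF.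
    have [c cc0 hc] := local_estimate c00 w0 bgt0 bMb sp Bw0 wB Wincr W0 Wsmall r0 C0 hr.
    exists (r / 4, c) => /=; first by rewrite divr_gt0.
    move=> x xp m z zeta phi hch z0 Ox Oy; rewrite -z0.
    by apply: (hc m z zeta phi hch) => //; rewrite z0.
  have cN := archi_boundP (normr_ge0 c).
  exists ([set x | enorm (x - p) < r], [set k | (Num.bound `|c| <= k)%N]) => /=.
    split; first by apply/nbhs_CnP; exists r.
    by exists (Num.bound `|c|).
  move=> [x k] [/= xp Nk]; apply: (Pmono c _ k x _ Nk); last exact: h xp.
  exact: le_lt_trans (ler_norm c) cN.
exists N.+1%:R; split; first exact: ltr0Sn.
move=> x y Ox Oy; apply: chains => // m z zeta phi hc z0 zm.
have := hN N.+1 (leqnSn N) x (subset_closure Ox) m z zeta phi hc z0 Ox.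
by rewrite zm; apply.
Qed.
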